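(* Let $m$ be a positive integer and let $\{G_{n,m}\}_{n}$ be the uniform attachment random graph with parameter $m$. Then $\{G_{n,m}\}$ obeys the $\mathrm{FO}^{m-2}$ convergence law: for every first-order sentence $\varphi$ about graphs that uses at most $m-2$ different variables, the probability $\Pr(G_{n,m}\models\varphi)$ converges as $n\to\infty$.
   Context: Uniform attachment random graph: for $n\ge m$, $G_{n,m}$ is a random graph on the vertex set $[n]=\{1,\dots,n\}$ generated recursively. $G_{m,m}$ is the complete graph on $[m]$. Given $G_{n,m}$, the graph $G_{n+1,m}$ is obtained by adding the new vertex $n+1$ together with $m$ edges joining it to $m$ different vertices of $[n]$, the $m$-element set of neighbours being chosen uniformly at random, independently of the previous steps. First-order (FO) sentences about graphs: sentences built from variables (representing vertices), logical connectives, the two binary relation symbols $\sim$ (adjacency) and $=$ (equality), and the quantifiers $\exists,\forall$ over vertices. ''At most $\gamma$ different variables'' means that at most $\gamma$ distinct variable symbols occur in the sentence; variables may be re-quantified (reused). $G\models\varphi$ means that $\varphi$ is true on the graph $G$. *)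

(* Defs.v *)
(* MathComp / MathComp-Analysis. *)
From mathcomp Require Import all_boot all_order all_algebra.
From mathcomp Require Import all_classical all_reals all_analysis.

Set Implicit Arguments.
Unset Strict Implicit.
Unset Printing Implicit Defensive.

Import Order.TTheory GRing.Theory Num.Theory.

Local Open Scope classical_set_scope.
Local Open Scope ring_scope.

(* Variable symbols are natural numbers. *)
Inductive fo : Type :=
  | FOeq of nat & nat
  | FOadj of nat & nat
  | FOnot of fo
  | FOand of fo & fo
  | FOor of fo & fo
  | FOimp of fo & fo
  | FOiff of fo & fo
  | FOex of nat & fo
  | FOall of nat & fo.

(* Includes the symbols that occur only next to a quantifier. *)
Fixpoint fo_vars (phi : fo) : seq nat :=
  match phi with
  | FOeq x y | FOadj x y => [:: x; y]
  | FOnot p => fo_vars p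
  | FOand p q | FOor p q | FOimp p q | FOiff p q => fo_vars p ++ fo_vars q
  | FOex x p | FOall x p => x :: fo_vars p
  end.

Definition fo_nb_vars (phi : fo) : nat := size (undup (fo_vars phi)).

Fixpoint fo_free (phi : fo) : seq nat :=
  match phi with
  | FOeq x y | FOadj x y => [:: x; y]
  | FOnot p => fo_free p
  | FOand p q | FOor p q | FOimp p q | FOiff p q => fo_free p ++ fo_free q
  | FOex x p | FOall x p => [seq y <- fo_free p | y != x]
  end.

Definition fo_sentence (phi : fo) : Prop := fo_free phi = [::].

Fixpoint fo_sat (T : finType) (e : rel T) (phi : fo) (env : nat -> T) : bool :=
  match phi with
  | FOeq x y => env x == env y
  | FOadj x y => e (env x) (env y)
  | FOnot p => ~~ fo_sat e p env
  | FOand p q => fo_sat e p env && fo_sat e q env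
  | FOor p q => fo_sat e p env || fo_sat e q env
  | FOimp p q => fo_sat e p env ==> fo_sat e q env
  | FOiff p q => fo_sat e p env == fo_sat e q env
  | FOex x p => [exists v : T, fo_sat e p [eta env with x |-> v]]
  | FOall x p => [forall v : T, fo_sat e p [eta env with x |-> v]]
  end.

(* For a sentence and a nonempty [T] the assignment is irrelevant. *)
Definition fo_models (T : finType) (e : rel T) (phi : fo) : Prop :=
  forall env : nat -> T, fo_sat e phi env.

(* The new vertex is [ord_max]; the old vertices are the [lift ord_max i]. *)
Definition add_vertex (n : nat) (e : rel 'I_n) (S : {set 'I_n}) :
    rel 'I_n.+1 :=
  fun i j => match unlift ord_max i, unlift ord_max j with
  | Some i', Some j' => e i' j'
  | Some i', None => i' \in S
  | None, Some j' => j' \in S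
  | None, None => false
  end.

(* The graph with [k + m] vertices, i.e. after [k] steps from the complete
   graph on [m] vertices.  [N n] is the neighbourhood given to the vertex that
   is added to an [n]-vertex graph; only its values for [m <= n] are used.
   Vertices are numbered from 0. *)
Fixpoint ua_graph (m : nat) (N : forall n, {set 'I_n}) (k : nat) :
    rel 'I_(k + m) :=
  match k return rel 'I_(k + m) with
  | 0 => fun i j => i != j
  | k'.+1 => add_vertex (@ua_graph m N k') (N (k' + m)%N)
  end.

(* [N n], for [n >= m], are mutually independent random sets, [N n] being
   uniform on the m-element subsets of the [n] existing vertices. *)
Record uniform_attachment (R : realType) (d : measure_display)
    (Omega : measurableType d) (P : probability Omega R) (m : nat)
    (N : forall n, Omega -> {set 'I_n}) : Prop := {
  ua_measurable : forall n (B : set {set 'I_n}), (m <= n)%N ->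
    measurable (N n @^-1` B) ;
  ua_uniform : forall n (S : {set 'I_n}), (m <= n)%N -> #|S| = m ->
    P (N n @^-1` [set S]) = (('C(n, m)%:R : R)^-1)%:E ;
  ua_independent : forall (J : seq nat) (B : forall n, set {set 'I_n}),
    uniq J -> all (leq m) J ->
    P (\bigcap_(n in [set` J]) (N n @^-1` B n)) =
      (\prod_(n <- J) P (N n @^-1` B n))%E
}.

(* The probability for the graph with [n = k + m] vertices. *)
Definition ua_prob (R : realType) (d : measure_display)
    (Omega : measurableType d) (P : probability Omega R) (m : nat)
    (N : forall n, Omega -> {set 'I_n}) (phi : fo) (k : nat) : R :=
  fine (P [set w : Omega | fo_models (@ua_graph m (fun n => N n w) k) phi]).

(* Main.v *)
(* Almost surely the truth value of [phi] on the graph with [n] vertices is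
   eventually constant, which gives convergence of the probabilities.

   Put [delta X = edges X - vertices X] for a finite set [X] of vertices; it is
   supermodular.  A set [X] containing [A] is rigid over [A] if every
   intermediate set has smaller [delta].  If [X] is rigid over [0, M), then each
   final segment of the vertices of [X] outside [0, M) sends more edges
   downwards than it has vertices; as a vertex [i] is joined to given earlier
   vertices with probability about [m / i], the expected number of such [X] of
   bounded size is finite.  Hence almost surely, over any finite set, only
   finitely many sets of bounded size are rigid.  Moreover every vertex has
   infinitely many neighbours almost surely.

   The rest is deterministic.  Take a finite core [C] containing all small sets
   rigid over the empty set and all small cycles of those isomorphism types
   that occur only finitely often.  In the pebble game on two large graphs of
   the sequence, Duplicator preserves an isomorphism between the bounded
   closures (unions of small rigid sets) of [C] and the pebbles.  A pebble near
   the old ones is reached by sliding it along a path, and at each step outside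
   the closure Duplicator needs a neighbour of its pebble outside the closure:
   by a degree count a vertex off the core has at most [gam + 1] neighbours in
   the closure of [gam] pebbles, while it has [m >= gam + 2] neighbours.  A far
   pebble is either isolated from the closure, or near a cycle, which has
   isomorphic copies far from the core and from the pebbles of Duplicator. *)

Require Import Defs.
From mathcomp Require Import all_boot all_order all_algebra.
From mathcomp Require Import finmap zify ring lra.
From mathcomp Require Import all_classical all_reals all_analysis.

Set Implicit Arguments.
Unset Strict Implicit.
Unset Printing Implicit Defensive.

Import Order.TTheory GRing.Theory Num.Theory.
Import numFieldNormedType.Exports.

(** All graphs of the sequence are induced on initial segments of one random graph [E] on the
    natural numbers. Both sides of the game therefore live in [E], and the core is fixed pointwise.
    The obstacle in the game is that a rigid set over a rigid set is again rigid only with the sizes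
    added. An isomorphism respecting rigid sets of size [l] after a move thus needs a larger level
    before it; [slide_level] and [ext_level] keep this account. A sentence has finitely many
    quantifiers, so one bound [Lam] suffices for it. The number of variables enters through the
    slack in a handshake count: in the relevant sets every vertex that is not a pebble has degree at
    least 2, so [gam] pebbles can account for only [gam] missing edge ends. In the probability
    estimate the surplus edge supplies a second factor [1/t] for sets with largest vertex [t]. The
    other vertices contribute sums of [1/i], hence powers of [log t], and the series of
    [(log t)^L / t^2] converges; [pi_weight] replaces the logarithms by a quantity that is easier to
    telescope. *)

Lemma fsubset_implyb (A B : {fset nat}) z : fsubset A B -> (z \in A) ==> (z \in B).
Proof. by move=> /fsubsetP AB; apply/implyP/AB. Qed.

Lemma fdisjoint_implyb (A B : {fset nat}) z : fdisjoint A B -> (z \in A) ==> (z \notin B).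
Proof. by move=> /fdisjointP AB; apply/implyP/AB. Qed.

Ltac bool_solve :=
  rewrite /is_true;
  repeat match goal with
  | |- context [@in_mem ?T ?y ?X] =>
      let b := fresh "b" in move: (@in_mem T y X) => b
  | |- context [@eq_op ?T ?y ?x] =>
      let b := fresh "b" in move: (@eq_op T y x) => b
  end;
  repeat match goal with
  | |- context [?b] => is_var b; match type of b with bool => destruct b end;
      cbn; try (intros; (reflexivity || discriminate))
  end; try (cbn; intros; (reflexivity || discriminate)).

Ltac fset_elim z :=
  repeat match goal with
  | H : is_true (fsubset _ _) |- _ => move: (fsubset_implyb z H); clear H
  | H : is_true (fdisjoint _ _) |- _ => move: (fdisjoint_implyb z H); clear H
  end;
  rewrite ?inE;
  repeat match goal with
  | |- context [z == ?y] => case: (eqVneq z y) => [->|_]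
  end;
  repeat match goal with
  | H : is_true (?y \in ?X) |- context [?y \in ?X] => rewrite H
  | H : is_true (?y \notin ?X) |- context [?y \in ?X] => rewrite (negbTE H)
  end; rewrite ?eqxx /=; bool_solve.

Ltac fset_tac :=
  let z := fresh "z" in
  lazymatch goal with
  | |- is_true (fsubset _ _) => apply/fsubsetP=> z; apply/implyP
  | |- is_true (fdisjoint _ _) => apply/fdisjointP=> z; apply/implyP
  | |- _ = _ => apply/fsetP=> z
  end; fset_elim z.

(* [lia] on the arithmetic hypotheses only: preprocessing the others is slow. *)
Ltac arith_lia :=
  repeat match goal with
  | H : ?T |- _ =>
      lazymatch T with
      | is_true (leq _ _) => revert H
      | is_true (@Order.le _ _ _ _) => revert H
      | is_true (@Order.lt _ _ _ _) => revert H
      | @eq nat _ _ => revert H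
      | @eq int _ _ => revert H
      | @eq (Equality.sort _) _ _ => revert H
      end
  end; clear; intros; lia.

(** * Rigid sets *)

Section Predimension.
Local Open Scope fset_scope.
Local Open Scope nat_scope.
Variable E : rel nat.
Hypothesis Esym : symmetric E.
Hypothesis Eirr : irreflexive E.

Definition deg (x : nat) (X : {fset nat}) : nat := \sum_(y <- X) E x y.
Definition cross (X Y : {fset nat}) : nat := \sum_(x <- X) deg x Y.
(* Ordered pairs are counted, so [del X] is twice [edges X - vertices X]. *)
Definition del (X : {fset nat}) : int := (cross X X)%:Z - (2 * #|` X|)%:Z.

Lemma sum_fsetUD (F : nat -> nat) (A B : {fset nat}) : [disjoint A & B] ->
  \sum_(x <- A `|` B) F x = \sum_(x <- A) F x + \sum_(x <- B) F x.
Proof.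
move=> dAB; rewrite (big_fsetID _ (mem A)) /=; congr addn; apply: eq_fbigl => x.
  by fset_elim x.
by fset_elim x.
Qed.

Lemma degU x A B : [disjoint A & B] -> deg x (A `|` B) = deg x A + deg x B.
Proof. exact: sum_fsetUD. Qed.

Lemma cross_sym A B : cross A B = cross B A.
Proof.
rewrite /cross /deg exchange_big /=; apply: eq_bigr => x _.
by apply: eq_bigr => y _; rewrite Esym.
Qed.

Lemma crossUl A B X : [disjoint A & B] ->
  cross (A `|` B) X = cross A X + cross B X.
Proof. exact: sum_fsetUD. Qed.

Lemma crossUr A B X : [disjoint A & B] ->
  cross X (A `|` B) = cross X A + cross X B.
Proof. by move=> dAB; rewrite cross_sym crossUl // !(cross_sym _ X). Qed.

Lemma card_fsetUD (A B : {fset nat}) : [disjoint A & B] ->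
  #|` A `|` B| = #|` A| + #|` B|.
Proof.
by move=> dAB; rewrite cardfsU (_ : A `&` B = fset0) ?cardfs0 ?subn0 //; fset_tac.
Qed.

Lemma delU A B : [disjoint A & B] ->
  del (A `|` B) = (del A + del B + (2 * cross A B)%:Z)%R.
Proof.
move=> dAB; rewrite /del crossUl // !crossUr // card_fsetUD //.
by rewrite (cross_sym B A); lia.
Qed.

Lemma cross1 x A : cross [fset x] A = deg x A.
Proof. by rewrite /cross big_seq_fset1. Qed.

Lemma del1 x : del [fset x] = (-2)%R.
Proof. by rewrite /del cross1 /deg big_seq_fset1 Eirr cardfs1. Qed.

Lemma del0 : del fset0 = 0%R.
Proof. by rewrite /del /cross big_seq_fset0 cardfs0. Qed.

Lemma delU1 x A : x \notin A -> del (x |` A) = (del A + (2 * deg x A)%:Z - 2)%R.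
Proof.
move=> xA; rewrite delU ?del1 ?cross1; first by lia.
by rewrite fdisjoint1X.
Qed.

Lemma sum_subset (F : nat -> nat) (A B : {fset nat}) : A `<=` B ->
  \sum_(x <- A) F x <= \sum_(x <- B) F x.
Proof.
move=> AB; rewrite (_ : B = A `|` (B `\` A)); last by fset_tac.
by rewrite sum_fsetUD ?leq_addr //; fset_tac.
Qed.

Lemma deg_subset x A B : A `<=` B -> deg x A <= deg x B.
Proof. exact: sum_subset. Qed.

Lemma cross_subset A B X : A `<=` B -> cross A X <= cross B X.
Proof. exact: sum_subset. Qed.

Lemma deg_gt0 x A y : y \in A -> E x y -> 0 < deg x A.
Proof. by move=> yA xy; rewrite /deg (big_fsetD1 y) //= xy. Qed.

Lemma deg_ge2 x A y z : y \in A -> z \in A -> y != z -> E x y -> E x z ->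
  1 < deg x A.
Proof.
move=> yA zA yz xy xz; rewrite /deg (big_fsetD1 y) //= xy.
by rewrite -/(deg x (A `\ y)) add1n ltnS; apply: (@deg_gt0 _ _ z); rewrite ?inE 1?eq_sym ?yz.
Qed.

Lemma deg_eq0 x A : (forall y, y \in A -> ~~ E x y) -> deg x A = 0.
Proof. by move=> H; apply: big1_fset => y yA _; rewrite (negbTE (H y yA)). Qed.

Lemma deg_le1 x A y : (forall z, z \in A -> E x z -> z = y) -> deg x A <= 1.
Proof.
move=> H; apply: leq_trans (deg_subset x (fsubsetU1 y A)) _.
rewrite (_ : y |` A = [fset y] `|` (A `\ y)); last by fset_tac.
rewrite degU; last by fset_tac.
rewrite [X in _ + X]deg_eq0 ?addn0; last first.
  move=> z; rewrite !inE => /andP[zy zA]; apply/negP => /(H _ zA) zz.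
  by rewrite zz eqxx in zy.
by rewrite /deg big_seq_fset1 leq_b1.
Qed.

Lemma cross_eq0 A B : (forall x y, x \in A -> y \in B -> ~~ E x y) -> cross A B = 0.
Proof. by move=> H; apply: big1_fset => x xA _; apply: deg_eq0 => y; apply: H. Qed.

Lemma del_sep A B : [disjoint A & B] ->
  (forall x y, x \in A -> y \in B -> ~~ E x y) -> del (A `|` B) = (del A + del B)%R.
Proof. by move=> dAB H; rewrite delU // cross_eq0 //= addr0. Qed.

(** The edges from the difference [Y] minus [X] to the intersection are among its edges to [X]. *)
Lemma del_supermod X Y : (del X + del Y <= del (X `|` Y) + del (X `&` Y))%R.
Proof.
have XUY : X `|` Y = X `|` (Y `\` X) by fset_tac.
have EY : Y = (X `&` Y) `|` (Y `\` X) by fset_tac.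
rewrite XUY delU; last by fset_tac.
rewrite [in X in (X <= _)%R]EY delU; last by fset_tac.
have : cross (X `&` Y) (Y `\` X) <= cross X (Y `\` X).
  by apply: cross_subset; fset_tac.
lia.
Qed.

(** Parity turns [-2 < del X] into [0 <= del X]; this is how a circuit is found near a far
    pebble. *)
Lemma del_even X : exists k : int, del X = (2 * k)%R.
Proof.
move: {2}#|` X| (erefl #|` X|) => n; elim: n X => [|n IHn] X.
  by move/cardfs0_eq => ->; exists 0%R; rewrite del0.
move=> cX; have /fset0Pn[x xX] : X != fset0 by rewrite -cardfs_gt0 cX.
rewrite -(fsetD1K xX) delU1 ?inE ?eqxx //.
have [|k ->] := IHn (X `\ x); first by move: cX; rewrite (cardfsD1 x) xX /=; lia.
by exists (k + (deg x (X `\ x))%:Z - 1)%R; lia.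
Qed.

Lemma del_imfset (f : nat -> nat) (X : {fset nat}) : {in X &, injective f} ->
  {in X &, forall x y, E (f x) (f y) = E x y} -> del (f @` X) = del X.
Proof.
move=> finj fE; rewrite /del card_in_imfset //=; congr (_%:Z - _)%R.
rewrite /cross big_imfset //= big_seq [RHS]big_seq; apply: eq_bigr => x xX.
rewrite /deg big_imfset //= big_seq [RHS]big_seq; apply: eq_bigr => y yX.
by rewrite fE.
Qed.

Definition rigid (A X : {fset nat}) : Prop :=
  A `<=` X /\ forall Y : {fset nat}, A `<=` Y -> Y `<` X -> (del Y < del X)%R.

Lemma rigid_refl A : rigid A A.
Proof.
split=> // Y AY; rewrite fproperE => /andP[_]; by rewrite AY.
Qed.

(* Submodularity of [- del]: joining a rigid set never decreases [del]. *)
Lemma rigid_join A X Y : rigid A X -> A `<=` Y ->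
  (del Y <= del (Y `|` X))%R /\ (~~ (X `<=` Y) -> del Y < del (Y `|` X))%R.
Proof.
move=> [AX rX] AY; have [XY|XY] := boolP (X `<=` Y).
  by split=> //; rewrite (fsetUidPl _ _ XY).
have lt1 : (del (Y `&` X) < del X)%R.
  by apply: rX; [fset_tac|rewrite fproperIr].
by have := del_supermod Y X; split=> [|_]; lia.
Qed.

(** An intermediate set climbs first by [X] and then by [X2]. By [rigid_join] neither step is a
    loss, and one of them is a strict gain because the set misses a vertex. *)
Lemma rigid_trans A A2 X X2 : rigid A X -> rigid A2 X2 -> A2 `<=` X ->
  rigid A (X `|` X2).
Proof.
move=> rX rX2 A2X; split; first by case: rX => AX _; fset_tac.
move=> Y AY; rewrite fproperE => /andP[YX nYX].
have [le1 lt1] := rigid_join rX AY.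
have A2Y : A2 `<=` Y `|` X by fset_tac.
have [le2 lt2] := rigid_join rX2 A2Y.
have eqYX : Y `|` X `|` X2 = X `|` X2 by fset_tac.
rewrite eqYX in le2 lt2.
have [XY|XY] := boolP (X `<=` Y); last by have := lt1 XY; lia.
have X2Y : ~~ (X2 `<=` Y `|` X).
  by apply: contra nYX => X2Y; fset_tac.
by have := lt2 X2Y; lia.
Qed.

Lemma rigidU A X X2 : rigid A X -> rigid A X2 -> rigid A (X `|` X2).
Proof. by move=> rX rX2; apply: (rigid_trans rX rX2); case: rX. Qed.

Lemma rigid_mono A B X : rigid A X -> A `<=` B -> rigid B (B `|` X).
Proof. by move=> rX AB; apply: (rigid_trans (rigid_refl B) rX). Qed.

Lemma rigid_deg A X x : rigid A X -> x \in X -> x \notin A -> 1 < deg x X.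
Proof.
move=> [AX rX] xX xA; have : (del (X `\ x) < del X)%R.
  by apply: rX; [fset_tac|exact: fproperD1].
rewrite -{2}(fsetD1K xX) delU1 ?inE ?eqxx //.
by have : deg x (X `\ x) <= deg x X := deg_subset _ (fsubsetDl _ _); lia.
Qed.

(* A set of least size among those of larger [del] is rigid. *)
Lemma exists_rigid_step A X Z : rigid A Z -> Z `<=` X ->
  (forall Y, Z `<=` Y -> Y `<=` X -> (del Y <= del Z)%R) \/
  exists Y, [/\ rigid A Y, Z `<` Y & Y `<=` X].
Proof.
move=> rZ ZX.
have [[Y [ZY YX dY]]|none] := pselect (exists Y, [/\ Z `<=` Y, Y `<=` X & (del Z < del Y)%R]); last first.
  left=> Y ZY YX; rewrite leNgt; apply/negP => dY; apply: none; by exists Y.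
right; move: {2}#|` Y| (leqnn #|` Y|) => n.
elim: n Y ZY YX dY => [|n IHn] Y ZY YX dY cY.
  have := fsubset_leq_card ZY; move: cY dY; rewrite leqn0 => /eqP cY.
  rewrite cY leqn0 => + /eqP cZ; by rewrite (cardfs0_eq cY) (cardfs0_eq cZ); lia.
have [[Y' [ZY' YY' dY']]|none] := pselect (exists Y', [/\ Z `<=` Y', Y' `<` Y & (del Z < del Y')%R]).
  apply: (IHn Y') => //; first exact: fsubset_trans (fproper_sub YY') YX.
  by have := fproper_ltn_card YY'; lia.
exists Y; split=> //; last first.
  rewrite fproperEneq ZY andbT; apply/eqP => ZEY; move: dY; rewrite ZEY; lia.
rewrite (_ : Y = Z `|` Y); last by fset_tac.
apply: (rigid_trans rZ _ (fsubset_refl Z)); split=> // Y' ZY' YY'.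
have : ~ (del Z < del Y')%R by move=> dY'; apply: none; exists Y'.
lia.
Qed.

(** Splits [X] into a part that the finiteness of rigid sets confines to an initial segment and a
    rest that adds at most as many edges as vertices. *)
Lemma exists_rigid_max A X : A `<=` X -> exists Z, [/\ rigid A Z, Z `<=` X &
  forall Y, Z `<=` Y -> Y `<=` X -> (del Y <= del Z)%R].
Proof.
move=> AX; suff main n Z : rigid A Z -> Z `<=` X -> #|` X| <= #|` Z| + n ->
    exists Z, [/\ rigid A Z, Z `<=` X &
      forall Y, Z `<=` Y -> Y `<=` X -> (del Y <= del Z)%R].
  by apply: (main #|` X| A) => //; [exact: rigid_refl|lia].
elim: n Z => [|n IHn] Z rZ ZX cZ.
  exists Z; split=> // Y ZY YX.
  have XZ : X = Z.
    apply/eqP; rewrite eq_sym eqEfcard ZX /=; by rewrite addn0 in cZ.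
  by rewrite (_ : Y = Z) //; subst Z; apply/eqP; rewrite eqEfsubset YX.
have [H|[Y [rY ZY YX]]] := exists_rigid_step rZ ZX; first by exists Z.
by apply: (IHn Y) => //; have := fproper_ltn_card ZY; lia.
Qed.

Lemma exists_rigid_gt A X : A `<=` X -> (del A < del X)%R ->
  exists Z, [/\ rigid A Z, Z `<=` X & A `<` Z].
Proof.
move=> AX dX; have [Z [rZ ZX maxZ]] := exists_rigid_max AX.
exists Z; split=> //; rewrite fproperEneq (proj1 rZ) andbT.
by apply/eqP => AZ; have := maxZ X; rewrite -AZ => /(_ AX (fsubset_refl X)); lia.
Qed.

End Predimension.

(** * Closures and game positions *)

Section Closure.
Local Open Scope fset_scope.
Local Open Scope nat_scope.
Variable E : rel nat.
Hypothesis Esym : symmetric E.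
Hypothesis Eirr : irreflexive E.

Definition below (n : nat) (X : {fset nat}) : Prop := forall x, x \in X -> x < n.

(* The closure of [B] in the graph induced on [0, n). *)
Definition cl (l n : nat) (B : {fset nat}) (x : nat) : Prop :=
  exists X, [/\ rigid E B X, x \in X, #|` X `\` B| <= l & below n X].

Lemma cl_below l n B x : cl l n B x -> x < n.
Proof. by case=> X [_ xX _]; apply. Qed.

Lemma cl_leq l l' n B x : l <= l' -> cl l n B x -> cl l' n B x.
Proof. by move=> ll [X [r xX c b]]; exists X; split=> //; apply: leq_trans ll. Qed.

Lemma cl_base l n B x : below n B -> x \in B -> cl l n B x.
Proof.
by move=> bB xB; exists B; split=> //; [exact: rigid_refl|rewrite fsetDv cardfs0].
Qed.

Lemma cl_mono l n A B x : A `<=` B -> below n B -> cl l n A x -> cl l n B x.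
Proof.
move=> AB bB [X [r xX c b]]; exists (B `|` X); split.
- exact: rigid_mono r AB.
- by rewrite inE xX orbT.
- by apply: leq_trans c; apply: fsubset_leq_card; fset_tac.
- by move=> z; rewrite inE => /orP[/bB|/b].
Qed.

(** Levels add up under iteration, so a move of the game has to start from a higher level than it
    ends with. *)
Lemma cl_trans l1 l2 n A y x : cl l1 n A y -> cl l2 n (y |` A) x ->
  cl (l1 + l2) n A x.
Proof.
move=> [X1 [r1 yX1 c1 b1]] [X2 [r2 xX2 c2 b2]]; exists (X1 `|` X2); split.
- by apply: (rigid_trans Esym r1 r2); have [AX1 _] := r1; fset_tac.
- by rewrite inE xX2 orbT.
- apply: leq_trans (leq_add c1 c2).
  have : (X1 `|` X2) `\` A `<=` (X1 `\` A) `|` (X2 `\` (y |` A)) by fset_tac.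
  move/fsubset_leq_card => /leq_trans; apply.
  by rewrite cardfsU leq_subr.
- by move=> z; rewrite inE => /orP[/b1|/b2].
Qed.

Lemma rigid_add X y : y \notin X -> 1 < deg E y X -> rigid E X (y |` X).
Proof.
move=> yX dy; split; first exact: fsubsetU1.
move=> Y XY; rewrite fproperE => /andP[YX nYX].
have -> : Y = X.
  have yY : y \notin Y by apply: contra nYX => yY; fset_tac.
  by fset_tac.
by rewrite delU1 //; arith_lia.
Qed.

(* A vertex [y] outside the closure of [B] that is adjacent to [h] in [B] adds
   nothing but itself to the closure. *)
Section FreeStep.
Variables (l n : nat) (B : {fset nat}) (y h : nat).
Hypotheses (yn : y < n) (hB : h \in B) (yh : E y h).
Hypothesis (ycl : ~ cl l.+1 n B y).

(** A second neighbour in a rigid set over [B] would give [y] two edges to that set. Adding [y]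
    would keep it rigid at the cost of one level, against [ycl]. *)
Lemma free_nbr z : cl l n B z -> E y z -> z = h.
Proof.
move=> [X [r zX c b]] yz; apply/eqP; case: eqVneq => // zh; exfalso.
have yX : y \notin X by apply/negP=> yX; apply: ycl; exists X; split=> //; arith_lia.
apply: ycl; exists (X `|` (y |` X)); split.
- apply: (rigid_trans Esym r (rigid_add yX _)) => //.
  have hX : h \in X by have [/fsubsetP BX _] := r; apply: BX.
  by apply: (deg_ge2 zX hX).
- by rewrite !inE eqxx orbT.
- apply: (@leq_trans #|` y |` (X `\` B)|); first by apply: fsubset_leq_card; fset_tac.
  by rewrite cardfsU1; move: c; case: (y \notin _) => /=; arith_lia.
- by move=> x; rewrite !inE => /orP[/b|/orP[/eqP->|/b]].
Qed.

(** Adding [y] to a set that contains [h] does not lower [del]. Hence a witness [X] is itself rigid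
    over [B] if [y] has two neighbours in it, which [ycl] excludes; otherwise removing [y] from [X]
    leaves a set rigid over [B]. *)
Lemma free_cl x : cl l n (y |` B) x -> x != y -> cl l n B x.
Proof.
move=> [X [[yBX rX] xX c b]] xy.
have yX : y \in X by move/fsubsetP: yBX; apply; rewrite !inE eqxx.
have yB : y \notin B.
  apply/negP=> yB; apply: ycl; apply: cl_base => // z zB; apply: b.
  by move/fsubsetP: yBX; apply; rewrite inE zB orbT.
have grow (Y : {fset nat}) : B `<=` Y -> y \notin Y ->
    (del E Y <= del E (y |` Y))%R.
  move=> /fsubsetP BY yY; rewrite delU1 //.
  by have := deg_gt0 (BY _ hB) yh; arith_lia.
have degX : deg E y X = deg E y (X `\ y).
  by rewrite -{1}(fsetD1K yX) degU ?fdisjoint1X ?inE ?eqxx // /deg big_seq_fset1 Eirr.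
have [dy|dy] := ltnP 1 (deg E y X).
  exfalso; apply: ycl; exists X; split=> //.
    split=> [|Y BY YX]; first by fset_tac.
    have [yY|yY] := boolP (y \in Y); first by apply: rX => //; fset_tac.
    have [eqX|neqX] := eqVneq (y |` Y) X.
      by rewrite -eqX delU1 //; move: dy; rewrite degX -eqX fsetU1K //; arith_lia.
    apply: le_lt_trans (grow Y BY yY) _; apply: rX; first by fset_tac.
    rewrite fproperEneq neqX /=; move/fproper_sub: YX => YX; fset_tac.
  apply: (@leq_trans #|` y |` (X `\` (y |` B))|).
    by apply: fsubset_leq_card; fset_tac.
  by rewrite cardfsU1; move: c; case: (y \notin _) => /=; arith_lia.
exists (X `\ y); split; last by move=> z; rewrite !inE => /andP[_ /b].
- split=> [|Y BY]; first by fset_tac.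
  rewrite fproperE => /andP[YX nYX].
  have yY : y \notin Y by apply/negP => /(fsubsetP YX); rewrite !inE eqxx.
  apply: le_lt_trans (grow Y BY yY) _.
  apply: (@lt_le_trans _ _ (del E X)).
    apply: rX; first by fset_tac.
    rewrite fproperE; apply/andP; split; first by fset_tac.
    by apply: contra nYX => XY; fset_tac.
  by rewrite -{1}(fsetD1K yX) delU1 -?degX ?inE ?eqxx //; arith_lia.
- by rewrite !inE xy.
- by rewrite (_ : (X `\ y) `\` B = X `\` (y |` B)) //; fset_tac.
Qed.

End FreeStep.

(** * Transport of rigid sets and closures along partial isomorphisms *)

Lemma imfset_fsubset (f : nat -> nat) (X Y : {fset nat}) : X `<=` Y ->
  f @` X `<=` f @` Y.
Proof. by move=> /fsubsetP XY; apply: subset_imfset. Qed.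

(** The maps are total on [nat] but matter only on [U] and [U']. Carrying the inverse along lets
    positions be patched by cases and reversed. *)
Definition iso_on (U U' : nat -> Prop) (f g : nat -> nat) : Prop :=
  [/\ forall x, U x -> U' (f x) /\ g (f x) = x,
      forall x, U' x -> U (g x) /\ f (g x) = x &
      forall x y, U x -> U y -> E (f x) (f y) = E x y].

Lemma iso_on_sym U U' f g : iso_on U U' f g -> iso_on U' U g f.
Proof.
move=> [fU gU fE]; split=> // x y Ux Uy.
have [Ugx fgx] := gU x Ux; have [Ugy fgy] := gU y Uy.
by rewrite -fE // fgx fgy.
Qed.

Lemma iso_on_inj U U' f g (X : {fset nat}) : iso_on U U' f g ->
  (forall x, x \in X -> U x) -> {in X &, injective f}.
Proof.
move=> [fU _ _] XU x y xX yX fxy.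
by rewrite -(proj2 (fU x (XU x xX))) fxy (proj2 (fU y (XU y yX))).
Qed.

Lemma iso_on_imfsetK U U' f g (X : {fset nat}) : iso_on U U' f g ->
  (forall x, x \in X -> U x) -> g @` (f @` X) = X.
Proof.
move=> [fU _ _] XU; apply/fsetP => x; apply/imfsetP/idP => [[y /= /imfsetP[z /= zX ->] ->]|xX].
  by rewrite (proj2 (fU z (XU z zX))).
by exists (f x); rewrite ?in_imfset //= (proj2 (fU x (XU x xX))).
Qed.

Lemma iso_on_del U U' f g (X : {fset nat}) : iso_on U U' f g ->
  (forall x, x \in X -> U x) -> del E (f @` X) = del E X.
Proof.
move=> isoU XU; apply: del_imfset; first exact: iso_on_inj isoU XU.
by move=> x y xX yX; have [_ _ fE] := isoU; rewrite fE //; apply: XU.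
Qed.

Lemma iso_on_rigid U U' f g (B X : {fset nat}) : iso_on U U' f g ->
  (forall x, x \in X -> U x) -> rigid E B X -> rigid E (f @` B) (f @` X).
Proof.
move=> isoU XU [BX rX]; split; first exact: imfset_fsubset.
move=> Y BY; rewrite fproperE => /andP[YX nYX].
have YU' y : y \in Y -> U' y.
  move=> /(fsubsetP YX)/imfsetP[x /= xX ->].
  by have [fU _ _] := isoU; case: (fU x (XU x xX)).
have isoU' := iso_on_sym isoU.
have fgY := iso_on_imfsetK isoU' YU'.
have gYX : g @` Y `<=` X.
  by rewrite -(iso_on_imfsetK isoU XU); apply: imfset_fsubset.
have gYU x : x \in g @` Y -> U x by move/(fsubsetP gYX)/XU.
rewrite (iso_on_del isoU XU) -(iso_on_del isoU' YU'); apply: rX.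
  rewrite -(iso_on_imfsetK isoU (X := B)); first exact: imfset_fsubset.
  by move=> x /(fsubsetP BX)/XU.
rewrite fproperE gYX /=; apply: contra nYX => XgY.
by rewrite -fgY; apply: imfset_fsubset.
Qed.

Lemma iso_on_cl U U' f g l n n' (B : {fset nat}) x : iso_on U U' f g ->
  (forall x, cl l n B x -> U x) -> (forall x, U' x -> x < n') ->
  cl l n B x -> cl l n' (f @` B) (f x).
Proof.
move=> isoU clU U'n [X [r xX c b]].
have XU z : z \in X -> U z by move=> zX; apply: clU; exists X.
exists (f @` X); split.
- exact: iso_on_rigid isoU XU r.
- by rewrite in_imfset.
- have -> : f @` X `\` f @` B = f @` (X `\` B).
    apply/fsetP => y; rewrite inE; apply/andP/imfsetP => [[nB /imfsetP[z /= zX yz]]|].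
      exists z => //=; rewrite inE zX andbT; apply: contra nB => zB.
      by rewrite yz in_imfset.
    move=> [z /=]; rewrite inE => /andP[zB zX ->]; split; last by rewrite in_imfset.
    apply: contra zB => /imfsetP[t /= tB] /(iso_on_inj isoU XU) -> //.
    by have [/fsubsetP BX _] := r; apply: BX.
  by apply: leq_trans (leq_imfset_card _ _ _) _.
- move=> y /imfsetP[z /= zX ->]; apply: U'n.
  by have [fU _ _] := isoU; case: (fU z (XU z zX)).
Qed.

Variable C : {fset nat}.

(* Positions from which Duplicator can go on; [l] bounds the rigid sets that
   the isomorphism has to respect. *)
Definition game_pos l n n' (B : {fset nat}) f g : Prop :=
  [/\ below n B, below n' (f @` B),
     iso_on (cl l n B) (cl l n' (f @` B)) f g & {in C, f =1 id}].

(** The domains may exceed the closures: rigid sets are carried over in both directions, so the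
    closures are mapped onto each other. *)
Lemma game_pos_of_iso U U' l n n' B f g : iso_on U U' f g ->
  below n B -> (forall x, U' x -> x < n') -> (forall x, U x -> x < n) ->
  (forall x, cl l n B x -> U x) -> (forall x, cl l n' (f @` B) x -> U' x) ->
  {in C, f =1 id} -> game_pos l n n' B f g.
Proof.
move=> isoU bB U'n Un clU clU' fC; split=> //.
  move=> y /imfsetP[x /= xB ->]; apply: U'n.
  by have [fU _ _] := isoU; case: (fU x (clU _ (cl_base l bB xB))).
have isoU' := iso_on_sym isoU.
have gfB : g @` (f @` B) = B.
  by apply: (iso_on_imfsetK isoU) => x /(cl_base l bB)/clU.
have [fU gU fE] := isoU; split=> [x clx|x clx|x y /clU Ux /clU Uy]; last exact: fE.
  by split; [exact: iso_on_cl isoU clU U'n clx|exact: (proj2 (fU x (clU _ clx)))].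
split; last exact: (proj2 (gU x (clU' _ clx))).
by rewrite -gfB; apply: iso_on_cl isoU' clU' Un clx.
Qed.

Lemma game_pos_leq l l' n n' A B f g : l <= l' -> A `<=` B ->
  game_pos l' n n' B f g -> game_pos l n n' A f g.
Proof.
move=> ll AB [bB bB' isoB fC].
have sub (X : {fset nat}) : below n X -> forall Y, Y `<=` X -> below n Y.
  by move=> bX Y /fsubsetP YX x /YX/bX.
apply: (game_pos_of_iso isoB) => //.
- exact: sub AB.
- by move=> x /cl_below.
- by move=> x /cl_below.
- by move=> x /(cl_leq ll)/(cl_mono AB bB).
- move=> x /(cl_leq ll); apply: cl_mono => //.
  exact: imfset_fsubset.
Qed.

Lemma game_pos_sym l n n' B f g : C `<=` B -> game_pos l n n' B f g ->
  game_pos l n' n (f @` B) g f /\ g @` (f @` B) = B.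
Proof.
move=> CB [bB bB' isoB fC].
have gfB : g @` (f @` B) = B.
  by apply: (iso_on_imfsetK isoB) => x; apply: cl_base.
split=> //; split; rewrite ?gfB //; first exact: iso_on_sym.
move=> x xC; rewrite -{1}(fC x xC); have [fU _ _] := isoB.
by case: (fU x (cl_base l bB (fsubsetP CB _ xC))).
Qed.

(** The pattern of every genuine extension: a piece [W] containing all that is new in the closure is
    matched with [W']. The piece is a single vertex or a circuit. *)
Lemma game_pos_glue l n n' B f g (W W' : {fset nat}) f1 g1 b :
  game_pos l n n' B f g -> b \in W -> C `<=` B -> below n W -> below n' W' ->
  (forall x, x \in W -> ~ cl l n B x) ->
  (forall x, x \in W' -> ~ cl l n' (f @` B) x) ->
  iso_on (fun x => x \in W) (fun x => x \in W') f1 g1 ->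
  (forall x w, cl l n B x -> w \in W -> E (f x) (f1 w) = E x w) ->
  (forall x, cl l n (b |` B) x -> cl l n B x \/ x \in W) ->
  (forall x, cl l n' (f1 b |` f @` B) x -> cl l n' (f @` B) x \/ x \in W') ->
  exists f2 g2, [/\ game_pos l n n' (b |` B) f2 g2, {in B, f2 =1 f} & f2 b = f1 b].
Proof.
move=> [bB bB' [fU gU fE] fC] bW CB bW' bW'' WB WB' [f1W g1W f1E] crossE clW clW'.
pose f2 x := if x \in W then f1 x else f x.
pose g2 x := if x \in W' then g1 x else g x.
have f2B : {in B, f2 =1 f}.
  move=> x xB; rewrite /f2; case: ifPn => // xW.
  by case: (WB x xW); apply: cl_base.
have f2b : f2 b = f1 b by rewrite /f2 bW.
have f2bB : f2 @` (b |` B) = f1 b |` f @` B.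
  by rewrite imfsetU1 f2b; congr (_ |` _); apply: eq_in_imfset.
exists f2, g2; split=> //.
apply: (@game_pos_of_iso (fun x => cl l n B x \/ x \in W)
                         (fun x => cl l n' (f @` B) x \/ x \in W')).
- split.
  + move=> x; have [xW _|xW [clx|//]] := boolP (x \in W); rewrite /f2 /g2.
      by rewrite xW; have [f1x ->] := f1W x xW; rewrite f1x; split=> //; right.
    have [fx gfx] := fU x clx; rewrite (negbTE xW); split; first by left.
    by case: ifPn => // /WB'.
  + move=> x; have [xW _|xW [clx|//]] := boolP (x \in W'); rewrite /f2 /g2.
      by rewrite xW; have [f1x ->] := g1W x xW; rewrite f1x; split=> //; right.
    have [fx gfx] := gU x clx; rewrite (negbTE xW); split; first by left.
    by case: ifPn => // /WB.
  + move=> x y; rewrite /f2.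
    have [xW _|xW [clx|//]] := boolP (x \in W);
    have [yW _|yW [cly|//]] := boolP (y \in W).
    * exact: f1E.
    * by rewrite Esym crossE // Esym.
    * exact: crossE.
    * exact: fE.
- by move=> x; rewrite !inE => /orP[/eqP->|/bB//]; apply: bW'.
- by move=> x [/cl_below|/bW''].
- by move=> x [/cl_below|/bW'].
- exact: clW.
- by move=> x; rewrite f2bB; apply: clW'.
- by move=> x xC; rewrite f2B ?fC // (fsubsetP CB).
Qed.

End Closure.

(** * The extension property of the game *)

Section Game.
Local Open Scope fset_scope.
Local Open Scope nat_scope.
Variable E : rel nat.
Hypothesis Esym : symmetric E.
Hypothesis Eirr : irreflexive E.

Fixpoint walk (n d x y : nat) : Prop :=
  if d is d'.+1 then exists z, [/\ z < n, E x z & walk n d' z y] else x = y.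

Lemma walk_cat n d1 d2 x y z : walk n d1 x y -> walk n d2 y z ->
  walk n (d1 + d2) x z.
Proof.
elim: d1 x => [|d1 IHd] x /= => [->//|[t [tn xt ty]] yz].
by exists t; split=> //; apply: IHd.
Qed.

Lemma walk1 n x y : y < n -> E x y -> walk n 1 x y.
Proof. by exists y. Qed.

Lemma walk_sym n d x y : x < n -> walk n d x y -> walk n d y x.
Proof.
elim: d x => [|d IHd] x xn /=; first by move=> ->.
move=> [z [zn xz zy]]; suff: walk n (d + 1) y x by rewrite addn1.
apply: walk_cat (IHd _ zn zy) _.
by apply: walk1; rewrite // Esym.
Qed.

Definition reach n d (A : {fset nat}) x : Prop :=
  exists a d', [/\ a \in A, d' <= d & walk n d' a x].

(** [Y] collects the components of [X] that meet [A], so [del] splits along it. Each round of the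
    search adds one vertex, which is why the number of added vertices bounds the distances. *)
Lemma explore n (X A : {fset nat}) : A `<=` X -> below n X ->
  exists Y, [/\ A `<=` Y, Y `<=` X,
    forall y, y \in Y -> reach n #|` Y `\` A| A y &
    forall y x, y \in Y -> x \in X `\` Y -> ~~ E y x].
Proof.
move=> AX bX; suff main k Y : A `<=` Y -> Y `<=` X -> #|` X| <= #|` Y| + k ->
    (forall y, y \in Y -> reach n #|` Y `\` A| A y) ->
  exists Y, [/\ A `<=` Y, Y `<=` X,
    forall y, y \in Y -> reach n #|` Y `\` A| A y &
    forall y x, y \in Y -> x \in X `\` Y -> ~~ E y x].
  apply: (main #|` X| A) => //; first arith_lia.
  by move=> y yA; exists y, 0.
elim: k Y => [|k IHk] Y AY YX cY rY.
  exists Y; split=> // y x yY; suff -> : X = Y by rewrite fsetDv inE.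
  by apply/eqP; rewrite eq_sym eqEfcard YX /=; rewrite addn0 in cY.
have [[y [x [yY xXY yx]]]|none] := pselect (exists y x, [/\ y \in Y, x \in X `\` Y & E y x]).
  move: (xXY); rewrite inE => /andP[xY xX].
  have xA : x \notin A by apply: contra xY; apply: (fsubsetP AY).
  have cardY : #|` (x |` Y) `\` A| = (#|` Y `\` A|).+1.
    rewrite (_ : (x |` Y) `\` A = x |` (Y `\` A)); last by fset_tac.
    by rewrite cardfsU1 !inE (negbTE xY) andbF.
  apply: (IHk (x |` Y)).
  - by fset_tac.
  - by fset_tac.
  - by rewrite cardfsU1 xY; arith_lia.
  move=> z; rewrite cardY inE => /orP[|/rY[a [d [aA dle w]]]]; last by exists a, d; split=> //; arith_lia.
  rewrite inE => /eqP ->; have [a [d [aA dle w]]] := rY _ yY.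
  exists a, d.+1; split=> //; rewrite -addn1; apply: walk_cat w _.
  by apply: walk1 => //; apply: bX.
exists Y; split=> // y x yY xXY; apply/negP => yx; apply: none; by exists y, x.
Qed.

(* These are the induced cycles of length at least 3. *)
Definition circuit (Q : {fset nat}) : Prop :=
  [/\ Q != fset0, del E Q = 0%R &
      forall Y, Y != fset0 -> Y `<` Q -> (del E Y < 0)%R].

Lemma circuit_rigid Q w : circuit Q -> w \in Q -> rigid E [fset w] Q.
Proof.
move=> [_ dQ mQ] wQ; split; first by rewrite fsub1set.
move=> Y wY YQ; rewrite dQ; apply: mQ => //.
by apply/fset0Pn; exists w; apply: (fsubsetP wY); rewrite inE.
Qed.

Lemma exists_circuit X : X != fset0 -> (0 <= del E X)%R ->
  (forall Y, Y `<=` X -> (del E Y <= 0)%R) -> exists Q, circuit Q /\ Q `<=` X.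
Proof.
move=> X0 dX small; have [k] := ubnP #|` X|; elim: k X X0 dX small => // k IHk X X0 dX small cX.
have [[Y [Y0 YX dY]]|none] := pselect (exists Y, [/\ Y != fset0, Y `<` X & (0 <= del E Y)%R]).
  have YX' := fproper_sub YX.
  have [||Q [cQ QY]] := IHk Y Y0 dY.
  - by move=> Z ZY; apply: small; apply: fsubset_trans YX'.
  - by have := fproper_ltn_card YX; arith_lia.
  by exists Q; split=> //; apply: fsubset_trans YX'.
exists X; split=> //; split=> //.
  by have := small X (fsubset_refl X); arith_lia.
move=> Y Y0 YX; rewrite ltNge; apply/negP => dY; apply: none; by exists Y.
Qed.

Variables (C : {fset nat}) (gam Lam : nat).

(** The deterministic input of the game. [good_free] allows [gam] pebbles because the sliding pebble
    is already on the board; [good_circuit] allows fewer, because the new pebble is not yet placed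
    and a pigeonhole argument over [gam] copies has to succeed. *)
Record good (n : nat) : Prop := Good {
  good_core : C != fset0 /\ below n C;
  good_deg : forall x, x < n ->
    exists y z, [/\ y < n, z < n, y != z, E x y & E x z];
  good_rigid : forall X, rigid E fset0 X -> #|` X| <= Lam -> X `<=` C;
  good_free : forall (P : {fset nat}) h, below n P -> #|` P| <= gam ->
    h \in C `|` P -> exists y, [/\ y < n, E h y & ~ cl E Lam n (C `|` P) y];
  good_circuit : forall Q P : {fset nat}, circuit Q -> #|` Q| <= Lam ->
    ~~ (Q `<=` C) -> below n P -> #|` P| < gam ->
    exists Q' f g, [/\ iso_on E (fun x => x \in Q) (fun x => x \in Q') f g,
      below n Q' & forall q, q \in Q' -> ~ reach n Lam (C `|` P) q]
}.

(** A positive value would produce a nonempty rigid set over [fset0] inside [X], and [good_rigid]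
    puts such a set into the core. *)
Lemma no_rigid n (X : {fset nat}) : good n -> #|` X| <= Lam ->
  [disjoint X & C] -> (del E X <= 0)%R.
Proof.
move=> gn cX dXC; rewrite leNgt; apply/negP => dX.
have [||Z [rZ ZX Z0]] := @exists_rigid_gt E Esym fset0 X.
- exact: fsub0set.
- by rewrite del0.
have /fsubsetP ZC : Z `<=` C.
  by apply: (good_rigid gn rZ); apply: leq_trans (fsubset_leq_card ZX) _.
have /fset0Pn[z zZ] : Z != fset0 by rewrite -fproper0.
by have := fdisjointP dXC _ (fsubsetP ZX _ zZ); rewrite ZC.
Qed.

Lemma rigid_reach n l A X : good n -> rigid E A X -> C `<=` A ->
  #|` X `\` A| <= l -> l <= Lam -> below n X ->
  forall x, x \in X -> reach n l A x.
Proof.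
move=> gn [AX rX] CA cX lL bX; have [Y [AY YX rY sep]] := explore AX bX.
have YXl : #|` Y `\` A| <= l.
  by apply: leq_trans cX; apply: fsubset_leq_card; fset_tac.
suff EXY : X = Y.
  by rewrite EXY => x /rY[a [d [aA dl w]]]; exists a, d; split=> //; arith_lia.
apply/eqP; case: (eqVneq X Y) => // XY; exfalso.
have YX' : Y `<` X by rewrite fproperEneq eq_sym XY.
have EX : X = Y `|` (X `\` Y) by fset_tac.
have := rX Y AY YX'; rewrite EX del_sep //; last by fset_tac.
have : (del E (X `\` Y) <= 0)%R.
  apply: (no_rigid gn); last by fset_tac.
  by apply: leq_trans lL; apply: leq_trans cX; apply: fsubset_leq_card; fset_tac.
arith_lia.
Qed.

Lemma cl_reach n l A x : good n -> C `<=` A -> l <= Lam ->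
  cl E l n A x -> reach n l A x.
Proof. by move=> gn CA lL [X [rX xX c b]]; apply: (rigid_reach gn rX). Qed.

(** * Closures in the presence of a circuit far from the position *)

Section FarCircuit.
Variables (n l k D : nat) (A Q : {fset nat}) (w : nat).
Hypotheses (gn : good n) (CA : C `<=` A) (cQ : circuit Q) (kQ : #|` Q| <= k).
Hypotheses (bQ : below n Q) (wQ : w \in Q).
Hypotheses (lkD : l + k < D) (DL : D <= Lam).
Hypothesis far : forall q, q \in Q -> ~ reach n D A q.

Lemma far_cl x : cl E l n A x -> x \notin Q /\ forall q, q \in Q -> ~~ E x q.
Proof.
move=> clx; have [|a [d [aA dl wk]]] := cl_reach gn CA _ clx; first by arith_lia.
split.
  by apply/negP => /far; apply; exists a, d; split=> //; arith_lia.
move=> q qQ; apply/negP => xq; apply: (far qQ); exists a, d.+1; split=> //; first arith_lia.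
by rewrite -addn1; apply: walk_cat wk _; apply: walk1 => //; apply: bQ.
Qed.

(** Since [Q] is rigid over [w], the union of [X] and [Q] is rigid over [w] and [A]. Its part [Y]
    connected to [A] misses [Q], and what lies outside [Y] has [del] at most 0, the value of [Q]; so
    nothing but [Y] and [Q] is there. As [Q] adds 0 to [del], [Y] alone is rigid over [A]. *)
Lemma far_clU x : cl E l n (w |` A) x -> cl E l n A x \/ x \in Q.
Proof.
move=> [X [rX xX c b]]; pose XQ := X `|` Q.
have wX : w \in X by have [/fsubsetP H _] := rX; apply: H; rewrite !inE eqxx.
have [wAXQ rXQ] : rigid E (w |` A) XQ.
  by apply: (rigid_trans Esym rX (circuit_rigid cQ wQ)); rewrite fsub1set.
have bXQ : below n XQ by move=> z; rewrite inE => /orP[/b|/bQ].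
have AXQ : A `<=` XQ by fset_tac.
have cXQ : #|` XQ `\` A| <= l + k.+1.
  have : XQ `\` A `<=` (X `\` (w |` A)) `|` (w |` Q) by fset_tac.
  move/fsubset_leq_card => /leq_trans; apply; rewrite cardfsU.
  apply: leq_trans (leq_subr _ _) _; apply: leq_add => //.
  by rewrite cardfsU1 wQ; arith_lia.
have [Y [AY YX rY sep]] := explore AXQ bXQ.
have cY : #|` Y `\` A| <= D.
  apply: (@leq_trans #|` XQ `\` A|); last by move: cXQ lkD; arith_lia.
  by apply: fsubset_leq_card; fset_tac.
have dYQ : [disjoint Y & Q].
  apply/fdisjointP => y /rY[a [d [aA dl wk]]]; apply/negP => /far; apply.
  by exists a, d; split=> //; arith_lia.
have sepQ (Z : {fset nat}) : Z `<=` Y -> del E (Z `|` Q) = del E Z.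
  have [_ dQ _] := cQ => /fsubsetP ZY; rewrite del_sep ?dQ ?addr0 //.
    by move: ZY => /fsubsetP ZY; fset_tac.
  move=> y q /ZY yY qQ; apply: sep => //.
  by rewrite !inE qQ orbT (fdisjointP_sym dYQ).
have EXQ : XQ = Y `|` Q.
  apply/eqP; case: (eqVneq XQ (Y `|` Q)) => // neq; exfalso.
  have YQX : Y `|` Q `<=` XQ by rewrite /XQ in YX *; fset_tac.
  have lt1 : (del E (Y `|` Q) < del E XQ)%R.
    apply: rXQ; last by rewrite fproperEneq eq_sym neq.
    by fset_tac.
  have : (del E (XQ `\` Y) <= 0)%R.
    apply: (no_rigid gn); last by fset_tac.
    apply: (@leq_trans #|` XQ `\` A|); last by move: cXQ lkD DL; arith_lia.
    by apply: fsubset_leq_card; fset_tac.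
  move: lt1; rewrite sepQ //.
  have -> : XQ = Y `|` (XQ `\` Y) by fset_tac.
  rewrite del_sep //; last by fset_tac.
  by rewrite (_ : (Y `|` (XQ `\` Y)) `\` Y = XQ `\` Y); [arith_lia|fset_tac].
have : x \in XQ by rewrite inE xX.
rewrite EXQ inE => /orP[xY|]; [left|by right].
exists Y; split=> //.
- split=> // Y' AY' YY'; have Y'Y := fproper_sub YY'.
  rewrite -(sepQ Y) // -(sepQ Y') // -EXQ; apply: rXQ; first by fset_tac.
  rewrite EXQ fproperE; apply/andP; split; first by fset_tac.
  move: YY'; rewrite fproperE => /andP[_]; apply: contra => YQ.
  apply/fsubsetP => z zY; have : z \in Y' `|` Q by apply: (fsubsetP YQ); rewrite inE zY.
  by rewrite inE (negbTE (fdisjointP dYQ _ zY)) orbF.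
- apply: leq_trans c; apply: fsubset_leq_card.
  apply/fsubsetP => z; rewrite !inE => /andP[zA zY]; have zQ := fdisjointP dYQ _ zY.
  have := fsubsetP YX z zY; rewrite inE (negbTE zQ) orbF => ->.
  by rewrite (negbTE zA) orbF andbT; apply: contraNneq zQ => ->.
- by move=> z /(fsubsetP YX)/bXQ.
Qed.

End FarCircuit.

(** A rigid set that brings in a new vertex splits into the part connected to [A] and a part [U]
    around [v]. Off the core [del U] is at most 0, and rigidity forces it to be 0, so [U] contains a
    circuit. *)
Lemma far_dichotomy n l A v : good n -> C `<=` A -> v < n ->
  l < Lam -> ~ reach n l.+1 A v ->
  (forall x, cl E l n (v |` A) x -> cl E l n A x \/ x = v) \/
  exists Q, [/\ circuit Q, #|` Q| <= l.+1, below n Q &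
    forall q, q \in Q -> exists d, d <= l /\ walk n d q v].
Proof.
move=> gn CA vn lL nrv.
have [H|/existsNP[x]] := pselect (forall x, cl E l n (v |` A) x -> cl E l n A x \/ x = v).
  by left.
move=> /not_implyP[[X [[AX rX] xX c b]] /not_orP[nclx xv]]; right.
have vX : v \in X by apply: (fsubsetP AX); rewrite !inE eqxx.
have vA : v \notin A by apply/negP => vA; apply: nrv; exists v, 0.
have AX' : A `<=` X by fset_tac.
have [Y [AY YX rY sep]] := explore AX' b.
have cXA : #|` X `\` A| <= l.+1.
  have : X `\` A `<=` v |` (X `\` (v |` A)) by fset_tac.
  move/fsubset_leq_card => /leq_trans; apply; rewrite cardfsU1.
  by move: c; case: (v \notin _) => /=; arith_lia.
have vY : v \notin Y.
  apply/negP => vY; have [a [d [aA dle wk]]] := rY v vY; apply: nrv.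
  exists a, d; split=> //; apply: leq_trans dle _; apply: leq_trans cXA.
  by apply: fsubset_leq_card; fset_tac.
pose U := X `\` Y.
have vU : v \in U by rewrite inE vY vX.
have cU : #|` U| <= l.+1.
  by apply: leq_trans cXA; apply: fsubset_leq_card; rewrite /U; fset_tac.
have small (Z : {fset nat}) : Z `<=` U -> (del E Z <= 0)%R.
  move=> ZU; apply: (no_rigid gn); last by rewrite /U in ZU *; fset_tac.
  by have := fsubset_leq_card ZU; arith_lia.
have sepZ (Z : {fset nat}) : Z `<=` U -> del E (Y `|` Z) = (del E Y + del E Z)%R.
  move=> ZU; rewrite del_sep //; first by rewrite /U in ZU; fset_tac.
  by move=> y z yY /(fsubsetP ZU) zU; apply: sep.
have EX : X = Y `|` U by rewrite /U; fset_tac.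
have ltZ (Z : {fset nat}) : Z `<` U -> v \in Z -> (del E Z < del E U)%R.
  move=> ZU vZ; suff : (del E (Y `|` Z) < del E (Y `|` U))%R.
    by rewrite !sepZ ?(fproper_sub ZU) //; arith_lia.
  rewrite -EX; apply: rX; first by fset_tac.
  rewrite fproperE; apply/andP; split; first by move/fproper_sub: ZU; rewrite /U => ZU; fset_tac.
  move: ZU; rewrite fproperE => /andP[_]; apply: contra => XYZ.
  by rewrite /U; fset_tac.
(* If [v] were alone, [Y] would be rigid over [A] and contain [x], against [nclx]. *)
have U1 : U != [fset v].
  apply/eqP => U1; apply: nclx; exists Y; split.
  - split=> // Y' AY' YY'.
    have Y'Y := fproper_sub YY'.
    have : (del E (Y' `|` [fset v]) < del E X)%R.
      apply: rX; first by fset_tac.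
      rewrite EX U1 fproperE; apply/andP; split; first by fset_tac.
      move: YY'; rewrite fproperE => /andP[_]; apply: contra => YY'.
      by fset_tac.
    rewrite EX sepZ // U1 del_sep ?del1 //; [arith_lia|by fset_tac|].
    move=> y z /(fsubsetP Y'Y) yY; rewrite inE => /eqP ->; apply: sep => //.
  - by move: xX; rewrite EX U1 !inE; case: eqP xv => // _ _; rewrite orbF.
  - apply: leq_trans c; apply: fsubset_leq_card; fset_tac.
  - by move=> z /(fsubsetP YX)/b.
(* The value is even and exceeds that of [v] alone, which is -2. *)
have dU : (0 <= del E U)%R.
  have : (del E [fset v] < del E U)%R.
    by apply: ltZ; rewrite ?inE // fproperEneq eq_sym U1 fsub1set.
  by rewrite del1 //; have [k ->] := del_even Esym Eirr U; arith_lia.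
have U0 : U != fset0 by apply/fset0Pn; exists v.
have [Q [cQ QU]] := exists_circuit U0 dU small.
exists Q; split=> //.
- exact: leq_trans (fsubset_leq_card QU) cU.
- by move=> q /(fsubsetP QU); rewrite inE => /andP[_ /b].
have bU : below n U by move=> q; rewrite inE => /andP[_ /b].
(* [U] is connected: the rest of it outside the component of [v] would have to raise [del]. This
   bounds the distance from [v] to the circuit. *)
have [K [vK KU rK sepK]] := explore (X := U) (A := [fset v]) (n := n) (eq_ind_r is_true vU (fsub1set _ _)) bU.
have EK : K = U.
  apply/eqP; case: (eqVneq K U) => // KU'; exfalso.
  have vK' : v \in K by apply: (fsubsetP vK); rewrite inE.
  have := ltZ K; rewrite fproperEneq KU' KU => /(_ isT vK').
  have -> : U = K `|` (U `\` K) by fset_tac.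
  rewrite del_sep //; last by fset_tac.
  by have := small (U `\` K) (fsubsetDl _ _); arith_lia.
move=> q /(fsubsetP QU); rewrite -EK => /rK[a [d [+ dle wk]]].
rewrite inE => /eqP av; exists d; split; last by rewrite av in wk; exact: walk_sym.
apply: leq_trans dle _; have := cardfsD1 v U; rewrite vU EK; arith_lia.
Qed.

(* The level needed to slide a pebble [d] steps and end at level [l]. *)
Fixpoint slide_level (d l : nat) : nat :=
  if d is d'.+1 then (slide_level d' l).*2.+1 else l.

Lemma slide_level_ge d l : d + l <= slide_level d l.
Proof. by elim: d => //= d IHd; arith_lia. Qed.

Lemma slide_level_leq d d' l : d <= d' -> slide_level d l <= slide_level d' l.
Proof.
elim: d' => [|d' IHd]; first by rewrite leqn0 => /eqP ->.
rewrite leq_eqVlt => /orP[/eqP->//|/IHd /leq_trans]; apply=> /=; arith_lia.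
Qed.

Lemma game_pos_step n n' l (P : {fset nat}) (y y1 : nat) (f g : nat -> nat) : good n' -> #|` y |` P| <= gam ->
  l < Lam -> y1 < n -> E y y1 ->
  game_pos E C l.*2.+1 n n' (y |` (C `|` P)) f g ->
  exists f2 g2, game_pos E C l n n' (y1 |` (y |` (C `|` P))) f2 g2 /\
    {in y |` (C `|` P), f2 =1 f}.
Proof.
set B := y |` (C `|` P) => gn' cP lL y1n yy1 gp.
have [bB bB' isoB fC] := gp.
have CB : C `<=` B by rewrite /B; fset_tac.
have yB : y \in B by rewrite !inE eqxx.
(* The split is at level [l.+1] because that is what [free_nbr] and [free_cl] require at level [l].
   If [y1] is already in the closure, [f] answers, and [cl_trans] costs [l.+1 + l], which is
   [l.*2.+1]. *)
have [cly1|ncl] := pselect (cl E l.+1 n B y1).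
  exists f, g; split=> //.
  have clB x : cl E l n (y1 |` B) x -> cl E l.*2.+1 n B x.
    by move=> /(cl_trans Esym cly1); apply: cl_leq; arith_lia.
  apply: (game_pos_of_iso isoB) => //.
  - by move=> x; rewrite inE => /orP[|/bB//]; rewrite inE => /eqP->.
  - by move=> x /cl_below.
  - by move=> x /cl_below.
  - have cly1' : cl E l.+1 n' (f @` B) (f y1).
      apply: (iso_on_cl isoB _ _ cly1); last by move=> x /cl_below.
      by move=> x; apply: cl_leq; arith_lia.
    move=> x; rewrite imfsetU1 => /(cl_trans Esym cly1').
    by apply: cl_leq; arith_lia.
have fB : f @` B = C `|` f @` (y |` P).
  rewrite (_ : B = C `|` (y |` P)); last by rewrite /B; fset_tac.
  rewrite imfsetU; congr (_ `|` _); rewrite -[RHS]imfset_id.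
  by apply: eq_in_imfset.
have bfP : below n' (f @` (y |` P)).
  by move=> x xP; apply: bB'; rewrite fB inE xP orbT.
have fyB : f y \in f @` B by rewrite in_imfset.
have [||y' [y'n fyy' ncl']] := good_free gn' (h := f y) bfP.
- by apply: leq_trans (leq_imfset_card _ _ _) _.
- by rewrite -fB.
rewrite -fB in ncl'.
have nclL : ~ cl E l.+1 n' (f @` B) y' by move=> /(cl_leq lL).
have gpl : game_pos E C l n n' B f g.
  by apply: (game_pos_leq Esym _ (fsubset_refl B) gp); arith_lia.
have Ey1y : E y1 y by rewrite Esym.
have Ey'fy : E y' (f y) by rewrite Esym.
have isoy : iso_on E (fun x => x \in [fset y1]) (fun x => x \in [fset y'])
    (fun=> y') (fun=> y1).
  split=> [x|x|x z]; rewrite !inE ?eqxx; try by move=> /eqP ->.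
  by move=> /eqP -> /eqP ->; rewrite !Eirr.
have [|||||||f2 [g2 [gp2 f2B _]]] := game_pos_glue Esym gpl (fset11 y1) CB _ _ _ _ isoy.
- by move=> x; rewrite inE => /eqP->.
- by move=> x; rewrite inE => /eqP->.
- by move=> x; rewrite inE => /eqP-> /(cl_leq (leqnSn l)).
- by move=> x; rewrite inE => /eqP-> /(cl_leq (leqnSn l)).
- have [_ _ [fU gU fE] _] := gpl => x w clx; rewrite inE => /eqP ->.
  have [clfx gfx] := fU x clx.
  apply/idP/idP => [|xy1].
    rewrite Esym => /(free_nbr Esym Eirr y'n fyB Ey'fy nclL clfx) fxy.
    by rewrite -gfx fxy (proj2 (fU y (cl_base E l bB yB))).
  move: (xy1); rewrite Esym => /(free_nbr Esym Eirr y1n yB Ey1y ncl clx) ->.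
  exact: fyy'.
- move=> x clx; have [xy|xy] := eqVneq x y1; first by right; rewrite inE xy.
  by left; apply: (free_cl Esym Eirr y1n yB Ey1y ncl clx).
- move=> x clx; have [xy|xy] := eqVneq x y'; first by right; rewrite inE xy.
  by left; apply: (free_cl Esym Eirr y'n fyB Ey'fy nclL clx).
by exists f2, g2.
Qed.

(** After each step the previous position of the sliding pebble is dropped, so there is never more
    than one extra pebble beyond those of [P] when a neighbour is sought. *)
Lemma game_pos_slide n n' d l (P : {fset nat}) (y v : nat) (f g : nat -> nat) :
  good n' -> #|` P| < gam -> slide_level d l <= Lam -> walk n d y v ->
  game_pos E C (slide_level d l) n n' (y |` (C `|` P)) f g ->
  exists f2 g2, game_pos E C l n n' (v |` (C `|` P)) f2 g2 /\
    {in C `|` P, f2 =1 f}.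
Proof.
move=> gn' cP; elim: d y f g => [|d IHd] y f g lL /= wk gp.
  by exists f, g; rewrite -wk.
move: wk => [z [zn yz wk]].
have cyP : #|` y |` P| <= gam by rewrite cardfsU1; case: (y \notin P); move: cP; lia.
move: lL => /= lL; have [|f1 [g1 [gp1 f1f]]] := game_pos_step gn' cyP _ zn yz gp.
  by arith_lia.
have gp1' : game_pos E C (slide_level d l) n n' (z |` (C `|` P)) f1 g1.
  by apply: (game_pos_leq Esym (leqnn _) _ gp1); fset_tac.
have lL' : slide_level d l <= Lam by arith_lia.
have [f2 [g2 [gp2 f2f1]]] := IHd z f1 g1 lL' wk gp1'.
by exists f2, g2; split=> // x xB; rewrite f2f1 // f1f // inE xB orbT.
Qed.

(* A path leaving the closure freely for more than [l] steps ends at a vertex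
   that is isolated over [A] at level [l]: a rigid set through an inner vertex
   of the path would contain all inner vertices. *)
Section Isolated.
Variables (n l : nat) (A : {fset nat}) (c0 : nat).
Hypotheses (gn : good n) (bA : below n A) (c0A : c0 \in A).

Fixpoint trail (y : nat -> nat) (i : nat) : {fset nat} :=
  if i is j.+1 then y j.+1 |` trail y j else A.

Lemma in_trail y i x : x \in trail y i ->
  x \in A \/ exists j, [/\ 0 < j, j <= i & x = y j].
Proof.
elim: i => [|i IHi] /=; first by left.
rewrite inE => /orP[|/IHi [|[j [j0 ji xj]]]]; last 2 first.
- by left.
- by right; exists j; split=> //; arith_lia.
by rewrite inE => /eqP ->; right; exists i.+1.
Qed.

Lemma trail_leq y i j : i <= j -> trail y i `<=` trail y j.
Proof.
elim: j => [|j IHj]; first by rewrite leqn0 => /eqP ->.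
rewrite leq_eqVlt => /orP[/eqP->//|/IHj ij]; apply: fsubset_trans ij _.
exact: fsubsetU1.
Qed.

Lemma mem_trail y i j : 0 < i -> i <= j -> y i \in trail y j.
Proof.
by case: i => // i _ ij; apply: (fsubsetP (trail_leq y ij)); rewrite /= !inE eqxx.
Qed.

Lemma trail_ext y y' i : (forall j, 0 < j -> j <= i -> y j = y' j) ->
  trail y i = trail y' i.
Proof.
elim: i => //= i IHi H; rewrite H ?IHi // => j j0 ji; apply: H => //; arith_lia.
Qed.

Variable T : nat.
Hypotheses (T2 : T = l.+2) (gA : exists y, [/\ y < n, E c0 y & ~ cl E (l + T) n A y]).

(** The level drops by one per vertex because conclusions about the closure at some level need the
    new vertex to be free one level higher. Starting at [l + T] leaves a level above [l] for all [T]
    steps. *)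
Definition trail_ok (y : nat -> nat) (i : nat) : Prop :=
  y 0 = c0 /\ forall j, j < i -> [/\ y j.+1 < n, E (y j) (y j.+1) &
    ~ cl E (l + T - j) n (trail y j) (y j.+1)].

Lemma trail_below y i : trail_ok y i -> below n (trail y i).
Proof.
move=> [_ H] x /in_trail[/bA//|[j [j0 ji ->]]].
by case: j j0 ji => // j _ /H[].
Qed.

Lemma trail_prev y i j : trail_ok y i -> j < i -> y j \in trail y j.
Proof. by move=> [y0 _]; case: j => [|j] ji; [rewrite y0|apply: mem_trail]. Qed.

Lemma trail_notcl y i j a : trail_ok y i -> j < i -> a <= l + T - j ->
  ~ cl E a n (trail y j) (y j.+1).
Proof. by move=> [_ /[apply]] [_ _ ncl] la /(cl_leq la). Qed.

Lemma trail_nbr y i j a z : trail_ok y i -> j < i -> a < l + T - j ->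
  cl E a n (trail y j) z -> E (y j.+1) z -> z = y j.
Proof.
move=> ok ji la clz; have [_ /(_ j ji) [yn yy _]] := ok.
apply: free_nbr clz => //; first exact: trail_prev ok ji.
  by rewrite Esym.
exact: trail_notcl ok ji la.
Qed.

Lemma trail_cl y i j a z : trail_ok y i -> j < i -> a < l + T - j ->
  cl E a n (trail y j.+1) z -> z != y j.+1 -> cl E a n (trail y j) z.
Proof.
move=> ok ji la clz; have [_ /(_ j ji) [yn yy _]] := ok.
apply: (free_cl Esym Eirr yn (trail_prev ok ji)) => //.
  by rewrite Esym.
exact: trail_notcl ok ji la.
Qed.

(** The last vertex has two neighbours by [good_deg]. One that lies in the closure of the trail can
    only be the predecessor, so another one continues the trail; [gA] supplies the first step. *)
Lemma trail_exists i : i <= T -> exists y, trail_ok y i.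
Proof.
elim: i => [|i IHi] iT; first by exists (fun=> c0); split.
have [y ok] := IHi (ltnW iT); have [y0 H] := ok.
suff [z [zn yz ncl]] : exists z, [/\ z < n, E (y i) z & ~ cl E (l + T - i) n (trail y i) z].
  pose y' j := if j == i.+1 then z else y j.
  have y'y j : j <= i -> y' j = y j by move=> ji; rewrite /y' ltn_eqF.
  have tr j : j <= i -> trail y' j = trail y j.
    by move=> ji; apply: trail_ext => k k0 kj; apply: y'y; arith_lia.
  exists y'; split; first by rewrite y'y.
  move=> j; rewrite ltnS leq_eqVlt => /orP[/eqP->|ji].
    by rewrite tr // (y'y i) // {1 2 3}/y' eqxx.
  by rewrite tr ?(ltnW ji) // !y'y ?(ltnW ji) //; apply: H.
case: i iT ok {IHi H} => [|i] iT ok; first by rewrite subn0 y0.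
have yin : y i.+1 < n by have [_ /(_ i (ltnSn i)) []] := ok.
have [z1 [z2 [z1n z2n z12 yz1 yz2]]] := good_deg gn yin.
apply: contrapT => none.
have clz z : z < n -> E (y i.+1) z -> z = y i.
  move=> zn yz; have [clz|ncl] := pselect (cl E (l + T - i.+1) n (trail y i.+1) z); last first.
    by exfalso; apply: none; exists z.
  have lev : l + T - i.+1 < l + T - i by arith_lia.
  apply: (trail_nbr ok (ltnSn i) lev _ yz).
  apply: (trail_cl ok (ltnSn i) lev clz).
  by apply/eqP => zy; rewrite zy Eirr in yz.
by move: z12; rewrite (clz z1) // (clz z2) // eqxx.
Qed.

Lemma exists_isolated : exists v, [/\ v < n, ~ cl E l n A v,
  forall x, cl E l n A x -> ~~ E x v &
  forall x, cl E l n (v |` A) x -> cl E l n A x \/ x = v].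
Proof.
have [y ok] := trail_exists (leqnn T).
have bt j : j <= T -> below n (trail y j).
  by move=> jT x /(fsubsetP (trail_leq y jT)); apply: trail_below ok _.
have At j : A `<=` trail y j := trail_leq y (leq0n j).
have lev j : j < T -> l < l + T - j by arith_lia.
have ncl j : j < T -> ~ cl E l n (trail y j) (y j.+1).
  by move=> jT; apply: (trail_notcl ok jT); apply: ltnW; apply: lev.
have nclA j : j < T -> ~ cl E l n A (y j.+1).
  by move=> jT /(cl_mono Esym (At j) (bt j (ltnW jT))); apply: ncl.
have neq i j : i < j -> j <= T -> y i <> y j.
  case: j => // j; rewrite ltnS => ij jT yij; apply: (ncl j jT); rewrite -yij.
  apply: cl_base; first exact: bt (ltnW jT).
  case: i ij yij => [|i] ij _; last exact: mem_trail.
  by have [-> _] := ok; apply: (fsubsetP (At j)).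
(* All that the closure of the trail can contain: peeling off the last vertex repeatedly leads back
   to the closure of [A]. *)
pose V z := cl E l n A z \/ exists k, [/\ 0 < k, k <= T & z = y k].
have desc z : cl E l n (trail y T) z -> V z.
  have: T <= T by []; move: {1 3}T; elim=> [|j IHj] jT clz; first by left.
  have [->|zy] := eqVneq z (y j.+1); first by right; exists j.+1.
  exact: IHj (ltnW jT) (trail_cl ok jT (lev j jT) clz zy).
have nbr j z : j < T -> V z -> E (y j.+1) z -> z = y j \/ z = y j.+2.
  move=> jT [clz|[k [k0 kT ->]]] yz.
    left; apply: (trail_nbr ok jT (lev j jT) _ yz).
    exact: (cl_mono Esym (At j) (bt j (ltnW jT)) clz).
  have [kj|jk] := leqP k j.
    left; apply: (trail_nbr ok jT (lev j jT) _ yz).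
    by apply: cl_base; [exact: bt (ltnW jT)|exact: mem_trail].
  case: k k0 kT yz jk => // k _ kT yz; rewrite ltnS => jk.
  have [jk'|jk'] := eqVneq j k; first by rewrite jk' Eirr in yz.
  have jk1 : j.+1 <= k by rewrite ltn_neqAle jk' jk.
  have : y j.+1 = y k.
    apply: (trail_nbr ok kT (lev k kT)); last by rewrite Esym.
    by apply: cl_base; [exact: bt (ltnW kT)|exact: mem_trail].
  have [->|jk2] := eqVneq j.+1 k; first by right.
  by move/(neq j.+1 k); case=> //; [rewrite ltn_neqAle jk2|exact: ltnW].
have ET : T = l.+1.+1 := T2.
have lT : l.+1 < T by rewrite ET.
exists (y T); split.
- by rewrite ET; have [_ /(_ _ lT)[]] := ok.
- by rewrite ET; apply: nclA.
- move=> x clx; apply/negP; rewrite Esym ET => yx.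
  have := trail_nbr ok lT (lev _ lT) (cl_mono Esym (At _) (bt _ (ltnW lT)) clx) yx.
  by move=> xy; apply: (nclA l _); rewrite -?xy // ltnW.
move=> x [X [rX xX c b]].
have sub : y T |` A `<=` trail y T.
  have yT : y T \in trail y T by (apply: mem_trail => //; rewrite ET).
  by have AT := At T; fset_tac.
have XV z : z \in X -> V z.
  by move=> zX; apply/desc/(cl_mono Esym sub (bt T (leqnn T))); exists X.
have out j : j.+1 < T -> y j.+1 \notin y T |` A.
  move=> jT; rewrite !inE negb_or; apply/andP; split.
    by apply/eqP; apply: neq.
  by apply/negP => yA; apply: (nclA j (ltnW jT)); apply: cl_base.
(* Rigidity gives an inner vertex two neighbours in [X], and [nbr] leaves only its two neighbours on
   the trail. *)
have step j : j.+1 < T -> y j.+1 \in X -> y j \in X /\ y j.+2 \in X.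
  move=> jT yX; have := rigid_deg Esym Eirr rX yX (out j jT).
  have nb z : z \in X -> E (y j.+1) z -> z = y j \/ z = y j.+2.
    by move=> /XV; apply: nbr; apply: ltnW.
  move=> d2; split; apply: contraLR d2 => nyX; rewrite -leqNgt.
    apply: (deg_le1 (y := y j.+2)) => z zX /(nb z zX)[zy|//].
    by rewrite -zy zX in nyX.
  apply: (deg_le1 (y := y j)) => z zX /(nb z zX)[//|zy].
  by rewrite -zy zX in nyX.
have [clx|[k [k0 kT xk]]] := XV x xX; first by left.
have [Ek|kT'] := eqVneq k T; [by right; rewrite xk Ek|exfalso].
have kT1 : k < T by rewrite ltn_neqAle kT'.
have yk : y k \in X by rewrite -xk.
have down j : 0 < j -> j <= k -> y j \in X.
  move=> j0 jk; rewrite -(subKn jk); move: (leq_subr j k) (j0); rewrite -{2}(subKn jk).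
  elim: (k - j) => [|i IHi] ik ki; first by rewrite subn0.
  have ki' : (k - i) = (k - i.+1).+1 by move: ki; lia.
  have := IHi (ltnW ik); rewrite ki' => /(_ isT) yki.
  by have [|//] := step (k - i.+1) _ yki; move: kT1 ki ki'; lia.
have up j : k <= j -> j < T -> y j \in X.
  move=> kj; rewrite -(subnKC kj); elim: (j - k) => [|i IHi]; first by rewrite addn0.
  case: k k0 {kT xk kT' kT1 yk down kj} IHi => // k _ IHi.
  by rewrite addnS => iT; have [] := step _ (ltnW iT) (IHi (ltnW iT)).
(* The inner vertices are [l.+1] in number, by the choice of [T], while [X] has at most [l] new
   vertices. *)
have /uniq_leq_size : uniq [seq y i | i <- iota 1 l.+1].
  rewrite map_inj_in_uniq ?iota_uniq // => i j; rewrite !mem_iota => iT jT yij.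
  case: (ltngtP i j) => // ij; [have := neq i j ij|have := neq j i ij].
    by move=> H; exfalso; apply: H => //; move: jT; rewrite ET; lia.
  by move=> H; exfalso; apply: H => //; move: iT; rewrite ET; lia.
move/(_ (enum_fset (X `\` (y T |` A)))); rewrite size_map size_iota.
suff sub' : {subset [seq y i | i <- iota 1 l.+1] <= X `\` (y T |` A)}.
  by move/(_ sub') => /leq_trans /(_ c); rewrite ltnn.
move=> z /mapP[[|j]]; rewrite mem_iota // => /andP[_ jl] ->.
have jT : j.+1 < T by rewrite ET; move: jl; rewrite add1n.
rewrite inE out //=; case: (leqP j.+1 k) => jk; first exact: down.
by apply: up => //; apply: ltnW.
Qed.

End Isolated.

Lemma iso_on_circuit Q Q' f g : iso_on E (fun x => x \in Q) (fun x => x \in Q') f g ->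
  circuit Q -> circuit Q' /\ #|` Q'| <= #|` Q|.
Proof.
move=> isoQ [Q0 dQ mQ]; have isoQ' := iso_on_sym isoQ.
have EQ' : Q' = f @` Q.
  have [fQ gQ _] := isoQ; apply/fsetP => x; apply/idP/imfsetP => [xQ|[z /= /fQ[fz _] -> //]].
  by exists (g x); have [gx fgx] := gQ x xQ.
split; last by rewrite EQ'; apply: leq_trans (leq_imfset_card _ _ _) _.
split.
- by have /fset0Pn[q qQ] := Q0; apply/fset0Pn; exists (f q); rewrite EQ' in_imfset.
- by rewrite EQ' (iso_on_del isoQ).
move=> Y /fset0Pn[y yY] YQ'; have YQ := fproper_sub YQ'.
have YU x : x \in Y -> x \in Q' := fsubsetP YQ x.
rewrite -(iso_on_del isoQ' YU); apply: mQ.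
  by apply/fset0Pn; exists (g y); rewrite in_imfset.
have [_ gQ _] := isoQ; rewrite fproperE; apply/andP; split.
  by apply/fsubsetP => x /imfsetP[z /= /YU/gQ[gz _] ->].
move: YQ'; rewrite fproperE => /andP[_]; apply: contra => QgY.
by rewrite EQ' -(iso_on_imfsetK isoQ' YU); apply: imfset_fsubset.
Qed.

(** A circuit within distance [l] of the new pebble is matched at level [slide_level l l], which
    leaves level [l] after sliding to the pebble. It has at most [l.+1] vertices, so the circuit
    must be at distance more than [slide_level l l + l.+2] from the old pebbles; adding [l] gives
    the radius outside which a pebble counts as far. A pebble within this radius is reached by
    sliding, whence the outer [slide_level]. *)
Definition ext_level (l : nat) : nat :=
  slide_level (slide_level l l + l.+2 + l) l.

Lemma reach_leq n d d' (A : {fset nat}) x : d <= d' -> reach n d A x -> reach n d' A x.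
Proof. by move=> dd [a [k [aA kd w]]]; exists a, k; split=> //; apply: leq_trans dd. Qed.

Lemma reach_walk n d k (A : {fset nat}) x y : reach n d A x -> walk n k x y ->
  reach n (d + k) A y.
Proof.
move=> [a [i [aA id w]]] w'; exists a, (i + k); split=> //; last exact: walk_cat w w'.
by rewrite leq_add2r.
Qed.

Lemma game_pos_ext n n' l (P : {fset nat}) (v : nat) (f g : nat -> nat) :
  good n -> good n' -> #|` P| < gam -> ext_level l <= Lam -> v < n ->
  game_pos E C (ext_level l) n n' (C `|` P) f g ->
  exists f2 g2, game_pos E C l n n' (v |` (C `|` P)) f2 g2 /\
    {in C `|` P, f2 =1 f}.
Proof.
set A := C `|` P => gn gn' cP lL vn gp.
have [bA bA' isoA fC] := gp.
pose l1 := slide_level l l; pose D := l1 + l.+2 + l.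
have CA : C `<=` A by rewrite /A; fset_tac.
have lD : D + l <= ext_level l := slide_level_ge D l.
have l1l : l <= l1 by have := slide_level_ge l l; rewrite -/l1; lia.
have fA : f @` A = C `|` f @` P.
  rewrite imfsetU; congr (_ `|` _); rewrite -[RHS]imfset_id.
  by apply: eq_in_imfset.
have CA' : C `<=` f @` A by rewrite fA; fset_tac.
have bP' : below n' (f @` P) by move=> x xP; apply: bA'; rewrite fA inE xP orbT.
have cP' : #|` f @` P| < gam by apply: leq_ltn_trans cP; apply: leq_imfset_card.
have [[a [d [aA dD wk]]]|far] := pselect (reach n D A v).
  apply: (game_pos_slide gn' cP _ wk (f := f) (g := g)).
    by apply: leq_trans lL; apply: slide_level_leq.
  rewrite -/A mem_fset1U //.
  apply: (game_pos_leq Esym _ (fsubset_refl A) gp).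
  exact: slide_level_leq.
have lLam : l < Lam by move: lD lL; rewrite /D; lia.
have nreach x d : cl E l n A x -> walk n d x v -> l + d <= D -> False.
  move=> clx wk ldD; apply: far; apply: reach_leq ldD _.
  by apply: reach_walk wk; apply: cl_reach gn CA _ clx; apply: ltnW.
have [|iso_v|[Q [cQ kQ bQ Qv]]] := far_dichotomy gn CA vn lLam.
- by move/reach_leq => H; apply: far; apply: H; rewrite /D; lia.
(* The answer is the end of a trail of [l.+2] steps that starts at an arbitrary core vertex. *)
- have [/fset0Pn[c0 c0C] _] := good_core gn'.
  have c0A : c0 \in f @` A by apply: (fsubsetP CA').
  have gA : exists y, [/\ y < n', E c0 y & ~ cl E (l + l.+2) n' (f @` A) y].
    have [|y [yn c0y ncly]] := good_free gn' (h := c0) bP' (ltnW cP').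
      by rewrite inE c0C.
    exists y; split=> //; rewrite fA => /cl_leq H; apply: ncly; apply: H.
    by move: lD lL; rewrite /D; lia.
  have [v' [v'n nclv' nbv' iso_v']] := exists_isolated gn' bA' c0A (erefl _) gA.
  have gpl : game_pos E C l n n' A f g.
    by apply: (game_pos_leq Esym _ (fsubset_refl A) gp); move: lD; lia.
  have isov : iso_on E (fun x => x \in [fset v]) (fun x => x \in [fset v'])
      (fun=> v') (fun=> v).
    split=> [x|x|x z]; rewrite !inE ?eqxx; try by move=> /eqP ->.
    by move=> /eqP -> /eqP ->; rewrite !Eirr.
  have [|||||||f2 [g2 [gp2 f2A _]]] := game_pos_glue Esym gpl (fset11 v) CA _ _ _ _ isov.
  + by move=> x; rewrite inE => /eqP->.
  + by move=> x; rewrite inE => /eqP->.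
  + move=> x; rewrite inE => /eqP-> clv; apply: (nreach v 0 clv) => //.
    by rewrite /D; lia.
  + by move=> x; rewrite inE => /eqP->.
  + have [_ _ [fU gU fE] _] := gpl => x w clx; rewrite inE => /eqP ->.
    rewrite (negbTE (nbv' _ (proj1 (fU x clx)))); apply/esym/negbTE/negP => xv.
    by apply: (nreach x 1 clx); [exact: walk1|rewrite /D; lia].
  + by move=> x /iso_v[clx|->]; [left|right; rewrite inE].
  + by move=> x /iso_v'[clx|->]; [left|right; rewrite inE].
  by exists f2, g2.
have [/fset0Pn[w wQ] _ _] := cQ.
have farQ q : q \in Q -> ~ reach n (l1 + l.+2) A q.
  move=> /Qv[d [dl wk]] rq; apply: far; apply: reach_leq (reach_walk rq wk).
  by rewrite /D; lia.
have QC : ~~ (Q `<=` C).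
  apply/negP => /fsubsetP QC; apply: (farQ w wQ); exists w, 0; split=> //.
  by apply: (fsubsetP CA); apply: QC.
have cQL : #|` Q| <= Lam by move: lLam kQ; arith_lia.
have [Q' [f1 [g1 [isoQ bQ' farQ']]]] := good_circuit gn' cQ cQL QC bP' cP'.
rewrite -fA in farQ'.
have [cQ' kQ'] := iso_on_circuit isoQ cQ.
have l1L : l1 + l.+1 < Lam by move: lD lL; rewrite /D; arith_lia.
have gp1 : game_pos E C l1 n n' A f g.
  by apply: (game_pos_leq Esym _ (fsubset_refl A) gp); move: lD; rewrite /D; arith_lia.
have l1l2 : l1 + l.+1 < l1 + l.+2 by arith_lia.
have l1L2 : l1 + l.+2 <= Lam by arith_lia.
have farc := far_cl gn CA kQ bQ l1l2 l1L2 farQ.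
have farcU := far_clU gn CA cQ kQ bQ wQ l1l2 l1L2 farQ.
have kQ'' : #|` Q'| <= l.+1 := leq_trans kQ' kQ.
have [f1Q _ _] := isoQ; have w'Q' := proj1 (f1Q w wQ).
have farc' := far_cl gn' CA' kQ'' bQ' l1L (leqnn Lam) farQ'.
have farcU' := far_clU gn' CA' cQ' kQ'' bQ' w'Q' l1L (leqnn Lam) farQ'.
(* The whole circuit is matched with its copy at level [l1]; the pebble then slides from [w] to [v]
   in at most [l] steps. *)
have [|||f2 [g2 [gp2 f2A _]]] :=
  game_pos_glue Esym gp1 wQ CA bQ bQ' _ _ isoQ _ farcU farcU'.
- by move=> x xQ /farc[]; rewrite xQ.
- by move=> x xQ /farc'[]; rewrite xQ.
- have [_ _ [fU gU fE] _] := gp1 => x q clx qQ.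
  rewrite (negbTE (proj2 (farc' _ (proj1 (fU x clx))) _ _)) ?(proj1 (f1Q q qQ)) //.
  by rewrite (negbTE (proj2 (farc _ clx) _ qQ)).
have [d [dl wk]] := Qv w wQ.
have gp2' : game_pos E C (slide_level d l) n n' (w |` A) f2 g2.
  apply: (game_pos_leq Esym _ (fsubset_refl _) gp2); exact: slide_level_leq.
have [|f3 [g3 [gp3 f3f2]]] := game_pos_slide gn' cP _ wk gp2'.
  by apply: leq_trans (slide_level_leq l dl) _; rewrite -/l1; arith_lia.
by exists f3, g3; split=> // x xA; rewrite f3f2 // f2A.
Qed.

End Game.

(** * Large graphs of the sequence have the extension property *)

Lemma fin_bound (T : finType) (P : T -> nat -> Prop) :
  (forall c b b', b <= b' -> P c b -> P c b')%N -> (forall c, exists b, P c b) ->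
  exists b, forall c, P c b.
Proof.
move=> mono /choice[b Pb]; exists (\max_c b c)%N => c.
by apply: mono (Pb c); apply: leq_bigmax.
Qed.

Section Limit.
Local Open Scope fset_scope.
Local Open Scope nat_scope.
Variable E : rel nat.
Hypothesis Esym : symmetric E.
Hypothesis Eirr : irreflexive E.

(** Connectedness by cuts. [T] may stick out of [W], so that growing sets can be inserted
    directly. *)
Definition conn (W : {fset nat}) : Prop := forall T : {fset nat},
  ~~ fdisjoint T W -> ~~ (W `<=` T) ->
  exists t z, [/\ t \in T, t \in W, z \in W, z \notin T & E t z].

Lemma disjointPn (X Y : {fset nat}) :
  reflect (exists2 x, x \in X & x \in Y) (~~ fdisjoint X Y).
Proof.
apply: (iffP idP) => [|[x xX xY]]; last first.
  by apply/negP => /fdisjointP/(_ x xX); rewrite xY.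
rewrite /fdisjoint => /fset0Pn[x]; rewrite inE => /andP[]; by exists x.
Qed.

Lemma walk_conn n d x y : x < n -> walk E n d x y ->
  exists W, [/\ conn W, x \in W, y \in W, #|` W| <= d.+1 & below n W].
Proof.
elim: d x => [|d IHd] x xn /= => [<-|[z [zn xz /(IHd _ zn)[W [cW zW yW kW bW]]]]].
  exists [fset x]; split; rewrite ?inE ?cardfs1 //.
    by move=> T /disjointPn[t tT]; rewrite inE => /eqP <- /negP[]; rewrite fsub1set.
  by move=> t; rewrite inE => /eqP ->.
exists (x |` W); split; rewrite ?inE ?eqxx ?yW ?orbT //; last 2 first.
- by rewrite cardfsU1; case: (x \notin W); move: kW; lia.
- by move=> t; rewrite !inE => /orP[/eqP->|/bW].
move=> T TW WT; have [dTW|/negPn dTW] := boolP (~~ fdisjoint T W).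
  have [WT'|WT'] := boolP (W `<=` T).
    exists z, x; split; rewrite ?inE ?eqxx ?zW ?orbT //.
    - exact: (fsubsetP WT').
    - by apply: contra WT => xT; fset_tac.
    - by rewrite Esym.
  have [t [u [tT tW uW uT tu]]] := cW T dTW WT'.
  by exists t, u; split; rewrite ?inE ?tW ?uW ?orbT.
have /disjointPn[t tT] := TW; rewrite !inE (negbTE (fdisjointP dTW _ tT)) orbF => /eqP tx.
exists x, z; split; rewrite ?inE ?eqxx ?zW ?orbT //; first by rewrite -tx.
exact: (fdisjointP_sym dTW).
Qed.

Lemma connU W W' p : conn W -> conn W' -> p \in W -> p \in W' -> conn (W `|` W').
Proof.
move=> cW cW' pW pW'.
have key T V V' : conn V -> p \in V -> p \in V' ->
  (~~ (V `<=` T)) -> (p \in T \/ ~~ fdisjoint T V) ->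
  exists t z, [/\ t \in T, t \in V `|` V', z \in V `|` V', z \notin T & E t z].
  move=> cV pV pV' VT H; have TV : ~~ fdisjoint T V.
    by case: H => // pT; apply/disjointPn; exists p.
  have [t [z [tT tV zV zT tz]]] := cV T TV VT.
  by exists t, z; split; rewrite ?inE ?tV ?zV.
move=> T TW WT; have [pT|pT] := boolP (p \in T).
  have : ~~ (W `<=` T) \/ ~~ (W' `<=` T).
    have [WT'|] := boolP (W `<=` T); last by left.
    by right; apply: contra WT => WT''; fset_tac.
  case=> VT; first by apply: key cW pW pW' VT _; left.
  by rewrite fsetUC; apply: key cW' pW' pW VT _; left.
have nsub V : p \in V -> ~~ (V `<=` T) by move=> pV; apply/fsubsetPn; exists p.
have /disjointPn[t tT] := TW; rewrite inE => /orP[tW|tW].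
  by apply: (key T _ _ cW) => //; [exact: nsub|right; apply/disjointPn; exists t].
rewrite fsetUC; apply: (key T _ _ cW') => //; first exact: nsub.
by right; apply/disjointPn; exists t.
Qed.

(** By supermodularity, since the intersection is a nonempty proper part of the circuit and has
    negative [del]. *)
Lemma circuit_join B Q : circuit E Q -> ~~ fdisjoint B Q -> ~~ (Q `<=` B) ->
  (del E B < del E (B `|` Q))%R.
Proof.
move=> [_ dQ mQ] /disjointPn[x xB xQ] QB.
have : (del E (B `&` Q) < 0)%R.
  apply: mQ; first by apply/fset0Pn; exists x; rewrite inE xB.
  by rewrite fproperIr.
by have := del_supermod Esym B Q; rewrite dQ; lia.
Qed.

(** [B] is enlarged inside [W] by adjacent vertices, which does not lower [del], until it meets [Q];
    then [circuit_join] gives the strict gain. *)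
Lemma circuit_gain B W Q : conn W -> circuit E Q -> ~~ fdisjoint W Q ->
  (~~ fdisjoint B W \/ ~~ fdisjoint B Q) -> ~~ (Q `<=` B) ->
  exists Y, [/\ B `<=` Y, Y `<=` B `|` W `|` Q & (del E B < del E Y)%R].
Proof.
move=> cW cQ WQ; have [k] := ubnP #|` W `\` B|; elim: k B => // k IHk B kB H QB.
have [BQ|BQ] := boolP (~~ fdisjoint B Q).
  by exists (B `|` Q); split; [fset_tac|fset_tac|exact: circuit_join].
have BW : ~~ fdisjoint B W by case: H => //; rewrite (negbTE BQ).
move/negPn: BQ => BQ.
have [t [z [tB tW zW zB tz]]] : exists t z, [/\ t \in B, t \in W, z \in W, z \notin B & E t z].
  apply: cW => //; have /disjointPn[w wW wQ] := WQ.
  by apply/fsubsetPn; exists w => //; apply: (fdisjointP_sym BQ).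
have dz : (del E B <= del E (z |` B))%R.
  rewrite delU1 //; have : 0 < deg E z B by apply: deg_gt0 tB _; rewrite Esym.
  by lia.
have [|||Y [BY YBW dY]] := IHk (z |` B).
- rewrite (cardfsD1 z) !inE zB zW /= in kB.
  by rewrite (_ : W `\` (z |` B) = (W `\` B) `\ z) //; fset_tac.
- by left; apply/disjointPn; exists z; rewrite ?inE ?eqxx.
- apply/negP => QzB.
  have Qz : Q `<=` [fset z].
    apply/fsubsetP => q qQ; have := fsubsetP QzB q qQ.
    by rewrite !inE (negbTE (fdisjointP_sym BQ _ qQ)) orbF.
  have [Q0 dQ _] := cQ.
  have EQ : Q = [fset z] by move: Qz; rewrite fsubset1 (negbTE Q0) orbF => /eqP.
  by move: dQ; rewrite EQ del1.
exists Y; split; [fset_tac|fset_tac|lia].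
Qed.

Lemma cl_union l n (B S : {fset nat}) : below n B -> (forall y, y \in S -> cl E l n B y) ->
  exists X, [/\ rigid E B X, S `<=` X, below n X & #|` X `\` B| <= #|` S| * l].
Proof.
move=> bB; have [k] := ubnP #|` S|; elim: k S => // k IHk S kS clS.
have [->|/fset0Pn[y yS]] := eqVneq S fset0.
  by exists B; split=> //; [exact: rigid_refl|rewrite fsetDv cardfs0].
have cS := cardfsD1 y S; rewrite yS in cS.
have [||X [rX SX bX cX]] := IHk (S `\ y).
- by move: kS; rewrite cS; lia.
- by move=> z; rewrite inE => /andP[_ /clS].
have [X2 [rX2 yX2 cX2 bX2]] := clS y yS; exists (X `|` X2); split.
- exact: rigidU.
- apply/fsubsetP => z zS; rewrite inE; have [->|zy] := eqVneq z y; first by rewrite yX2 orbT.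
  by rewrite (fsubsetP SX) // !inE zy.
- by move=> z; rewrite inE => /orP[/bX|/bX2].
have : (X `|` X2) `\` B `<=` (X `\` B) `|` (X2 `\` B) by fset_tac.
move/fsubset_leq_card => /leq_trans; apply; rewrite cardfsU cS.
by apply: leq_trans (leq_subr _ _) _; rewrite mulnDl mul1n addnC leq_add.
Qed.

(* The handshake lemma for the vertices of [X] outside [Z] that are not
   isolated: [del] does not increase from [Z] to [X], so there are at most as
   many edges as such vertices. *)
Lemma degree_sum (X Z U : {fset nat}) : Z `<=` X ->
  (forall Y, Z `<=` Y -> Y `<=` X -> (del E Y <= del E Z)%R) ->
  U = [fset x in X | (x \notin Z) && (0 < deg E x X)] ->
  \sum_(x <- U) deg E x X + cross E U Z <= 2 * #|` U|.
Proof.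
move=> ZX maxZ EU.
have inU x : (x \in U) = [&& x \in X, x \notin Z & 0 < deg E x X] by rewrite EU !inE.
have dZU : [disjoint Z & U]%fset.
  by apply/fdisjointP => x xZ; rewrite inU xZ andbF.
have UX : U `<=` X by apply/fsubsetP => x; rewrite inU => /and3P[].
clear EU.
have ZUX : Z `|` U `<=` X by fset_tac.
have le1 := maxZ (Z `|` U) (fsubsetUl _ _) ZUX.
have degE x : x \in U -> deg E x X = deg E x Z + deg E x U.
  have XE : X = (Z `|` U) `|` (X `\` (Z `|` U)) by fset_tac.
  move=> xU; rewrite -degU // XE degU -?XE; last by fset_tac.
  rewrite [X in _ + X]deg_eq0 ?addn0 //.
  move=> y; rewrite !inE => /andP[/norP[yZ yU] yX]; apply/negP => xy.
  move: yU; rewrite inU yZ yX /= => /negP; apply.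
  by apply: (@deg_gt0 _ _ _ x); [exact: (fsubsetP UX)|rewrite Esym].
have -> : \sum_(x <- U) deg E x X = cross E U Z + cross E U U.
  by rewrite /cross -big_split /= big_seq [RHS]big_seq; apply: eq_bigr => x /degE.
move: le1; rewrite delU // (cross_sym Esym Z U).
rewrite /del; move: (cross E Z Z) (cross E U U) (cross E U Z) #|` Z| #|` U|; lia.
Qed.

(** In [degree_sum] all vertices other than pebbles contribute at least 2, so the slack is at most
    the number of pebbles. It bounds the edges into [Z], and it bounds one pebble's degree by
    [2 + (#|P| - 1)]. This is where the condition [gam + 2 <= m] comes from. *)
Lemma degree_sum_pebbles (X Z P : {fset nat}) : Z `<=` X ->
  (forall Y, Z `<=` Y -> Y `<=` X -> (del E Y <= del E Z)%R) ->
  (forall x, x \in X -> x \notin Z -> x \notin P -> 1 < deg E x X) ->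
  (forall S, S `<=` X -> [disjoint S & Z]%fset -> (forall x, x \in S -> 0 < deg E x Z) ->
    #|` S| <= #|` P|) /\
  (forall h, h \in X -> h \notin Z -> h \in P -> deg E h X <= #|` P|.+1).
Proof.
move=> ZX maxZ degX; pose U := [fset x in X | (x \notin Z) && (0 < deg E x X)].
have dsum := degree_sum ZX maxZ (erefl U).
have inU x : (x \in U) = [&& x \in X, x \notin Z & 0 < deg E x X] by rewrite !inE.
have cUP : \sum_(x <- U) (x \in P) <= #|` P|.
  rewrite (big_fsetID _ (mem P)) /= [X in _ + X]big1_fset ?addn0; last first.
    by move=> x; rewrite !inE => /andP[_ /negbTE->].
  apply: (@leq_trans #|` [fset x in U | x \in P]|).
    by rewrite card_fset_sum1; apply: leq_sum => x _; apply: leq_b1.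
  by apply: fsubset_leq_card; apply/fsubsetP => x; rewrite !inE => /andP[].
have two x : x \in U -> 2 <= deg E x X + (x \in P).
  rewrite inU => /and3P[xX xZ x0]; have [xP|xP] := boolP (x \in P); first by move: x0; lia.
  by have := degX x xX xZ xP; lia.
have two_sum (V : {fset nat}) : V `<=` U ->
    2 * #|` V| <= \sum_(x <- V) (deg E x X + (x \in P)).
  move=> VU; rewrite card_fset_sum1 big_distrr /= big_seq [leqRHS]big_seq.
  by apply: leq_sum => x /(fsubsetP VU)/two.
split=> [S SX dSZ Sdeg|h hX hZ hP].
  have SU : S `<=` U.
    apply/fsubsetP => x xS; rewrite inU (fsubsetP SX) // (fdisjointP dSZ) //=.
    exact: leq_trans (Sdeg x xS) (deg_subset _ _ ZX).
  have : #|` S| <= cross E U Z.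
    apply: leq_trans (cross_subset _ _ SU); rewrite card_fset_sum1 /cross.
    by rewrite big_seq [leqRHS]big_seq; apply: leq_sum => x /Sdeg.
  have := two_sum U (fsubset_refl U); rewrite big_split /=; move: dsum cUP.
  move: (\sum_(x <- U) deg E x X) (\sum_(x <- U) (x \in P)) (cross E U Z) #|` U| #|` S| #|` P| => *; lia.
have [->//|hdeg] := posnP (deg E h X).
have hU : h \in U by rewrite inU hX hZ.
have := two_sum (U `\ h) (fsubsetDl _ _); rewrite big_split /=.
move: dsum cUP; rewrite !(big_fsetD1 h hU) /= (cardfsD1 h U) hU hP /=.
move: (\sum_(x <- U `\ h) deg E x X) (\sum_(x <- U `\ h) (x \in P)) (cross E U Z) #|` U `\ h| #|` P| => *; lia.
Qed.

Definition iset (b : nat) : {fset nat} := [fset x | x in iota 0 b].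

Lemma in_iset b x : (x \in iset b) = (x < b).
Proof. by rewrite inE /= mem_iota add0n leq0n. Qed.

Lemma iset_sub b (X : {fset nat}) : below b X -> X `<=` iset b.
Proof. by move=> bX; apply/fsubsetP => x /bX; rewrite in_iset. Qed.

Lemma iset_leq b b' : b <= b' -> iset b `<=` iset b'.
Proof. by move=> bb; apply: iset_sub => x; rewrite in_iset => xb; apply: leq_trans bb. Qed.

Lemma deg_all x (S : {fset nat}) : (forall y, y \in S -> E x y) -> deg E x S = #|` S|.
Proof.
move=> H; rewrite card_fset_sum1 /deg big_seq [RHS]big_seq.
by apply: eq_bigr => y /H ->.
Qed.

Definition rigid_bound (b L b' : nat) : Prop :=
  b <= b' /\ forall X, rigid E (iset b) X -> #|` X `\` iset b| <= L -> below b' X.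

(** The common setting of the two degree counts. [X] joins the rigid sets that witness the closure
    of all of [S], and [Z] is its largest rigid part over [[0, b)], hence below [b']. Degrees of at
    least 2 survive because the witnesses are rigid over [P] and a smaller initial segment. *)
Lemma closure_max l b0 b b' n (P S : {fset nat}) (L : nat) :
  b0 <= b -> b <= n -> below n P -> #|` S| * l + #|` P| <= L ->
  (forall y, y \in S -> cl E l n (iset b0 `|` P) y) -> rigid_bound b L b' ->
  exists X Z, [/\ S `<=` X, iset b `|` P `<=` X, Z `<=` X, below b' Z & iset b `<=` Z] /\
  (forall Y, Z `<=` Y -> Y `<=` X -> (del E Y <= del E Z)%R) /\
  (forall x, x \in X -> x \notin Z -> x \notin P -> 1 < deg E x X).
Proof.
move=> b0b bn bP SL clS [_ rb].
have bB : below n (iset b0 `|` P).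
  by move=> x; rewrite inE in_iset => /orP[xb|/bP//]; apply: leq_trans xb (leq_trans b0b bn).
have [X [rX SX bX cX]] := cl_union bB clS.
have [BX _] := rX; have b0b' := iset_leq b0b.
have [Z [rZ ZX maxZ]] := exists_rigid_max Esym (fsubsetUl (iset b) X).
have [bZ _] := rZ.
exists (iset b `|` X), Z; split; [split=> //|split=> //].
- by fset_tac.
- by fset_tac.
- apply: rb => //; apply: leq_trans SL; apply: leq_trans (leq_add cX (leqnn _)).
  have : Z `\` iset b `<=` (X `\` (iset b0 `|` P)) `|` P by fset_tac.
  by move/fsubset_leq_card => /leq_trans; apply; rewrite cardfsU leq_subr.
- move=> x xX xZ xP.
  have xb : x \notin iset b by apply: contra xZ; apply: (fsubsetP bZ).
  move: xX; rewrite inE (negbTE xb) /= => xX.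
  apply: (@leq_trans (deg E x X)); last by apply: deg_subset; apply: fsubsetUr.
  apply: (rigid_deg Esym Eirr rX) => //; rewrite inE negb_or xP andbT.
  by apply: contra xb; apply: (fsubsetP b0b').
Qed.

(** The vertices of [S] lie beyond [Z] but are adjacent to [h] in [Z], and there are more of them
    than edges the count allows. *)
Lemma free_core l b0 b b' n h (P S : {fset nat}) L :
  b0 <= b -> b <= n -> below n P -> #|` S| * l + #|` P| <= L -> rigid_bound b L b' ->
  h < b -> #|` P| < #|` S| -> (forall y, y \in S -> b' <= y /\ E h y) ->
  exists y, y \in S /\ ~ cl E l n (iset b0 `|` P) y.
Proof.
move=> b0b bn bP SL rb hb PS HS; apply: contrapT => none.
have clS y : y \in S -> cl E l n (iset b0 `|` P) y.
  by move=> yS; apply: contrapT => ncl; apply: none; exists y.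
have [X [Z [[SX bPX ZX bZ iZ] [maxZ degX]]]] := closure_max b0b bn bP SL clS rb.
have [sum1 _] := degree_sum_pebbles ZX maxZ degX.
suff cS : #|` S| <= #|` P| by rewrite leqNgt PS in cS.
apply: sum1 => //.
  by apply/fdisjointP => y /HS[yb _]; apply/negP => /bZ; rewrite ltnNge yb.
move=> y /HS[_ hy]; apply: (@deg_gt0 _ _ _ h); last by rewrite Esym.
by apply: (fsubsetP iZ); rewrite in_iset.
Qed.

(** If all of [S] were in the closure, the pebble [h] would have degree at least [#|P| + 2] in
    [X]. *)
Lemma free_pebble l b b' n h (P S : {fset nat}) L :
  b <= n -> below n P -> #|` S| * l + #|` P| <= L -> rigid_bound b L b' ->
  h \in P -> b' <= h -> #|` P|.+1 < #|` S| -> (forall y, y \in S -> E h y) ->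
  exists y, y \in S /\ ~ cl E l n (iset b `|` P) y.
Proof.
move=> bn bP SL rb hP hb PS HS; apply: contrapT => none.
have clS y : y \in S -> cl E l n (iset b `|` P) y.
  by move=> yS; apply: contrapT => ncl; apply: none; exists y.
have [X [Z [[SX bPX ZX bZ iZ] [maxZ degX]]]] := closure_max (leqnn b) bn bP SL clS rb.
have [_ sum2] := degree_sum_pebbles ZX maxZ degX.
have : deg E h X <= #|` P|.+1.
  apply: sum2 => //; first by apply: (fsubsetP bPX); rewrite inE hP orbT.
  by apply/negP => /bZ; rewrite ltnNge hb.
by apply/negP; rewrite -ltnNge (leq_trans PS) // -(deg_all HS) deg_subset.
Qed.

(** [Q] must lie in the largest rigid part over [[0, b)], since otherwise [circuit_gain] would raise
    [del] further. *)
Lemma circuit_near b b' L W Q : conn W -> circuit E Q -> rigid_bound b L b' ->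
  ~~ fdisjoint W Q -> (~~ fdisjoint (iset b) W \/ ~~ fdisjoint (iset b) Q) ->
  #|` W| + #|` Q| <= L -> below b' Q.
Proof.
move=> cW cQ [_ rb] WQ H cL.
have bX : iset b `<=` iset b `|` W `|` Q by fset_tac.
have [Z [rZ ZX maxZ]] := exists_rigid_max Esym bX.
have bZ : below b' Z.
  apply: rb => //; apply: leq_trans cL.
  have : Z `\` iset b `<=` W `|` Q by fset_tac.
  by move/fsubset_leq_card => /leq_trans; apply; rewrite cardfsU leq_subr.
have [iZ _] := rZ.
have [QZ|QZ] := boolP (Q `<=` Z); first by move=> q /(fsubsetP QZ)/bZ.
have [|Y [ZY YX dY]] := circuit_gain cW cQ WQ _ QZ.
  by case: H => /disjointPn[x xb xW]; [left|right]; apply/disjointPn; exists x => //; apply: (fsubsetP iZ).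
suff YX' : Y `<=` iset b `|` W `|` Q by have := maxZ Y ZY YX'; rewrite leNgt dY.
by fset_tac.
Qed.

(* Otherwise [Q1], [Q2] and the walks joining them to [p] contain a rigid set
   over the empty set, and that set lies below [b]. *)
Lemma circuit_pair b b' L W1 W2 Q1 Q2 p : conn W1 -> conn W2 ->
  p \in W1 -> p \in W2 -> circuit E Q1 -> circuit E Q2 -> Q1 != Q2 ->
  ~~ fdisjoint W1 Q1 -> ~~ fdisjoint W2 Q2 ->
  #|` W1| + #|` W2| + #|` Q1| + #|` Q2| <= L ->
  (forall X, rigid E fset0 X -> #|` X| <= L -> below b X) -> rigid_bound b L b' ->
  below b' Q1 \/ below b' Q2.
Proof.
move=> cW1 cW2 pW1 pW2 cQ1 cQ2 Q12 WQ1 WQ2 cL r0 rb.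
have cW := connU cW1 cW2 pW1 pW2; set W := W1 `|` W2 in cW.
have sub (V V' Q : {fset nat}) : V `<=` V' -> ~~ fdisjoint V Q -> ~~ fdisjoint V' Q.
  by move=> VV /disjointPn[x xV xQ]; apply/disjointPn; exists x => //; apply: (fsubsetP VV).
have W1W : ~~ fdisjoint W Q1 by apply: sub WQ1; apply: fsubsetUl.
have W2W : ~~ fdisjoint W Q2 by apply: sub WQ2; apply: fsubsetUr.
have cW12 : #|` W| <= #|` W1| + #|` W2| by rewrite cardfsU leq_subr.
have Q2Q1 : ~~ (Q2 `<=` Q1).
  apply/negP => Q21; have [_ _ mQ1] := cQ1; have [Q20 dQ2 _] := cQ2.
  by have := mQ1 Q2 Q20; rewrite fproperEneq eq_sym Q12 Q21 dQ2 => /(_ isT).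
have [|Y [QY YX dY]] := circuit_gain (B := Q1) cW cQ2 W2W _ Q2Q1.
  by left; have /disjointPn[x xW xQ] := W1W; apply/disjointPn; exists x.
have [_ dQ1 _] := cQ1; rewrite dQ1 in dY.
have [|Z [rZ ZY Z0]] := exists_rigid_gt Esym (fsub0set Y); first by rewrite del0.
have bZ : below b Z.
  apply: r0 => //; apply: leq_trans cL.
  have : Z `<=` W `|` (Q1 `|` Q2) by fset_tac.
  move/fsubset_leq_card => /leq_trans; apply; rewrite cardfsU.
  apply: leq_trans (leq_subr _ _) _; rewrite -addnA; apply: leq_add => //.
  by rewrite cardfsU leq_subr.
have /fset0Pn[z zZ] : Z != fset0 by rewrite -fproper0.
have zb : z \in iset b by rewrite in_iset; apply: bZ.
have := fsubsetP YX z (fsubsetP ZY z zZ); rewrite inE => /orP[|zQ2]; last first.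
  right; apply: (circuit_near cW cQ2 rb W2W); last by move: cL cW12; arith_lia.
  by right; apply/disjointPn; exists z.
rewrite inE => /orP[zQ1|zW]; left.
  apply: (circuit_near cW cQ1 rb W1W); last by move: cL cW12; arith_lia.
  by right; apply/disjointPn; exists z.
apply: (circuit_near cW cQ1 rb W1W); last by move: cL cW12; arith_lia.
by left; apply/disjointPn; exists z.
Qed.

Lemma fset_subset_card k (S : {fset nat}) : k <= #|` S| ->
  exists2 S', S' `<=` S & #|` S'| = k.
Proof.
elim: k => [|k IHk] kS; first by exists fset0; rewrite ?fsub0set ?cardfs0.
have [S' S'S kS'] := IHk (ltnW kS).
have /fsubsetPn[x xS xS'] : ~~ (S `<=` S').
  by apply/negP => /fsubset_leq_card; rewrite kS' leqNgt kS.
by exists (x |` S'); [fset_tac|rewrite cardfsU1 xS' kS'].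
Qed.

Lemma two_elements (S : {fset nat}) : 1 < #|` S| ->
  exists y z, [/\ y \in S, z \in S & y != z].
Proof.
move=> S1; have /fset0Pn[y yS] : S != fset0 by rewrite -cardfs_gt0 ltnW.
have /fset0Pn[z] : S `\ y != fset0.
  by rewrite -cardfs_gt0; move: S1; rewrite (cardfsD1 y) yS.
by rewrite !inE => /andP[zy zS]; exists y, z; rewrite eq_sym.
Qed.

(** * Isomorphism types of small circuits *)

Section Circuits.
Variable Lam : nat.

(** Size and adjacency matrix in the enumeration order of [Q], an element of a finite type.
    Positions past the end read vertex 0, so isomorphic sets may have different codes; only the
    converse implication matters. *)
Definition code (Q : {fset nat}) : 'I_Lam.+1 * {ffun 'I_Lam.+1 * 'I_Lam.+1 -> bool} :=
  (inord #|` Q|, [ffun p : 'I_Lam.+1 * 'I_Lam.+1 => E (nth 0 Q p.1) (nth 0 Q p.2)]).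

Lemma code_iso Q Q' : #|` Q| <= Lam -> #|` Q'| <= Lam -> code Q = code Q' ->
  exists f g, iso_on E (fun x => x \in Q) (fun x => x \in Q') f g.
Proof.
move=> cQ cQ' [/(congr1 val)]; rewrite /= !inordK ?ltnS // => QQ' /ffunP QE.
exists (fun x => nth 0 Q' (index x Q)), (fun x => nth 0 Q (index x Q')); split.
- move=> x xQ; have iQ : index x Q < size Q' by rewrite -QQ' index_mem.
  by rewrite mem_nth // index_uniq ?fset_uniq // nth_index.
- move=> x xQ; have iQ : index x Q' < size Q by rewrite QQ' index_mem.
  by rewrite mem_nth // index_uniq ?fset_uniq // nth_index.
move=> x y xQ yQ.
have iL z : z \in Q -> index z Q < Lam.+1.
  by move=> zQ; rewrite ltnS; apply: leq_trans cQ; apply: ltnW; rewrite index_mem.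
have := QE (Ordinal (iL x xQ), Ordinal (iL y yQ)).
by rewrite !ffunE /= !nth_index // => ->.
Qed.

Definition small_circuit (Q : {fset nat}) : Prop := circuit E Q /\ #|` Q| <= Lam.

Lemma circuits_dichotomy : exists b, forall c,
  (forall Q, small_circuit Q -> code Q = c -> below b Q) \/
  (forall b', exists Q, [/\ small_circuit Q, code Q = c & ~ below b' Q]).
Proof.
apply: fin_bound => [c b b' bb [H|H]|c]; [left|by right|].
  by move=> Q sQ cQ x xQ; apply: leq_trans bb; apply: (H Q).
have [H|/existsNP[b H]] := pselect (forall b', exists Q, [/\ small_circuit Q, code Q = c & ~ below b' Q]).
  by exists 0; right.
exists b; left=> Q sQ cQ; apply: contrapT => nb; apply: H; by exists Q.
Qed.

Lemma many_circuits b c k :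
  (forall b', exists Q, [/\ small_circuit Q, code Q = c & ~ below b' Q]) ->
  exists N (s : seq {fset nat}), [/\ uniq s, size s = k &
    forall Q, Q \in s -> [/\ small_circuit Q, code Q = c, ~ below b Q & below N Q]].
Proof.
move=> H; elim: k => [|k [N [s [us ks Hs]]]]; first by exists 0, [::].
have [Q [sQ cQ nQ]] := H (maxn b N).
have below_max M (X : {fset nat}) : below M X -> M <= maxn b N -> below (maxn b N) X.
  by move=> bX MM x /bX xM; apply: leq_trans MM.
exists (maxn N (\max_(x <- Q) x).+1), (Q :: s); split.
- rewrite /= us andbT; apply/negP => /Hs[_ _ _ /below_max H']; apply: nQ; apply: H'.
  exact: leq_maxr.
- by rewrite /= ks.
move=> X; rewrite inE => /orP[/eqP->|/Hs[sX cX nX bX]]; split=> //.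
- by move=> /below_max H'; apply: nQ; apply: H'; exact: leq_maxl.
- by move=> x xQ; rewrite leq_max ltnS leq_bigmax_seq ?orbT.
- by move=> x /bX xN; rewrite leq_max xN.
Qed.

End Circuits.

Variables (m gam Lam : nat).
Hypothesis bounded_rigid : forall (F : {fset nat}) L, exists b, forall X,
  rigid E F X -> #|` X `\` F| <= L -> below b X.
Hypothesis infinite_degree : forall v b, exists y, b <= y /\ E v y.
Hypothesis lower_degree : forall v, m <= v ->
  exists S : {fset nat}, [/\ #|` S| = m, below v S & forall y, y \in S -> E v y].
Hypothesis gam_m : gam + 2 <= m.

Lemma rigid_bound_exists b L b0 : exists b', b0 <= b' /\ rigid_bound b L b'.
Proof.
have [b' H] := bounded_rigid (iset b) L; exists (maxn b0 (maxn b b')); split.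
  exact: leq_maxl.
split; first by rewrite leq_max leq_maxl orbT.
by move=> X rX cX x xX; rewrite !leq_max (H X rX cX) ?orbT.
Qed.

Lemma many_neighbours v b k : exists N (S : {fset nat}), [/\ #|` S| = k, below N S &
  forall y, y \in S -> b <= y /\ E v y].
Proof.
elim: k => [|k [N [S [kS bS HS]]]]; first by exists 0, fset0; rewrite cardfs0; split.
have [y [yb vy]] := infinite_degree v (maxn b N).
have yS : y \notin S by apply/negP => /bS; move: yb; rewrite geq_max => /andP[_]; lia.
exists (maxn N y.+1), (y |` S); split.
- by rewrite cardfsU1 yS kS.
- by move=> z; rewrite !inE => /orP[/eqP->|/bS zN]; rewrite leq_max ?zN ?ltnSn ?orbT.
- move=> z; rewrite !inE => /orP[/eqP->|/HS//]; split=> //.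
  by move: yb; rewrite geq_max => /andP[].
Qed.

Lemma good_eventually : exists C n0, forall n, n0 <= n -> good E C gam Lam n.
Proof.
(* [gam.+2 * Lam + gam] bounds the sets in the degree counts, and [4 * Lam.+1] two circuits with two
   walks in [circuit_pair]. *)
pose L := gam.+2 * Lam + gam + 4 * Lam.+1.
have [bc Hc] := circuits_dichotomy Lam.
have [br Hr] := bounded_rigid fset0 L.
(* [b0] bounds the core, and the 1 makes it nonempty. Pebbles from [b1] on are treated by
   [free_pebble]; all smaller vertices, also those between [b0] and [b1], by [free_core] with
   neighbours beyond [b2]. *)
pose b0 := maxn 1 (maxn bc br).
have [b1 [mb1 rb1]] := rigid_bound_exists b0 L m.
have [b2 [_ rb2]] := rigid_bound_exists b1 L 0.
have [N1 HN1] : exists N, forall h : 'I_b1, exists S : {fset nat},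
    [/\ #|` S| = gam.+2, below N S & forall y, y \in S -> b2 <= y /\ E h y].
  apply: fin_bound => [h b b' bb [S [kS bS HS]]|h]; last exact: many_neighbours.
  by exists S; split=> // x /bS xb; apply: leq_trans bb.
have [N2 HN2] : exists N, forall c, (forall Q, small_circuit Lam Q -> code Lam Q = c -> below b0 Q) \/
    exists s : seq {fset nat}, [/\ uniq s, size s = gam &
    forall Q, Q \in s -> [/\ small_circuit Lam Q, code Lam Q = c, ~ below b1 Q & below N Q]].
  apply: fin_bound => [c b b' bb [H|[s [us ks Hs]]]|c]; [by left|right|].
    by exists s; split=> // Q /Hs[sQ cQ nQ bQ]; split=> // x /bQ xb; apply: leq_trans bb.
  have [H|/(many_circuits b1 gam)[N [s Hs]]] := Hc c; last by exists N; right; exists s.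
  exists 0; left=> Q sQ cQ x xQ; apply: leq_trans (H Q sQ cQ x xQ) _.
  by rewrite leq_max leq_maxl orbT.
exists (iset b0), (maxn b2 (maxn N1 N2)) => n; rewrite !geq_max => /and3P[b2n N1n N2n].
have b01 : b0 <= b1 by case: rb1.
have b12 : b1 <= b2 by case: rb2.
have b1n : b1 <= n := leq_trans b12 b2n.
have Hr0 X : rigid E fset0 X -> #|` X| <= L -> below b0 X.
  move=> rX cX x xX; rewrite !leq_max (Hr X rX) ?orbT //.
  by rewrite fsetD0.
have low v : b1 <= v -> exists S : {fset nat},
    [/\ #|` S| = gam.+2, below v S & forall y, y \in S -> E v y].
  move=> bv; have [S [cS bS HS]] := lower_degree (leq_trans mb1 bv).
  have [|S' S'S cS'] := @fset_subset_card gam.+2 S; first by rewrite cS; lia.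
  by exists S'; split=> // y /(fsubsetP S'S); [apply: bS|apply: HS].
split.
- split; first by apply/fset0Pn; exists 0; rewrite in_iset leq_max.
  by move=> x; rewrite in_iset => xb; apply: leq_trans xb (leq_trans b01 b1n).
- move=> x xn; have [b1x|xb1] := leqP b1 x.
    have [S [cS bS HS]] := low x b1x.
    have [|y [z [yS zS yz]]] := @two_elements S; first by rewrite cS.
    by exists y, z; split; rewrite ?HS // ?(ltn_trans (bS _ yS)) ?(ltn_trans (bS _ zS)).
  have [S [cS bS HS]] := HN1 (Ordinal xb1).
  have [|y [z [yS zS yz]]] := @two_elements S; first by rewrite cS.
  by exists y, z; split; rewrite ?(proj2 (HS _ yS)) ?(proj2 (HS _ zS)) ?(leq_trans (bS _ yS)) ?(leq_trans (bS _ zS)).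
- move=> X rX cX; apply: iset_sub; apply: Hr0 => //; apply: leq_trans cX _.
  by rewrite /L; lia.
- move=> P h bP cP hCP.
  have SL : gam.+2 * Lam + #|` P| <= L by rewrite /L; move: cP; arith_lia.
  have [b1h|hb1] := leqP b1 h.
    have hP : h \in P.
      by move: hCP; rewrite inE in_iset ltnNge (leq_trans b01 b1h).
    have [S [cS bS HS]] := low h b1h.
    have [||y [yS ncl]] := free_pebble (l := Lam) (leq_trans b01 b1n) bP _ rb1 hP b1h _ HS.
    + by rewrite cS.
    + by rewrite cS ltnS.
    by exists y; split=> //; [apply: ltn_trans (bS _ yS) (bP _ hP)|apply: HS].
  have [S [cS bS HS]] := HN1 (Ordinal hb1).
  have [||y [yS ncl]] := free_core (l := Lam) b01 b1n bP _ rb2 hb1 _ HS.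
  + by rewrite cS.
  + by rewrite cS; apply: leqW; rewrite ltnS.
  exists y; split=> //; first by apply: leq_trans (bS _ yS) _.
  by have [] := HS y yS.
move=> Q P cQ cardQ QC bP cP.
have [H|[s [us ks Hs]]] := HN2 (code Lam Q).
  by case/negP: QC; apply: iset_sub; apply: H.
have [[Q' [sQ' far]]|none] := pselect (exists Q', Q' \in s /\
    forall q, q \in Q' -> ~ reach E n Lam (iset b0 `|` P) q).
  have [[cQ' cardQ'] codeQ' _ bQ'] := Hs Q' sQ'.
  have [f [g isoQ]] := code_iso cardQ cardQ' (esym codeQ').
  by exists Q', f, g; split=> // x /bQ' xN; apply: leq_trans xN N2n.
exfalso.
(* The copies are not below [b1], so [circuit_near] keeps them away from the core, and a copy that
   is not far is near a pebble. *)
have near Q' : Q' \in s -> exists p, p \in P /\ exists W,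
    [/\ conn W, p \in W, ~~ fdisjoint W Q' & #|` W| <= Lam.+1].
  move=> sQ'; have [[cQ' cardQ'] _ nQ' _] := Hs Q' sQ'.
  apply: contrapT => H; apply: none; exists Q'; split=> // q qQ' [a [d [aCP dL wk]]].
  have an : a < n.
    by move: aCP; rewrite inE in_iset => /orP[ab|/bP//]; apply: leq_trans ab (leq_trans b01 b1n).
  have [W [cW aW qW kW bW]] := walk_conn an wk.
  have WQ' : ~~ fdisjoint W Q' by apply/disjointPn; exists q.
  have kW' : #|` W| <= Lam.+1 by apply: leq_trans kW _; rewrite ltnS.
  move: aCP; rewrite inE => /orP[ab|aP]; last by apply: H; exists a; split=> //; exists W.
  apply: nQ'; apply: (circuit_near cW cQ' rb1 WQ').
    by left; apply/disjointPn; exists a.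
  by rewrite /L; move: kW' cardQ'; arith_lia.
(* [h] picks a pebble near each copy. It is injective by [circuit_pair], so [gam] copies would
   require [gam] pebbles. *)
have /choice[h Hh] : forall Q' : {fset nat}, exists p, Q' \in s -> p \in P /\
    exists W, [/\ conn W, p \in W, ~~ fdisjoint W Q' & #|` W| <= Lam.+1].
  move=> Q'; have [sQ'|sQ'] := boolP (Q' \in s); last by exists 0.
  by have [p Hp] := near Q' sQ'; exists p.
have : size [seq h Q' | Q' <- s] <= size P.
  apply: uniq_leq_size; last by move=> p /mapP[Q' /Hh[hP _] ->].
  rewrite map_inj_in_uniq // => Q1 Q2 s1 s2 h12; apply/eqP.
  case: eqVneq => // Q12; exfalso.
  have [[cQ1 k1] _ n1 _] := Hs Q1 s1; have [[cQ2 k2] _ n2 _] := Hs Q2 s2.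
  have [_ [W1 [cW1 p1 WQ1 kW1]]] := Hh Q1 s1.
  have [_ [W2 [cW2 p2 WQ2 kW2]]] := Hh Q2 s2; rewrite -h12 in p2.
  have [//|//] : below b1 Q1 \/ below b1 Q2.
  apply: (circuit_pair cW1 cW2 p1 p2 cQ1 cQ2 Q12 WQ1 WQ2 _ Hr0 rb1).
  by rewrite /L; move: kW1 kW2 k1 k2; arith_lia.
by rewrite size_map ks leqNgt cP.
Qed.

Lemma cl_eventually l C : exists n0, forall n n' x, n0 <= n -> n0 <= n' ->
  cl E l n C x -> cl E l n' C x.
Proof.
have [b Hb] := bounded_rigid C l; exists b => n n' x bn bn' [X [rX xX cX bX]].
by exists X; split=> // z zX; apply: leq_trans bn'; apply: (Hb X).
Qed.

End Limit.

(** * From the game to first-order sentences *)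

Section Logic.
Local Open Scope fset_scope.
Local Open Scope nat_scope.
Variable E : rel nat.
Hypothesis Esym : symmetric E.
Hypothesis Eirr : irreflexive E.
Variables (C : {fset nat}) (gam Lam : nat) (V : seq nat).
Hypothesis gamV : size (undup V) <= gam.

Fixpoint fo_level (phi : fo) : nat :=
  match phi with
  | FOeq _ _ | FOadj _ _ => 0
  | FOnot p => fo_level p
  | FOand p q | FOor p q | FOimp p q | FOiff p q => maxn (fo_level p) (fo_level q)
  | FOex _ p | FOall _ p => ext_level (fo_level p)
  end.

Definition ord_rel (n : nat) : rel 'I_n := fun i j => E i j.

Definition similar (l n n' : nat) (s : seq nat) (env : nat -> 'I_n) (env' : nat -> 'I_n') : Prop :=
  exists f g, game_pos E C l n n' (C `|` [fset (env x : nat) | x in s]) f g /\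
    {in s, forall x, env' x = f (env x) :> nat}.

Lemma similar_sub l l' n n' s s' env env' : l <= l' -> {subset s <= s'} ->
  @similar l' n n' s' env env' -> similar l s env env'.
Proof.
move=> ll ss [f [g [gp fe]]]; exists f, g; split; last by move=> x /ss/fe.
apply: (game_pos_leq Esym ll _ gp); apply: fsetUS; apply: subset_imfset.
by move=> x; apply: ss.
Qed.

(** The pebble of the quantified variable is lifted before the move; this is how reuse of variables
    keeps the number of pebbles bounded. *)
Lemma card_env n (s : seq nat) (env : nat -> 'I_n) x : x \in V -> {subset s <= V} ->
  #|` [fset (env y : nat) | y in [seq y <- s | y != x]]| < gam.
Proof.
move=> xV sV; apply: leq_trans gamV.
have : #|` [fset (env y : nat) | y in [seq y <- s | y != x]]| <=
    size [seq (env y : nat) | y <- rem x (undup V)].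
  apply: uniq_leq_size; first exact: fset_uniq.
  move=> z /imfsetP[y /=]; rewrite mem_filter => /andP[yx ys] ->.
  apply: map_f; rewrite mem_rem_uniq ?undup_uniq // inE yx mem_undup.
  exact: sV.
rewrite size_map size_rem ?mem_undup // => H; apply: leq_ltn_trans H _.
by case: (undup V) (mem_undup V x) => [|//]; rewrite xV.
Qed.

Lemma similar_forth l n n' (s : seq nat) x (env : nat -> 'I_n) (env' : nat -> 'I_n') :
  good E C gam Lam n -> good E C gam Lam n' -> ext_level l <= Lam ->
  x \in V -> {subset s <= V} ->
  similar (ext_level l) [seq y <- s | y != x] env env' ->
  forall v, exists v', similar l s [eta env with x |-> v] [eta env' with x |-> v'].
Proof.
move=> gn gn' lL xV sV [f [g [gp fe]]] v.
have [f2 [g2 [gp2 f2f]]] :=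
  game_pos_ext Esym Eirr gn gn' (card_env env xV sV) lL (ltn_ord v) gp.
have v'n : f2 v < n' by have [_ + _ _] := gp2; apply; rewrite in_imfset //= !inE eqxx.
exists (Ordinal v'n), f2, g2; split=> [|y ys] /=.
  apply: (game_pos_leq Esym (leqnn l) _ gp2); apply/fsubsetP => z.
  rewrite inE => /orP[zC|/imfsetP[y /= ys ->]]; first by rewrite !inE zC orbT.
  have [//|yx] := eqVneq y x; first by rewrite !inE eqxx.
  rewrite !inE; apply/orP; right; apply/orP; right; apply/imfsetP; exists y => //=.
  by rewrite mem_filter yx.
have [//|yx] := eqVneq y x.
have ys' : y \in [seq y <- s | y != x] by rewrite mem_filter yx.
by rewrite fe // f2f // inE; apply/orP; right; apply/imfsetP; exists y.
Qed.

Lemma similar_sym l n n' (s : seq nat) (env : nat -> 'I_n) (env' : nat -> 'I_n') :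
  similar l s env env' -> similar l s env' env.
Proof.
move=> [f [g [gp fe]]]; exists g, f.
have [gps gf] := game_pos_sym (fsubsetUl _ _) gp.
have [bB _ [fU _ _] fC] := gp.
split; last first.
  move=> x xs; rewrite fe //; apply/esym; apply: (proj2 (fU (env x) _)).
  by apply: cl_base => //; rewrite inE; apply/orP; right; apply/imfsetP; exists x.
apply: (game_pos_leq Esym (leqnn l) _ gps); apply/fsubsetP => z.
rewrite inE => /orP[zC|/imfsetP[x /= xs ->]].
  by rewrite -(fC z zC) in_imfset //= inE zC.
by rewrite fe // in_imfset //= inE; apply/orP; right; apply/imfsetP; exists x.
Qed.

Lemma similar_sat phi n n' (env : nat -> 'I_n) (env' : nat -> 'I_n') :
  good E C gam Lam n -> good E C gam Lam n' -> fo_level phi <= Lam ->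
  {subset fo_vars phi <= V} -> similar (fo_level phi) (fo_free phi) env env' ->
  fo_sat (@ord_rel n) phi env = fo_sat (@ord_rel n') phi env'.
Proof.
have free_vars psi : {subset fo_free psi <= fo_vars psi}.
  elim: psi => [x y|x y|p IHp|p IHp q IHq|p IHp q IHq|p IHp q IHq|p IHp q IHq|y p IHp|y p IHp] z //=;
    try exact: IHp; rewrite ?mem_cat ?mem_filter ?inE; try by case/orP => [/IHp->|/IHq->]; rewrite ?orbT.
  - by move=> /andP[_ /IHp ->]; rewrite orbT.
  - by move=> /andP[_ /IHp ->]; rewrite orbT.
have backforth l (s : seq nat) x k k' (e : nat -> 'I_k) (e' : nat -> 'I_k') :
    good E C gam Lam k -> good E C gam Lam k' -> ext_level l <= Lam ->
    x \in V -> {subset s <= V} ->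
    similar (ext_level l) [seq y <- s | y != x] e e' ->
    (forall v, exists v', similar l s [eta e with x |-> v] [eta e' with x |-> v']) /\
    (forall v', exists v, similar l s [eta e with x |-> v] [eta e' with x |-> v']).
  move=> gk gk' lL xV sV sim; split; first exact: similar_forth.
  move=> v'; have [v sv] := similar_forth gk' gk lL xV sV (similar_sym sim) v'.
  by exists v; apply: similar_sym.
have split_bin (p q : fo) (k k' : nat) (e : nat -> 'I_k) (e' : nat -> 'I_k') :
    maxn (fo_level p) (fo_level q) <= Lam -> {subset fo_vars p ++ fo_vars q <= V} ->
    similar (maxn (fo_level p) (fo_level q)) (fo_free p ++ fo_free q) e e' ->
    [/\ fo_level p <= Lam, {subset fo_vars p <= V} & similar (fo_level p) (fo_free p) e e'] /\
    [/\ fo_level q <= Lam, {subset fo_vars q <= V} & similar (fo_level q) (fo_free q) e e'].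
  rewrite geq_max => /andP[lp lq] sV sim; split; split=> //.
  - by move=> z zp; apply: sV; rewrite mem_cat zp.
  - by apply: similar_sub sim; [exact: leq_maxl|move=> z zp; rewrite mem_cat zp].
  - by move=> z zq; apply: sV; rewrite mem_cat zq orbT.
  - by apply: similar_sub sim; [exact: leq_maxr|move=> z zp; rewrite mem_cat zp orbT].
elim: phi env env' => /= [x y|x y|p IHp|p IHp q IHq|p IHp q IHq|p IHp q IHq|p IHp q IHq|x p IHp|x p IHp] env env' gn gn' lL sV sim.
- have [f [g [gp fe]]] := sim; have [bB _ [fU _ _] _] := gp.
  have cle z : z \in [:: x; y] -> cl E 0 n (C `|` [fset (env x : nat) | x in [:: x; y]]) (env z).
    by move=> zs; apply: cl_base => //; rewrite inE; apply/orP; right; apply/imfsetP; exists z.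
  apply/eqP/eqP => [exy|/(congr1 val) /=].
    by apply/val_inj; rewrite /= !fe ?exy ?inE ?eqxx ?orbT.
  rewrite !fe ?inE ?eqxx ?orbT // => fxy; apply/val_inj => /=.
  have [_ <-] := fU _ (cle x (mem_head _ _)).
  by rewrite fxy; have [] := fU _ (cle y _) => //; rewrite !inE eqxx orbT.
- have [f [g [gp fe]]] := sim; have [bB _ [_ _ fE] _] := gp.
  rewrite /ord_rel !fe ?inE ?eqxx ?orbT // fE //; apply: cl_base => //;
    rewrite inE; apply/orP; right; apply/imfsetP; [exists x|exists y] => //=;
    by rewrite !inE eqxx ?orbT.
- by rewrite (IHp env env').
- have [[lp vp sp] [lq vq sq]] := split_bin p q _ _ _ _ lL sV sim.
  by rewrite (IHp env env') ?(IHq env env').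
- have [[lp vp sp] [lq vq sq]] := split_bin p q _ _ _ _ lL sV sim.
  by rewrite (IHp env env') ?(IHq env env').
- have [[lp vp sp] [lq vq sq]] := split_bin p q _ _ _ _ lL sV sim.
  by rewrite (IHp env env') ?(IHq env env').
- have [[lp vp sp] [lq vq sq]] := split_bin p q _ _ _ _ lL sV sim.
  by rewrite (IHp env env') ?(IHq env env').
- have xV : x \in V by apply: sV; rewrite inE eqxx.
  have pV : {subset fo_vars p <= V} by move=> z zp; apply: sV; rewrite inE zp orbT.
  have fpV : {subset fo_free p <= V} by move=> z /free_vars/pV.
  have [forth back] := backforth _ _ _ _ _ _ _ gn gn' lL xV fpV sim.
  have lp : fo_level p <= Lam by have := slide_level_ge (slide_level (fo_level p) (fo_level p) + (fo_level p).+2 + fo_level p) (fo_level p); rewrite -/(ext_level _); lia.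
  apply/existsP/existsP => [[v sv]|[v' sv']].
    by have [v' sim'] := forth v; exists v'; rewrite -(IHp _ _ gn gn' lp pV sim').
  by have [v sim'] := back v'; exists v; rewrite (IHp _ _ gn gn' lp pV sim').
- have xV : x \in V by apply: sV; rewrite inE eqxx.
  have pV : {subset fo_vars p <= V} by move=> z zp; apply: sV; rewrite inE zp orbT.
  have fpV : {subset fo_free p <= V} by move=> z /free_vars/pV.
  have [forth back] := backforth _ _ _ _ _ _ _ gn gn' lL xV fpV sim.
  have lp : fo_level p <= Lam by have := slide_level_ge (slide_level (fo_level p) (fo_level p) + (fo_level p).+2 + fo_level p) (fo_level p); rewrite -/(ext_level _); lia.
  apply/forallP/forallP => H v.
    by have [v' sim'] := back v; rewrite -(IHp _ _ gn gn' lp pV sim').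
  by have [v' sim'] := forth v; rewrite (IHp _ _ gn gn' lp pV sim').
Qed.

(** The game starts from the identity on the closure of the core, which [same] makes common to both
    graphs. *)
Lemma good_sat phi n n' (env : nat -> 'I_n) (env' : nat -> 'I_n') :
  good E C gam Lam n -> good E C gam Lam n' -> fo_level phi <= Lam ->
  {subset fo_vars phi <= V} -> fo_sentence phi ->
  (forall x, cl E (fo_level phi) n C x <-> cl E (fo_level phi) n' C x) ->
  fo_sat (@ord_rel n) phi env = fo_sat (@ord_rel n') phi env'.
Proof.
move=> gn gn' lL sV sen same; apply: similar_sat => //; rewrite sen.
have [_ bC] := good_core gn; have [_ bC'] := good_core gn'.
exists id, id; split=> //.
have -> : [fset (env x : nat) | x in [::]] = fset0.
  by apply/fsetP => z; rewrite inE; apply/negbTE/imfsetP => -[].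
rewrite fsetU0; split; rewrite ?imfset_id //.
by split=> // x /same.
Qed.

End Logic.

(** * The infinite graph that contains the whole sequence *)

Section Graph.
Local Open Scope fset_scope.
Local Open Scope nat_scope.

Lemma rigid_bounded_fset (E : rel nat) : symmetric E ->
  (forall M L, exists b, forall X, rigid E (iset M) X -> #|` X `\` iset M| <= L -> below b X) ->
  forall (F : {fset nat}) L, exists b, forall X, rigid E F X -> #|` X `\` F| <= L -> below b X.
Proof.
move=> Esym H F L; have [b Hb] := H (\max_(x <- F) x).+1 L; exists b => X rX cX.
have FM : F `<=` iset (\max_(x <- F) x).+1.
  by apply: iset_sub => x xF; rewrite ltnS leq_bigmax_seq.
move=> x xX; apply: (Hb _ (rigid_mono Esym rX FM)); last by rewrite inE xX orbT.
by apply: leq_trans cX; apply: fsubset_leq_card; fset_tac.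
Qed.

Lemma fo_eventually_constant (E : rel nat) m (phi : fo) : symmetric E -> irreflexive E ->
  (forall M L, exists b, forall X, rigid E (iset M) X -> #|` X `\` iset M| <= L -> below b X) ->
  (forall v b, exists y, b <= y /\ E v y) ->
  (forall v, m <= v -> exists S : {fset nat}, [/\ #|` S| = m, below v S & forall y, y \in S -> E v y]) ->
  fo_sentence phi -> fo_nb_vars phi + 2 <= m ->
  exists n0, forall n n' (env : nat -> 'I_n) (env' : nat -> 'I_n'), n0 <= n -> n0 <= n' ->
    fo_sat (@ord_rel E n) phi env = fo_sat (@ord_rel E n') phi env'.
Proof.
move=> Esym Eirr /(rigid_bounded_fset Esym) rb inf low sen gm.
have [C [n1 Hgood]] := good_eventually Esym Eirr (fo_level phi) rb inf low gm.
have [n2 Hcl] := cl_eventually rb (fo_level phi) C.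
exists (maxn n1 n2) => n n' env env'; rewrite !geq_max => /andP[n1n n2n] /andP[n1n' n2n'].
apply: (good_sat Esym Eirr (V := fo_vars phi) (leqnn _) env env' (Hgood n n1n) (Hgood n' n1n')) => //.
by move=> x; split; apply: Hcl.
Qed.

(** The union of the sequence: a step adds no edge between old vertices, so every graph of the
    sequence is induced on an initial segment. *)
Definition nat_graph (m : nat) (N : forall n, {set 'I_n}) : rel nat := fun i j =>
  if i < j then (j < m) || [exists z : 'I_j, (val z == i) && (z \in N j)]
  else if j < i then (i < m) || [exists z : 'I_i, (val z == j) && (z \in N i)]
  else false.

Lemma nat_graph_sym m N : symmetric (nat_graph m N).
Proof. by move=> i j; rewrite /nat_graph; case: ltngtP. Qed.

Lemma nat_graph_irr m N : irreflexive (nat_graph m N).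
Proof. by move=> i; rewrite /nat_graph ltnn. Qed.

Lemma nat_graph_lt m (N : forall n, {set 'I_n}) j (z : 'I_j) : m <= j ->
  nat_graph m N z j = (z \in N j).
Proof.
move=> mj; rewrite /nat_graph ltn_ord ltnNge mj /=; apply/existsP/idP => [[y /andP[/eqP yz]]|zN].
  by rewrite (val_inj yz).
by exists z; rewrite eqxx.
Qed.

Lemma ua_graphE m (N : forall n, {set 'I_n}) k : @ua_graph m N k =2 @ord_rel (nat_graph m N) (k + m).
Proof.
elim: k => [|k IHk] i j; rewrite /ord_rel.
  rewrite /= /nat_graph; have [im jm] : i < m /\ j < m := conj (ltn_ord i) (ltn_ord j).
  by rewrite -val_eqE /=; case: ltngtP; rewrite /= ?im ?jm.
rewrite /= /add_vertex.
case: (unliftP ord_max i) => [i' ->|->]; case: (unliftP ord_max j) => [j' ->|->].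
- by rewrite IHk /ord_rel !lift_max.
- by rewrite lift_max /= nat_graph_lt // leq_addl.
- by rewrite lift_max nat_graph_sym /= nat_graph_lt // leq_addl.
- by rewrite nat_graph_irr.
Qed.

End Graph.

(** * Weights of rigid sets *)

Section Weights.
Local Open Scope fset_scope.
Local Open Scope nat_scope.

(* Abel summation, in multiplicative form: [theta] runs downwards from [t]. *)
Lemma weight_bound (p : pred nat) (d : nat -> nat) (t M : nat) : p t -> 0 < M ->
  (forall theta, M <= theta -> theta <= t ->
    \sum_(theta <= i < t.+1 | p i) 1 < \sum_(theta <= i < t.+1 | p i) d i) ->
  forall theta, M <= theta -> theta <= t ->
    t * (\prod_(theta <= i < t.+1 | p i) i) *
      theta ^ (\sum_(theta <= i < t.+1 | p i) d i - (\sum_(theta <= i < t.+1 | p i) 1).+1)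
    <= \prod_(theta <= i < t.+1 | p i) i ^ d i.
Proof.
move=> pt M0 H theta Mt tt; rewrite -(subKn tt).
move: (leq_subr theta t) Mt; rewrite -{2}(subKn tt); elim: (t - theta) => [|k IHk] kt Mk.
  have one (op : Monoid.law 0) F : \big[op/0]_(t <= i < t.+1 | p i) F i = F t.
    by rewrite big_mkcond big_nat1 pt.
  have one' (op : Monoid.law 1) F : \big[op/1]_(t <= i < t.+1 | p i) F i = F t.
    by rewrite big_mkcond big_nat1 pt.
  rewrite subn0 in Mk *; have := H t Mk (leqnn t); rewrite !one !one' => d1.
  rewrite -mulnA -!expnS; apply: leq_pexp2l; first exact: leq_trans Mk.
  by move: d1; lia.
have kt' := ltnW kt.
have Mk' : M <= t - k by move: Mk; lia.
have := IHk kt' Mk'; have Hk := H _ Mk' (leq_subr _ _); have Hk1 := H _ Mk (leq_subr _ _).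
have Ek : (t - k) = (t - k.+1).+1 by lia.
move: Hk Hk1; set a := t - k.+1 in Mk Ek *; rewrite Ek => Hk Hk1.
have at1 : a < t.+1 by rewrite /a; lia.
move: Hk1; rewrite !(big_ltn_cond at1) /=.
move: Hk; set D := \sum_(_ <= _ < _ | _) d _; set c := \sum_(_ <= _ < _ | _) 1.
set Pi := \prod_(_ <= _ < _ | _) _; set Pd := \prod_(_ <= _ < _ | _) _ ^ _ => cD.
(* The surplus power may have its base lowered from [a.+1] to [a]. A vertex at [a] then pays its own
   factor with one of its [d a] edges. *)
have le1 : a ^ (D - c.+1) <= a.+1 ^ (D - c.+1).
  by case: (D - c.+1) => // e; rewrite leq_exp2r.
have a0 : 0 < a by apply: leq_trans Mk.
case: (p a) => [cD'|_] IH; last first.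
  by apply: leq_trans IH; rewrite leq_mul2l le1 orbT.
apply: (@leq_trans (a ^ d a * (t * Pi * a ^ (D - c.+1)))); last first.
  by rewrite leq_mul2l; apply/orP; right; apply: leq_trans IH; rewrite leq_mul2l le1 orbT.
have -> : t * (a * Pi) * a ^ (d a + D - (1 + c).+1) = t * Pi * a ^ (d a + D - (1 + c).+1).+1.
  by rewrite expnS; ring.
have -> : a ^ d a * (t * Pi * a ^ (D - c.+1)) = t * Pi * a ^ (d a + (D - c.+1)).
  by rewrite expnD; ring.
by rewrite leq_mul2l leq_pexp2l ?orbT //; lia.
Qed.

(** Without denominators: [r] given vertices all belong to a random [m]-subset with probability at
    most [(m / n) ^ r]. *)
Lemma bin_bound n m r : r <= m -> m <= n -> 'C(n - r, m - r) * n ^ r <= 'C(n, m) * m ^ r.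
Proof.
elim: r => [|r IHr] rm mn; first by rewrite !subn0 !muln1.
have nr : 0 < n - r by lia.
have step : 'C(n - r.+1, m - r.+1) * n <= 'C(n - r, m - r) * m.
  have E : (n - r) * 'C(n - r.+1, m - r.+1) = (m - r) * 'C(n - r, m - r).
    by rewrite subnS mul_bin_diag subnSK.
  rewrite -(leq_pmul2l nr) mulnA E.
  have : (m - r) * n <= (n - r) * m by nia.
  by move=> le1; nia.
apply: (@leq_trans ('C(n - r, m - r) * m * n ^ r)).
  by rewrite expnS mulnA leq_mul2r step orbT.
rewrite -mulnA (mulnC m) mulnA expnS (mulnC m) mulnA leq_mul2r.
by rewrite IHr ?orbT // ltnW.
Qed.

Lemma card_superset (T : finType) (R : {set T}) m : #|R| <= m ->
  #|[set S : {set T} | R \subset S & #|S| == m]| <= 'C(#|T| - #|R|, m - #|R|).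
Proof.
move=> Rm; have cR : #|T| - #|R| = #|~: R| by rewrite -(cardsC R) addKn.
rewrite cR -cards_draws.
apply: leq_trans (leq_imset_card (fun S => S :|: R) _).
apply/subset_leq_card/fintype.subsetP => S; rewrite inE => /andP[RS /eqP Sm].
apply/imsetP; exists (S :\: R); last first.
  by apply/setP => x; rewrite !inE; have := fintype.subsetP RS x; case: (x \in R) => //=; [move->|rewrite orbF].
rewrite inE cardsD (finset.setIidPr RS) Sm eqxx andbT.
by apply/fintype.subsetP => x; rewrite !inE => /andP[].
Qed.

Variable E : rel nat.
Hypothesis Esym : symmetric E.
Hypothesis Eirr : irreflexive E.

Definition ldeg (X : {fset nat}) (x : nat) : nat := deg E x [fset y in X | y < x].

Lemma cross_ldeg (X : {fset nat}) : cross E X X = 2 * \sum_(x <- X) ldeg X x.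
Proof.
have degE x : deg E x X = \sum_(y <- X) ((y < x) && E x y) + \sum_(y <- X) ((x < y) && E x y).
  rewrite -big_split /deg; apply: eq_bigr => y _.
  by case: (ltngtP y x) => [_|_|->] /=; rewrite ?addn0 ?Eirr.
have ldegE x : ldeg X x = \sum_(y <- X) ((y < x) && E x y).
  rewrite /ldeg /deg -big_fset_condE big_mkcond; apply: eq_bigr => y _.
  by case: (y < x).
rewrite /cross (eq_bigr _ (fun x _ => degE x)) big_split /= mul2n -addnn.
rewrite (eq_bigr _ (fun x _ => ldegE x)); congr addn.
rewrite exchange_big /=; apply: eq_bigr => x _; apply: eq_bigr => y _.
by rewrite Esym.
Qed.

(** Rigidity is applied to the part of [X] below [theta], which keeps all its downward edges; the
    difference of [del] counts exactly the final segment. *)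
Lemma rigid_ldeg M X theta : rigid E (iset M) X -> M <= theta ->
  (exists2 x, x \in X & theta <= x) ->
  \sum_(x <- X | theta <= x) 1 < \sum_(x <- X | theta <= x) ldeg X x.
Proof.
move=> [MX rX] Mt [x xX tx]; pose Y := [fset y in X | y < theta].
have YX : Y `<` X.
  rewrite fproperE; apply/andP; split; first by apply/fsubsetP => y; rewrite !inE => /andP[].
  by apply/fsubsetPn; exists x => //; rewrite !inE xX -leqNgt.
have MY : iset M `<=` Y.
  apply/fsubsetP => y yM; rewrite !inE (fsubsetP MX) //=.
  by rewrite in_iset in yM; apply: leq_trans Mt.
have := rX Y MY YX; rewrite /del !cross_ldeg.
have ldY y : y \in Y -> ldeg Y y = ldeg X y.
  rewrite !inE => /andP[yX yt]; rewrite /ldeg; congr deg; apply/fsetP => z.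
  rewrite !inE; case: (ltnP z y) => zy; rewrite ?andbF // !andbT.
  by rewrite (ltn_trans zy yt) andbT.
have -> : \sum_(y <- Y) ldeg Y y = \sum_(y <- X | y < theta) ldeg X y.
  by rewrite [RHS]big_fset_condE big_seq [RHS]big_seq; apply: eq_bigr => y /ldY.
have -> : #|` Y| = \sum_(y <- X | y < theta) 1 by rewrite card_fset_sum1 [RHS]big_fset_condE.
rewrite card_fset_sum1 (bigID (fun y => y < theta) predT (ldeg X)) /=.
rewrite (bigID (fun y => y < theta) predT (fun=> 1)) /=.
have neg F : \sum_(x <- X | ~~ (x < theta)) F x = \sum_(x <- X | theta <= x) F x.
  by apply: eq_bigl => y; rewrite -leqNgt.
rewrite !neg; move: (\sum_(x <- X | theta <= x) 1) (\sum_(x <- X | theta <= x) ldeg X x).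
move: (\sum_(x <- X | x < theta) 1) (\sum_(x <- X | x < theta) ldeg X x); lia.
Qed.

End Weights.

(** * Finite records of rigid sets *)

Section Config.
Local Open Scope nat_scope.

Lemma del_ext (E E' : rel nat) (X : {fset nat}) :
  (forall x y, x \in X -> y \in X -> E x y = E' x y) -> del E X = del E' X.
Proof.
move=> EE; rewrite /del; congr (_%:Z - _)%R; rewrite /cross big_seq [RHS]big_seq.
apply: eq_bigr => x xX; rewrite /deg big_seq [RHS]big_seq.
by apply: eq_bigr => y yX; rewrite EE.
Qed.

Lemma rigid_ext (E E' : rel nat) (A X : {fset nat}) :
  (forall x y, x \in X -> y \in X -> E x y = E' x y) -> rigid E A X -> rigid E' A X.
Proof.
move=> EE [AX rX]; split=> // Y AY YX; have YX' := fproper_sub YX.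
rewrite -(del_ext EE) -(@del_ext E E' Y); first exact: rX.
by move=> x y /(fsubsetP YX') xX /(fsubsetP YX') yX; apply: EE.
Qed.

Lemma big_fset_nat (R : Type) (idx : R) (op : Monoid.com_law idx) (X : {fset nat}) b
    (p : pred nat) (F : nat -> R) : below b X ->
  \big[op/idx]_(x <- X | p x) F x = \big[op/idx]_(0 <= i < b | (i \in X) && p i) F i.
Proof.
move=> bX; rewrite -big_filter_cond; apply: perm_big; apply: uniq_perm.
- exact: fset_uniq.
- by rewrite filter_uniq // iota_uniq.
move=> x; rewrite mem_filter mem_index_iota; apply/idP/andP => [xX|[]//].
by split=> //; apply: bX.
Qed.

Lemma big_nat_from (R : Type) (idx : R) (op : Monoid.law idx) a b (p : pred nat) (F : nat -> R) :
  \big[op/idx]_(0 <= i < b | p i && (a <= i)) F i = \big[op/idx]_(a <= i < b | p i) F i.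
Proof. by rewrite [RHS](big_nat_widenl a 0). Qed.

Variables (M L t : nat).

(* A set rigid over [0, M) with largest element [t] is recorded by its elements
   [S] in [M, t) and its set [H] of edges, directed downwards. *)
Definition config_vertices (S : {set 'I_t}) : {set 'I_t.+1} :=
  [set inord (val i) | i : 'I_M] :|: [set ord_max] :|: [set widen_ord (leqnSn t) z | z in S].

Definition config_edge (H : {set 'I_t.+1 * 'I_t.+1}) (n z : nat) : bool :=
  (inord n, inord z) \in H.

Definition config_deg (H : {set 'I_t.+1 * 'I_t.+1}) (n : nat) : nat :=
  #|[set z : 'I_n | config_edge H n z]|.

(** In the last condition [t * \prod z] is the product of the vertices outside [[0, M)], and the
    other [t] is the surplus from [weight_bound]. The bound on the number of edges controls the
    power of [m] in the probability. *)
Definition config_ok (S : {set 'I_t}) (H : {set 'I_t.+1 * 'I_t.+1}) : bool :=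
  [&& #|S| <= L, [forall z in S, M <= z],
      H \subset finset.setX (config_vertices S) (config_vertices S),
      \sum_(M <= n < t.+1) config_deg H n <= (M + L).+1 ^ 2 &
      t * (t * \prod_(z in S) z) <= \prod_(M <= n < t.+1) n ^ config_deg H n].

Lemma card_config_vertices (S : {set 'I_t}) : #|S| <= L -> #|config_vertices S| <= (M + L).+1.
Proof.
move=> cS.
have cU (A B : {set 'I_t.+1}) : #|A :|: B| <= #|A| + #|B| by rewrite cardsU leq_subr.
have -> : (M + L).+1 = M + 1 + L by lia.
apply: leq_trans (cU _ _) _; apply: leq_add; last exact: leq_trans (leq_imset_card _ _) cS.
apply: leq_trans (cU _ _) _; rewrite cards1 leq_add2r.
by apply: leq_trans (leq_imset_card _ _) _; rewrite card_ord.
Qed.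

Lemma rigid_config (E : rel nat) (X : {fset nat}) : symmetric E -> irreflexive E ->
  0 < M -> M <= t -> rigid E (iset M) X -> #|` (X `\` iset M)%fset| <= L ->
  below t.+1 X -> t \in X ->
  exists S H, config_ok S H /\
    forall n (z : 'I_n), M <= n < t.+1 -> config_edge H n z -> E n z.
Proof.
move=> Esym Eirr M0 Mt rX cX bX tX.
pose S := [set z : 'I_t | (M <= z) && (val z \in X)].
pose H := [set p : 'I_t.+1 * 'I_t.+1 | [&& val p.1 \in X, val p.2 \in X, M <= p.1, p.2 < p.1 & E p.1 p.2]].
have edgeE n z : M <= n < t.+1 -> z < n ->
    config_edge H n z = [&& n \in X, z \in X & E n z].
  move=> /andP[Mn nt] zn; have zt := ltn_trans zn nt.
  by rewrite /config_edge inE /= !inordK // Mn zn.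
have degE n : M <= n < t.+1 -> config_deg H n = if n \in X then ldeg E X n else 0.
  move=> nt; rewrite /config_deg -sum1dep_card.
  have [nX|nX] := boolP (n \in X); last first.
    by rewrite big1 // => z; rewrite edgeE // (negbTE nX).
  rewrite /ldeg /deg -big_fset_condE (big_fset_nat _ _ _ bX) /=.
  rewrite -(big_mkord (fun z => config_edge H n z) (fun=> 1)).
  case/andP: (nt) => _ nt'.
  rewrite [RHS](big_cat_nat (n := n)) //=; last exact: ltnW.
  rewrite [X in _ = _ + X]big_nat_cond [X in _ = _ + X]big1 ?addn0; last first.
    by move=> i /andP[/andP[ni _] /andP[_ ilt]]; move: ilt; rewrite ltnNge ni.
  rewrite big_nat_cond [RHS]big_nat_cond big_mkcond [RHS]big_mkcond.
  apply: eq_bigr => i _; case: (ltnP i n) => ilt; rewrite /= ?andbF // andbT.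
  by rewrite edgeE // nX /=; case: (i \in X); case: (E n i).
have cXM : #|` X| <= M + L.
  have -> : M = #|` iset M| by rewrite /iset card_fseq undup_id ?iota_uniq ?size_iota.
  have XE : (X `<=` iset M `|` (X `\` iset M))%fset by fset_tac.
  apply: leq_trans (fsubset_leq_card XE) _.
  by rewrite cardfsU; apply: leq_trans (leq_subr _ _) _; rewrite leq_add2l.
exists S, H; split; last first.
  by move=> n z nt; rewrite edgeE // => /and3P[].
apply/and5P; split.
- apply: leq_trans cX; rewrite cardE -(size_map val).
  apply: uniq_leq_size; first by rewrite map_inj_uniq ?enum_uniq //; apply: val_inj.
  by move=> x /mapP[z]; rewrite mem_enum inE => /andP[Mz zX] ->; rewrite in_fsetD in_iset -leqNgt Mz.
- by apply/forallP => z; apply/implyP; rewrite inE => /andP[].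
- have inV (x : 'I_t.+1) : val x \in X -> x \in config_vertices S.
    move=> xX; rewrite !inE; have [xM|Mx] := ltnP x M.
      apply/orP; left; apply/orP; left; apply/imsetP; exists (Ordinal xM) => //.
      by apply/val_inj; rewrite /= inordK.
    have [xt|xt] := eqVneq (val x) t.
      by apply/orP; left; apply/orP; right; apply/eqP/val_inj.
    have xlt : x < t by rewrite ltn_neqAle xt -ltnS ltn_ord.
    apply/orP; right; apply/imsetP; exists (Ordinal xlt); first by rewrite inE Mx.
    exact/val_inj.
  by apply/fintype.subsetP => p; rewrite inE => /and3P[p1 p2 _]; rewrite inE !inV.
- have -> : (M + L).+1 ^ 2 = (M + L).+1 * (M + L).+1 by rewrite expnS expn1.
  apply: (@leq_trans (\sum_(M <= n < t.+1 | n \in X) #|` X|)).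
    rewrite [leqRHS]big_mkcond big_nat_cond [leqRHS]big_nat_cond.
    apply: leq_sum => n /andP[nt _]; rewrite degE //; case: ifP => // nX.
    apply: (@leq_trans (deg E n X)); first by apply: deg_subset; apply/fsubsetP => y; rewrite !inE => /andP[].
    by rewrite card_fset_sum1; apply: leq_sum => y _; apply: leq_b1.
  rewrite -big_nat_from -big_fset_nat // big_const_seq iter_addn_0.
  apply: leq_mul; first exact: leq_trans cXM (leqnSn _).
  by apply: leq_trans (count_size _ _) (leq_trans cXM (leqnSn _)).
have PS : \prod_(z in S) val z = \prod_(M <= i < t | i \in X) i.
  rewrite -big_nat_from big_mkord; apply: eq_bigl => z; rewrite inE andbC //.
have Pt : \prod_(M <= i < t.+1 | i \in X) i = t * \prod_(z in S) z.
  by rewrite PS big_mkcond big_nat_recr //= -big_mkcond /= tX mulnC.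
have suffix_lt theta : M <= theta -> theta <= t ->
    \sum_(theta <= i < t.+1 | i \in X) 1 < \sum_(theta <= i < t.+1 | i \in X) ldeg E X i.
  move=> Mth tht; have := rigid_ldeg Esym Eirr rX Mth (ex_intro2 _ _ t tX tht).
  by rewrite !(big_fset_nat _ _ _ bX) !big_nat_from.
have := weight_bound tX M0 suffix_lt (leqnn M) Mt; rewrite Pt => le1.
apply: (@leq_trans (\prod_(M <= i < t.+1 | i \in X) i ^ ldeg E X i)).
  by apply: leq_trans le1; rewrite leq_pmulr // expn_gt0 M0.
rewrite big_mkcond [leqRHS]big_nat_cond big_nat_cond.
by apply: leq_prod => n /andP[nt _]; rewrite degE //; case: ifP.
Qed.

End Config.

Local Open Scope classical_set_scope.
Local Open Scope ring_scope.

(** * Almost sure properties *)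

Section Probability.
Variables (R : realType) (d : measure_display) (Omega : measurableType d)
  (P : probability Omega R).

Lemma measure_preimage_seq (T : choiceType) (X : Omega -> T) (s : seq T) :
  (forall t, t \in s -> measurable (X @^-1` [set t])) -> uniq s ->
  P (X @^-1` [set` s]) = (\sum_(t <- s) P (X @^-1` [set t]))%E.
Proof.
elim: s => [|t s IHs] mX /=.
  by rewrite big_nil (_ : _ @^-1` _ = set0) ?measure0 // -subset0 => w.
move=> /andP[ts us]; rewrite big_cons -IHs //; last by move=> u us'; apply: mX; rewrite inE us' orbT.
have -> : X @^-1` [set` t :: s] = X @^-1` [set t] `|` X @^-1` [set` s].
  apply/seteqP; split=> w /=; rewrite inE.
    by case/orP => [/eqP|]; [left|right].
  by case=> [->|->]; rewrite ?eqxx ?orbT.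
rewrite measureU //.
- by apply: mX; rewrite mem_head.
- rewrite (_ : X @^-1` [set` s] = \big[setU/set0]_(u <- s) (X @^-1` [set u])).
    rewrite big_seq; apply: bigsetU_measurable => u us'; apply: mX.
    by rewrite inE us' orbT.
  rewrite -bigcup_seq; apply/seteqP; split=> w /=; first by move=> ws; exists (X w).
  by move=> [u us' /= ->].
- by rewrite -subset0 => w /= [Xt ws]; rewrite -Xt ws in ts.
Qed.

Lemma measure_union_bound (I : choiceType) (s : seq I) (A : I -> set Omega) (B : set Omega) :
  (forall i, measurable (A i)) -> measurable B ->
  (forall w, B w -> exists2 i, i \in s & A i w) ->
  (P B <= \sum_(i <- s) P (A i))%E.
Proof.
move=> mA mB BA; apply: (@le_trans _ _ (P (\big[setU/set0]_(i <- s) A i))).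
  apply: le_measure; rewrite ?inE //; first exact: bigsetU_measurable.
  by move=> w /BA[i si Aw]; rewrite -bigcup_seq; exists i.
elim: s {BA} => [|i s IHs]; first by rewrite !big_nil measure0.
rewrite !big_cons; apply: le_trans (measureU2 _ _ _) _ => //.
  exact: bigsetU_measurable.
exact: leeD.
Qed.

Variables (m : nat) (N : forall n, Omega -> {set 'I_n}).
Hypotheses (m0 : (0 < m)%N) (UA : uniform_attachment P m N).

Lemma measure_attach_sum n (b : pred {set 'I_n}) : (m <= n)%N ->
  P (@N n @^-1` [set S | b S]) = (\sum_(S | b S) P (@N n @^-1` [set S]))%E.
Proof.
move=> mn; rewrite -big_filter -measure_preimage_seq ?filter_uniq ?index_enum_uniq //.
  by congr (P _); apply/seteqP; split=> w /=; rewrite mem_filter mem_index_enum ?andbT.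
by move=> t _; apply: (ua_measurable UA).
Qed.

Lemma bin_neq0 n : (m <= n)%N -> ('C(n, m)%:R : R) != 0.
Proof. by move=> mn; rewrite pnatr_eq0 -lt0n bin_gt0. Qed.

(** The masses given by [ua_uniform] already sum to 1, which forces mass 0 on sets of any other
    size. *)
Lemma measure_attach_card n : (m <= n)%N -> P (@N n @^-1` [set S : {set 'I_n} | #|S| == m]) = 1%E.
Proof.
move=> mn; rewrite measure_attach_sum //.
rewrite (eq_bigr (fun=> (('C(n, m)%:R : R)^-1)%:E)); last first.
  by move=> S /eqP cS; apply: (ua_uniform UA).
have := card_draws 'I_n m; rewrite card_ord cardsE => cE.
rewrite sumEFin sumr_const; transitivity ((('C(n, m)%:R : R)^-1 *+ 'C(n, m))%:E).
  by congr (_ *+ _)%:E; exact: cE.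
by rewrite -[_ *+ _]mulr_natl mulfV ?bin_neq0.
Qed.

Lemma measure_attach_other n (S : {set 'I_n}) : (m <= n)%N -> #|S| != m -> P (@N n @^-1` [set S]) = 0%E.
Proof.
move=> mn cS; apply/eqP; rewrite eq_le measure_ge0 andbT.
have mA (B : set {set 'I_n}) : measurable (@N n @^-1` B) by apply: (ua_measurable UA).
have := probability_setC P (mA [set S : {set 'I_n} | #|S| == m]); rewrite measure_attach_card // subee // => <-.
apply: le_measure; rewrite ?inE //; first exact: measurableC.
by move=> w /= ->; apply/negP.
Qed.

Lemma measure_attach n (b : pred {set 'I_n}) : (m <= n)%N ->
  P (@N n @^-1` [set S | b S]) = (#|[set S : {set 'I_n} | b S && (#|S| == m)]%SET|%:R / 'C(n, m)%:R)%:E.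
Proof.
move=> mn; rewrite measure_attach_sum // (bigID (fun S : {set 'I_n} => #|S| == m)) /=.
rewrite [X in (_ + X)%E]big1 ?adde0; last by move=> S /andP[_]; apply: measure_attach_other.
rewrite (eq_bigr (fun=> (('C(n, m)%:R : R)^-1)%:E)); last first.
  by move=> S /andP[_ /eqP cS]; apply: (ua_uniform UA).
by rewrite sumEFin sumr_const -cardsE mulr_natl.
Qed.

Lemma measure_attach_superset n (T : {set 'I_n}) : (m <= n)%N ->
  (P (@N n @^-1` [set S : {set 'I_n} | T \subset S]) <= ((m%:R / n%:R) ^+ #|T|)%:E)%E.
Proof.
move=> mn; rewrite measure_attach // lee_fin.
have n0 : (0 < n%:R :> R) by rewrite ltr0n (leq_trans m0).
have c0 : (0 < 'C(n, m)%:R :> R) by rewrite ltr0n bin_gt0.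
rewrite expr_div_n ler_pdivrMr // mulrAC ler_pdivlMr ?exprn_gt0 //.
rewrite -!natrX -!natrM ler_nat.
have [Tm|mT] := leqP #|T| m.
  have := card_superset Tm; rewrite card_ord => cS.
  apply: leq_trans (_ : _ <= 'C(n - #|T|, m - #|T|) * n ^ #|T|)%N _; first by rewrite leq_mul2r cS orbT.
  by rewrite [leqRHS]mulnC bin_bound.
rewrite (_ : [set S | _]%SET = finset.set0) ?cards0 ?mul0n //.
apply/setP => S; rewrite !inE; apply/negP => /andP[/subset_leq_card TS /eqP Sm].
by rewrite Sm leqNgt mT in TS.
Qed.

(** The exact value is [1 - m / n]. The weaker bound is enough, as the harmonic series diverges. *)
Lemma measure_attach_notin n (v : 'I_n) : (m <= n)%N ->
  (P (@N n @^-1` [set S : {set 'I_n} | v \notin S]) <= (1 - n%:R^-1)%:E)%E.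
Proof.
move=> mn; rewrite measure_attach // lee_fin.
have n0 : (0 < n%:R :> R) by rewrite ltr0n (leq_trans m0).
have c0 : (0 < 'C(n, m)%:R :> R) by rewrite ltr0n bin_gt0.
have -> : #|[set S : {set 'I_n} | v \notin S & #|S| == m]%SET| = 'C(n.-1, m).
  have <- : #|~: [set v]%SET| = n.-1 by rewrite cardsC1 card_ord.
  rewrite -cards_draws; apply: eq_card => S; rewrite !inE; congr andb.
  by rewrite finset.subsetC finset.sub1set inE.
have E : n%:R * 'C(n.-1, m)%:R = (n%:R - m%:R) * 'C(n, m)%:R :> R.
  by rewrite -natrB // -!natrM mul_bin_down.
rewrite ler_pdivrMr // -(ler_pM2l n0) E mulrA mulrBr mulr1 mulfV ?gt_eqF //.
by apply: ler_wpM2r; [exact: ltW|rewrite lerD2l lerN2 ler1n].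
Qed.

Lemma measure_attach_prod a b (B : forall n, set {set 'I_n}) (g : nat -> R) :
  (m <= a)%N ->
  (forall n, (a <= n < b)%N -> (P (@N n @^-1` B n) <= (g n)%:E)%E) ->
  measurable [set w | forall n, (a <= n < b)%N -> B n (N n w)] /\
  (P [set w | forall n, (a <= n < b)%N -> B n (N n w)] <= (\prod_(a <= n < b) g n)%:E)%E.
Proof.
move=> ma leB.
have -> : [set w | forall n, (a <= n < b)%N -> B n (N n w)] =
    \bigcap_(n in [set` index_iota a b]) (@N n @^-1` B n).
  apply/seteqP; split=> w /= H n nab; apply: H.
    by move: nab; rewrite /= mem_index_iota.
  by rewrite /= mem_index_iota.
have mJ : all (leq m) (index_iota a b).
  by apply/allP => n; rewrite mem_index_iota => /andP[an _]; exact: leq_trans an.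
split.
  rewrite bigcap_seq big_seq; apply: bigsetI_measurable => n nab.
  by apply: (ua_measurable UA); exact: (allP mJ).
rewrite (ua_independent UA) ?iota_uniq //.
have : forall n, n \in index_iota a b -> (P (@N n @^-1` B n) <= (g n)%:E)%E.
  by move=> n; rewrite mem_index_iota; exact: leB.
elim: (index_iota a b) => [|n s IHs] le; first by rewrite !big_nil.
rewrite !big_cons EFinM; apply: lee_pmul => //.
- by elim: (s) => [|k r IHr]; rewrite ?big_nil // big_cons mule_ge0.
- by apply: le; rewrite mem_head.
- by apply: IHs => k ks; apply: le; rewrite inE ks orbT.
Qed.

Lemma measurable_finite_preimage (T : finType) (X : Omega -> {set T}) (B : set {set T}) :
  (forall t, measurable [set w | t \in X w]) -> measurable (X @^-1` B).
Proof.
move=> mX; have -> : X @^-1` B = \bigcup_(t in B) (X @^-1` [set t]).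
  by apply/seteqP; split=> w /=; [move=> Bw; exists (X w)|move=> [t Bt /= ->]].
apply: fin_bigcup_measurable => // H _.
have -> : X @^-1` [set H] = \bigcap_(t in [set: T]) (if t \in H then [set w | t \in X w] else ~` [set w | t \in X w]).
  apply/seteqP; split=> w /=; first by move=> <- t _ /=; case: ifP => //= ->.
  move=> Hw; apply/setP => t; have := Hw t I; case: ifPn => /=; first by move=> _ ->.
  by move=> _ /negP/negbTE ->.
apply: fin_bigcap_measurable => // t _; case: ifP => _; first exact: mX.
exact: measurableC.
Qed.

Local Notation graph := (fun w => nat_graph m (fun n => N n w)).

Lemma measurable_edge i j : measurable [set w | graph w i j].
Proof.
have lt_edge i' j' : (i' < j')%N -> measurable [set w | graph w i' j'].
  move=> ij; have [jm|mj] := ltnP j' m.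
    rewrite (_ : [set w | _] = setT) //; apply/seteqP; split=> w //= _.
    by rewrite /nat_graph ij jm.
  have -> : [set w | graph w i' j'] = @N j' @^-1` [set S : {set 'I_j'} | Ordinal ij \in S].
    by apply/seteqP; split=> w /=; rewrite -[i']/(val (Ordinal ij)) nat_graph_lt.
  exact: (ua_measurable UA).
have [ij|ji|->] := ltngtP i j; first exact: lt_edge.
  rewrite (_ : [set w | _] = [set w | graph w j i]); first exact: lt_edge.
  by apply/seteqP; split=> w /=; rewrite nat_graph_sym.
by rewrite (_ : [set w | _] = set0) // -subset0 => w /=; rewrite nat_graph_irr.
Qed.

(** An event that depends only on the first [T] vertices is a preimage under a map to a finite type,
    whatever quantifiers [Phi] contains. *)
Lemma measurable_graph T (Phi : rel nat -> Prop) :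
  (forall E E' : rel nat, (forall i j, (i < T)%N -> (j < T)%N -> E i j = E' i j) ->
    Phi E -> Phi E') ->
  measurable [set w | Phi (graph w)].
Proof.
move=> ext; pose X w := [set p : 'I_T * 'I_T | graph w p.1 p.2]%SET.
have -> : [set w | Phi (graph w)] = X @^-1` [set H | exists2 w', X w' = H & Phi (graph w')].
  apply/seteqP; split=> w /=; first by exists w.
  move=> [w' XX]; apply: ext => i j iT jT.
  by have /setP/(_ (Ordinal iT, Ordinal jT)) := XX; rewrite !inE.
apply: measurable_finite_preimage => -[i j].
rewrite (_ : [set w | _] = [set w | graph w i j]); first exact: measurable_edge.
by apply/seteqP; split=> w /=; rewrite inE.
Qed.

(** * Borel-Cantelli for rigid sets *)

Section BadEvent.
Variables (M L : nat).
Hypotheses (mM : (m <= M)%N).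
Let K := ((M + L).+1 ^ 2)%N.
Let M0 : (0 < M)%N := leq_trans m0 mM.

Definition dense_at (t : nat) (w : Omega) : Prop :=
  exists X : {fset nat}, [/\ rigid (graph w) (iset M) X,
    (#|` (X `\` iset M)%fset| <= L)%N, below t.+1 X & t \in X].

Lemma measurable_dense_at t : measurable [set w | dense_at t w].
Proof.
apply: (@measurable_graph t.+1 (fun E => exists X : {fset nat}, [/\ rigid E (iset M) X,
  (#|` (X `\` iset M)%fset| <= L)%N, below t.+1 X & t \in X])).
move=> E E' EE [X [rX cX bX tX]]; exists X; split=> //.
by apply: rigid_ext rX => x y /bX xt /bX yt; apply: EE.
Qed.

Definition config_event t (H : {set 'I_t.+1 * 'I_t.+1}) : set Omega :=
  [set w | forall n, (M <= n < t.+1)%N -> [set z : 'I_n | config_edge H n z]%SET \subset N n w].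

Lemma config_event_prod t (H : {set 'I_t.+1 * 'I_t.+1}) :
  measurable (config_event H) /\
  (P (config_event H) <= (\prod_(M <= n < t.+1) (m%:R / n%:R) ^+ config_deg H n)%:E)%E.
Proof.
have := @measure_attach_prod M t.+1
  (fun n => [set S : {set 'I_n} | [set z : 'I_n | config_edge H n z]%SET \subset S])
  (fun n => (m%:R / n%:R) ^+ config_deg H n) mM.
apply=> n /andP[Mn _]; apply: measure_attach_superset; exact: leq_trans Mn.
Qed.

Lemma config_event_le t (S : {set 'I_t}) (H : {set 'I_t.+1 * 'I_t.+1}) : (M <= t)%N ->
  config_ok M L S H ->
  (P (config_event H) <= (m%:R ^+ K / t%:R ^+ 2 * \prod_(z in S) (val z)%:R^-1)%:E)%E.
Proof.
move=> Mt /and5P[cS /forallP SM HS degK weight].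
have [_ /le_trans] := config_event_prod H; apply; rewrite lee_fin.
rewrite (eq_bigr _ (fun n _ => expr_div_n _ _ _)) big_split /= prodfV.
rewrite prodrXr -mulrA; apply: ler_pM.
- exact: exprn_ge0.
- by rewrite invr_ge0 prodr_ge0.
- by apply: ler_weXn2l => //; rewrite ler1n.
rewrite prodfV -invfM lef_pV2; first last.
- rewrite posrE mulr_gt0 ?exprn_gt0 ?ltr0n ?(leq_trans M0) //.
  apply: prodr_gt0 => z zS; rewrite ltr0n; apply: leq_trans M0 _.
  by have := SM z; rewrite zS.
- rewrite posrE; rewrite big_nat_cond; apply: prodr_gt0 => n /andP[/andP[Mn _] _].
  by rewrite exprn_gt0 // ltr0n (leq_trans M0).
rewrite -natr_prod expr2 -!natrM.
under [leRHS]eq_bigr do rewrite -natrX.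
by rewrite -natr_prod ler_nat -mulnA.
Qed.

(* The factor [1/2] keeps the growth of this product strictly below linear, at
   the price of [2 ^ L] for sets of at most [L] elements. *)
Definition pi_weight (t : nat) : R :=
  \prod_(i < t) (1 + (if (M <= i)%N then (2 * i%:R)^-1 else 0)).

Lemma dense_at_le t : (M <= t)%N ->
  (P [set w | dense_at t w] <= (2 ^+ K * 2 ^+ L * m%:R ^+ K * (pi_weight t / t%:R ^+ 2))%:E)%E.
Proof.
move=> Mt; pose a (i : 'I_t) : R := if (M <= i)%N then (2 * i%:R)^-1 else 0.
have a0 i : 0 <= a i by rewrite /a; case: ifP => // _; rewrite invr_ge0 mulr_ge0.
pose s := [seq p <- index_enum (({set 'I_t} * {set 'I_t.+1 * 'I_t.+1})%type : finType) | config_ok M L p.1 p.2].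
apply: (@le_trans _ _ (\sum_(p <- s) P (config_event p.2))%E).
  apply: measure_union_bound.
  - by move=> p; have [] := config_event_prod p.2.
  - exact: measurable_dense_at.
  move=> w [X [rX cX bX tX]].
  have [S [H [ok edge]]] := rigid_config (@nat_graph_sym _ _) (@nat_graph_irr _ _) M0 Mt rX cX bX tX.
  exists (S, H); first by rewrite mem_filter ok mem_index_enum.
  move=> n nt; apply/fintype.subsetP => z; rewrite inE => /(edge _ _ nt).
  by rewrite nat_graph_sym nat_graph_lt //; case/andP: nt => Mn _; apply: leq_trans Mn.
apply: (@le_trans _ _ (\sum_(p <- s) (m%:R ^+ K / t%:R ^+ 2 * \prod_(z in p.1) (val z)%:R^-1)%:E)%E).
  rewrite big_seq [leRHS]big_seq; apply: lee_sum => p; rewrite mem_filter => /andP[ok _].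
  exact: config_event_le ok.
rewrite sumEFin lee_fin big_filter.
pose C0 : R := 2 ^+ L * m%:R ^+ K / t%:R ^+ 2.
have C00 : 0 <= C0 by rewrite /C0 !mulr_ge0 ?invr_ge0 ?exprn_ge0.
pose good (S : {set 'I_t}) (H : {set 'I_t.+1 * 'I_t.+1}) := (#|S| <= L)%N &&
  (H \in powerset (finset.setX (config_vertices M S) (config_vertices M S))).
apply: (@le_trans _ _ (\sum_(p | good p.1 p.2) (C0 * \prod_(z in p.1) a z))).
  rewrite big_mkcond [leRHS]big_mkcond; apply: ler_sum => p _.
  have [ok|_] := boolP (config_ok M L p.1 p.2); last first.
    by case: ifP => // _; rewrite mulr_ge0 // prodr_ge0.
  have [cS /forallP SM HS _ _] := and5P ok.
  rewrite /good cS inE HS /= /C0.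
  have aE z : z \in p.1 -> (val z)%:R^-1 = 2 * a z.
    by move=> zS; rewrite /a; have := SM z; rewrite zS /= => ->; rewrite invfM mulrA mulfV ?mul1r ?pnatr_eq0.
  rewrite (eq_bigr _ aE) big_split /= prodr_const.
  have -> : 2 ^+ L * m%:R ^+ K / t%:R ^+ 2 * \prod_(z in p.1) a z =
      m%:R ^+ K / t%:R ^+ 2 * (2 ^+ L * \prod_(z in p.1) a z) by ring.
  apply: ler_wpM2l; first by rewrite mulr_ge0 ?invr_ge0 ?exprn_ge0.
  apply: ler_wpM2r; first exact: prodr_ge0.
  by apply: ler_weXn2l => //; rewrite ler1n.
rewrite -(pair_big_dep (fun S : {set 'I_t} => #|S| <= L)%N
  (fun S H => H \in powerset (finset.setX (config_vertices M S) (config_vertices M S)))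
  (fun S H => C0 * \prod_(z in S) a z)) /=.
apply: (@le_trans _ _ (\sum_(S : {set 'I_t}) (2 ^+ K * C0 * \prod_(z in S) a z))).
  rewrite big_mkcond; apply: ler_sum => S _; case: ifP => [cS|_]; last first.
    by rewrite !mulr_ge0 ?exprn_ge0 // prodr_ge0.
  (* At most [2 ^ K] edge sets belong to one [S], since [config_vertices] has at most [M + L + 1]
     elements. *)
  rewrite sumr_const card_powerset cardsX -[_ *+ _]mulr_natl -mulrA.
  apply: ler_wpM2r; first by rewrite mulr_ge0 // prodr_ge0.
  rewrite natrX; apply: ler_weXn2l; first by rewrite ler1n.
  by rewrite /K expnS expn1 leq_mul // card_config_vertices.
(* With the size of [S] no longer restricted, the sum is the expansion of a product. *)
rewrite -mulr_sumr /pi_weight.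
rewrite (eq_bigr (fun i => a i + 1)); last by move=> i _; rewrite addrC.
rewrite (bigA_distr 1 +%R a (fun=> 1)) /=.
have -> : \sum_(J in {set 'I_t}) \prod_(i < t) (if i \in J then a i else 1) =
    \sum_(S : {set 'I_t}) \prod_(z in S) a z.
  by apply: eq_bigr => S _; rewrite [RHS]big_mkcond.
rewrite /C0 le_eqVlt; apply/orP; left; apply/eqP; ring.
Qed.

Lemma pi_weight_ge0 t : 0 <= pi_weight t.
Proof.
by apply: prodr_ge0 => i _; apply: addr_ge0 => //; case: ifP.
Qed.

(* [pi_weight t / t] decreases fast enough to dominate the series. *)
Lemma pi_weight_step t : (M <= t)%N ->
  pi_weight t / t%:R ^+ 2 <= 4 * (pi_weight t / t%:R - pi_weight t.+1 / t.+1%:R).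
Proof.
move=> Mt; have t1 : 1 <= t%:R :> R by rewrite ler1n (leq_trans M0).
have -> : pi_weight t.+1 = pi_weight t * (1 + (2 * t%:R)^-1).
  by rewrite /pi_weight big_ord_recr /= Mt.
have p0 := pi_weight_ge0 t; rewrite -[t.+1%:R]natr1; set x := t%:R in t1 *; set p := pi_weight t in p0 *.
have x0 : 0 < x by apply: lt_le_trans t1.
have -> : 4 * (p / x - p * (1 + (2 * x)^-1) / (x + 1)) = p * (2 / (x * (x + 1))).
  by field; rewrite !gt_eqF //= addr_gt0.
apply: ler_wpM2l => //; rewrite -[leLHS]mul1r ler_pdivrMr ?exprn_gt0 //.
rewrite mulrAC ler_pdivlMr ?mulr_gt0 ?addr_gt0 // mul1r expr2.
by nra.
Qed.

Definition late_dense (t : nat) : set Omega := [set w | (M <= t)%N /\ dense_at t w].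

Lemma late_denseE t :
  late_dense t = if (M <= t)%N then [set w | dense_at t w] else set0.
Proof.
by rewrite /late_dense; case: ifP => Mt; apply/seteqP; split=> w //= [].
Qed.

Lemma measurable_late_dense t : measurable (late_dense t).
Proof. by rewrite late_denseE; case: ifP => // _; exact: measurable_dense_at. Qed.

(** The partial sums telescope by [pi_weight_step]; the maximum with [M] accounts for the empty
    events before [M]. *)
Lemma dense_at_limsup : P (lim_sup_set late_dense) = 0%E.
Proof.
apply: lim_sup_set_cvg0; first exact: measurable_late_dense.
pose C : R := 2 ^+ K * 2 ^+ L * m%:R ^+ K.
have C0 : 0 <= C by rewrite /C !mulr_ge0 ?exprn_ge0.
apply: (@le_lt_trans _ _ (C * (4 * (pi_weight M / M%:R)))%:E); last exact: ltry.
apply: lime_le; first exact: is_cvg_nneseries.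
apply: nearW => n.
pose v t := pi_weight t / t%:R.
have v0 t : 0 <= v t by rewrite /v mulr_ge0 ?invr_ge0 // pi_weight_ge0.
have main k : (\sum_(0 <= t < k) P (late_dense t) <= (C * (4 * (v M - v (maxn M k))))%:E)%E.
  elim: k => [|k IHk]; first by rewrite big_geq // maxn0 subrr !mulr0.
  rewrite big_nat_recr //=; have [Mk|kM] := leqP M k; last first.
    rewrite late_denseE leqNgt kM /= measure0 adde0; apply: le_trans IHk _.
    by rewrite (maxn_idPl kM) (maxn_idPl (ltnW kM)).
  apply: (@le_trans _ _ ((C * (4 * (v M - v k)))%:E + (C * (4 * (v k - v k.+1)))%:E)%E).
    apply: leeD; first by rewrite (maxn_idPr Mk) in IHk.
    rewrite late_denseE Mk; apply: le_trans (dense_at_le Mk) _; rewrite lee_fin.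
    by apply: ler_wpM2l => //; apply: pi_weight_step.
  rewrite -EFinD lee_fin (maxn_idPr (leqW Mk)) -!mulrDr.
  by rewrite addrA subrK.
apply: le_trans (main n) _; rewrite lee_fin; apply: ler_wpM2l => //.
by apply: ler_wpM2l => //; rewrite lerBlDr lerDl.
Qed.

(** If no bound exists, rigid sets have arbitrarily large maxima, so [dense_at] holds at infinitely
    many [t]. *)
Lemma ae_dense_bounded : {ae P, forall w, exists b, forall X : {fset nat},
  rigid (graph w) (iset M) X -> (#|` (X `\` iset M)%fset| <= L)%N -> below b X}.
Proof.
exists (lim_sup_set late_dense); split; last 1 first.
- move=> w /= nb k _; apply: contrapT => none; apply: nb; exists (maxn k M) => X rX cX x xX.
  rewrite ltnNge; apply/negP; rewrite geq_max => /andP[kx Mx]; apply: none.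
  have [t _ tmax] := @arg_maxnP X [` xX]%fset xpredT (fun y => val y) isT.
  have Xt y : y \in X -> (y <= val t)%N by move=> yX; apply: (tmax [` yX]%fset).
  exists (val t); first exact: leq_trans (Xt x xX).
  split; first exact: leq_trans (Xt x xX).
  by exists X; split=> //; exact: valP.
- apply: bigcap_measurable => // k _; apply: bigcup_measurable => t _.
  exact: measurable_late_dense.
- exact: dense_at_limsup.
Qed.

End BadEvent.

(** * Degrees in the random graph, and almost sure constancy of truth values *)

Lemma ae_attach_card n : (m <= n)%N -> {ae P, forall w, #|N n w| = m}.
Proof.
move=> mn; exists (@N n @^-1` [set S : {set 'I_n} | #|S| != m]); split.
- exact: (ua_measurable UA).
- rewrite measure_attach // (_ : [set S | _]%SET = finset.set0) ?cards0 ?mul0r //.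
  by apply/setP => S; rewrite !inE andNb.
- by move=> w /= /eqP.
Qed.

(** The probability that [v] is missed by the [k] vertices from [a] on is at most a telescoping
    product, bounded by [a / (a + k)]. *)
Lemma ae_attached v a : (m <= a)%N -> (v < a)%N ->
  {ae P, forall w, exists2 n, (a <= n)%N & graph w v n}.
Proof.
move=> ma va.
pose B n : set {set 'I_n} := [set S : {set 'I_n} | forall z : 'I_n, val z = v -> z \notin S].
have a0 : (0 < a)%N := leq_trans m0 ma.
have vle n : (a <= n)%N -> (P (@N n @^-1` B n) <= (1 - n%:R^-1)%:E)%E.
  move=> an; have vn : (v < n)%N := leq_trans va an.
  have -> : B n = [set S : {set 'I_n} | Ordinal vn \notin S].
    apply/seteqP; split=> S /= H; first exact: H.
    by move=> z zv; rewrite (_ : z = Ordinal vn) //; apply/val_inj.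
  exact: measure_attach_notin (leq_trans ma an).
pose A b := [set w | forall n, (a <= n < b)%N -> B n (N n w)].
have HA b : measurable (A b) /\ (P (A b) <= (\prod_(a <= n < b) (1 - n%:R^-1))%:E)%E.
  by apply: measure_attach_prod => // n /andP[an _]; exact: vle.
have prod_le k : \prod_(a <= n < a + k) (1 - n%:R^-1) <= a%:R / (a + k)%:R :> R.
  elim: k => [|k IHk]; first by rewrite addn0 big_geq // divff // pnatr_eq0 -lt0n.
  rewrite addnS big_nat_recr ?leq_addr //=.
  have x1 : 1 <= (a + k)%:R :> R by rewrite ler1n addn_gt0 a0.
  rewrite -[(a + k).+1%:R]natr1; set x := (a + k)%:R in x1 IHk *; clearbody x.
  have x0 : 0 < x by apply: lt_le_trans x1.
  apply: (@le_trans _ _ (a%:R / x * (1 - x^-1))).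
    by apply: ler_wpM2r IHk; rewrite subr_ge0 invf_le1.
  rewrite -mulrA; apply: ler_wpM2l => //.
  rewrite ler_pdivrMl // ler_pdivlMr ?addr_gt0 //.
  have -> : (1 - x^-1) * (x + 1) = x - x^-1 by field; rewrite gt_eqF.
  by rewrite gerBl invr_ge0 ltW.
have P0 : P (\bigcap_b A b) = 0%E.
  have mA : measurable (\bigcap_b A b).
    by apply: bigcap_measurable => // b _; have [] := HA b.
  have Ple k : (P (\bigcap_b A b) <= (a%:R / (a + k)%:R)%:E)%E.
    apply: (@le_trans _ _ (P (A (a + k)%N))).
      by apply: le_measure; rewrite ?inE //; [have [] := HA (a + k)%N|exact: bigcap_inf].
    by have [_ /le_trans] := HA (a + k)%N; apply; rewrite lee_fin.
  have [p pE] : exists p : R, P (\bigcap_b A b) = p%:E.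
    by exists (fine (P (\bigcap_b A b))); rewrite fineK // fin_num_measure.
  have p0 : 0 <= p by rewrite -lee_fin -pE.
  rewrite pE in Ple *.
  congr _%:E; apply/eqP; rewrite eq_le p0 andbT leNgt; apply/negP => pp.
  pose k := Num.bound (a%:R / p); have kP : a%:R / p < k%:R.
    by apply: archi_boundP; rewrite divr_ge0.
  have := Ple k; rewrite lee_fin ler_pdivlMr ?ltr0n ?addn_gt0 ?a0 //.
  apply/negP; rewrite -ltNge natrD mulrDr; rewrite ltr_pdivrMr // in kP.
  by apply: lt_le_trans kP _; rewrite mulrC lerDr mulr_ge0.
exists (\bigcap_b A b); split=> //.
  by apply: bigcap_measurable => // b _; have [] := HA b.
move=> w /= none b _ n /andP[an _] z zv; apply/negP => zN; apply: none.
exists n => //; have mn := leq_trans ma an.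
by rewrite -zv nat_graph_lt.
Qed.

Lemma ae_eventually_constant (phi : fo) : fo_sentence phi -> (fo_nb_vars phi + 2 <= m)%N ->
  {ae P, forall w, exists n0, forall n n' (env : nat -> 'I_n) (env' : nat -> 'I_n'),
    (n0 <= n)%N -> (n0 <= n')%N ->
    fo_sat (@ord_rel (graph w) n) phi env = fo_sat (@ord_rel (graph w) n') phi env'}.
Proof.
move=> sen vm.
have ae1 : {ae P, forall w, forall n, (m <= n)%N -> #|N n w| = m}.
  apply: ae_foralln => n; have [mn|nm] := leqP m n; last exact: aeW.
  by have := ae_attach_card mn; apply: filterS => w.
(* The shift by [m] makes the segment contain the starting vertices, as [ae_dense_bounded] requires;
   [rigid_mono] later passes from [M] to [m + M]. *)
have ae2 : {ae P, forall w, forall M L, exists b, forall X : {fset nat},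
    rigid (graph w) (iset (m + M)) X ->
    (#|` (X `\` iset (m + M))%fset| <= L)%N -> below b X}.
  apply: ae_foralln => M; apply: ae_foralln => L.
  by apply: ae_dense_bounded; exact: leq_addr.
have ae3 : {ae P, forall w, forall v a, exists2 n, (m + (v.+1 + a) <= n)%N & graph w v n}.
  apply: ae_foralln => v; apply: ae_foralln => a.
  by apply: ae_attached; [exact: leq_addr|lia].
near=> w.
have c1 : forall n, (m <= n)%N -> #|N n w| = m by near: w.
have c2 : forall M L, exists b, forall X : {fset nat}, rigid (graph w) (iset (m + M)) X ->
    (#|` (X `\` iset (m + M))%fset| <= L)%N -> below b X by near: w.
have c3 : forall v a, exists2 n, (m + (v.+1 + a) <= n)%N & graph w v n by near: w.
have Esym := @nat_graph_sym m (fun n => N n w).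
apply: (@fo_eventually_constant (graph w) m) => //.
- exact: nat_graph_irr.
- move=> M L; have [b Hb] := c2 M L; exists b => X rX cX x xX.
  have MM : (iset M `<=` iset (m + M))%fset by apply: iset_leq; exact: leq_addl.
  apply: (Hb _ (rigid_mono Esym rX MM)); last by rewrite in_fsetU xX orbT.
  by apply: leq_trans cX; apply: fsubset_leq_card; fset_tac.
- move=> v b; have [n nb vn] := c3 v b; exists n; split=> //.
  by apply: leq_trans nb; lia.
- move=> v mv; exists [fset (val z : nat) | z in N v w]%fset; split.
  + rewrite card_imfset /=; last exact: val_inj.
    by rewrite -cardE c1.
  + by move=> x /imfsetP[z _ ->]; exact: ltn_ord.
  + move=> x /imfsetP[z /= zN ->]; rewrite nat_graph_sym nat_graph_lt //.
Unshelve. all: by end_near.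
Qed.

Lemma measurable_models (phi : fo) k :
  measurable [set w : Omega | fo_models (@ua_graph m (fun n => N n w) k) phi].
Proof.
have -> : [set w : Omega | fo_models (@ua_graph m (fun n => N n w) k) phi] =
    [set w | (fun E => fo_models (@ord_rel E (k + m)) phi) (graph w)].
  apply/seteqP; split=> w /=;
  by rewrite (_ : @ua_graph m (fun n => N n w) k = @ord_rel (graph w) (k + m)) //;
    apply/funext => i; apply/funext => j; apply: ua_graphE.
apply: (@measurable_graph (k + m) (fun E => fo_models (@ord_rel E (k + m)) phi)) => E E' EE.
rewrite (_ : @ord_rel E' (k + m) = @ord_rel E (k + m)) //.
by apply/funext => i; apply/funext => j; rewrite /ord_rel EE.
Qed.

(** The lower and upper limits of the events differ by a null set, and [P (A k)] is squeezed between
    the measures of [lo k] and [hi k], which converge by monotonicity. *)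
Lemma cvg_probability (A : nat -> set Omega) : (forall k, measurable (A k)) ->
  {ae P, forall w, exists k0, forall k k', (k0 <= k)%N -> (k0 <= k')%N -> A k w -> A k' w} ->
  cvgn (fun k => fine (P (A k))).
Proof.
move=> mA [Z [mZ Z0 AZ]].
pose lo k := \bigcap_(j in [set j | (k <= j)%N]) A j.
pose hi k := \bigcup_(j in [set j | (k <= j)%N]) A j.
have mlo k : measurable (lo k) by apply: bigcap_measurable => //; exists k => /=.
have mhi k : measurable (hi k) by apply: bigcup_measurable.
have mlim : measurable (lim_sup_set A).
  by apply: bigcap_measurable => // k _; exact: mhi.
have mUlo : measurable (\bigcup_k lo k) by apply: bigcup_measurable => k _; exact: mlo.
have cvlo : P (lo k) @[k --> \oo] --> P (\bigcup_k lo k).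
  apply: nondecreasing_cvg_mu => // i j ij; apply/subsetPset => w H k /= jk.
  by apply: H => /=; apply: leq_trans jk.
have cvhi : P (hi k) @[k --> \oo] --> P (lim_sup_set A).
  apply: lim_sup_set_cvg => //; apply: le_lt_trans (probability_le1 P (mhi 0%N)) _; exact: ltry.
have eqP_ : P (\bigcup_k lo k) = P (lim_sup_set A).
  apply/eqP; rewrite eq_le; apply/andP; split.
    apply: le_measure; rewrite ?inE // => w [k _ H] j _.
    by exists (maxn j k); [exact: leq_maxl|apply: H => /=; exact: leq_maxr].
  apply: (@le_trans _ _ (P (\bigcup_k lo k `|` Z))).
    apply: le_measure; rewrite ?inE //; first exact: measurableU.
    move=> w Hw; have [Zw|nZw] := pselect (Z w); [by right|left].
    have [k0 H] : exists k0, forall k k', (k0 <= k)%N -> (k0 <= k')%N -> A k w -> A k' w.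
      by apply: contrapT => nH; apply: nZw; apply: AZ.
    have [k k0k Ak] := Hw k0 I; exists k0 => // j /= k0j; exact: H Ak.
  by apply: le_trans (measureU2 _ _ _) _ => //; rewrite [X in (_ + X)%E]Z0 adde0.
apply/cvg_ex; exists (fine (P (lim_sup_set A))).
apply: fine_cvg; rewrite fineK ?fin_num_measure //.
apply: (@squeeze_cvge _ _ _ _ (fun k => P (lo k)) _ (fun k => P (hi k))) => //.
  apply: nearW => k; apply/andP; split; apply: le_measure; rewrite ?inE //.
    by move=> w; apply => /=.
  by move=> w Aw; exists k => /=.
by rewrite -eqP_.
Qed.

End Probability.

Theorem theorem1 (R : realType) (d : measure_display)
    (Omega : measurableType d) (P : probability Omega R) (m : nat)
    (N : forall n : nat, Omega -> {set 'I_n}) :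
  (0 < m)%N -> uniform_attachment P m N ->
  forall phi : fo, fo_sentence phi -> (fo_nb_vars phi + 2 <= m)%N ->
    cvgn (ua_prob P m N phi).
Proof.
move=> m0 UA phi sen vm; apply: (@cvg_probability _ _ _ P
  (fun k => [set w | fo_models (@ua_graph m (fun n => N n w) k) phi])).
  by move=> k; apply: (measurable_models UA).
apply: filterS (ae_eventually_constant m0 UA sen vm) => w [n0 H]; exists n0 => k k' k0 k0' Hk env'.
have graphE j : @ua_graph m (fun n => N n w) j = @ord_rel (nat_graph m (fun n => N n w)) (j + m).
  by apply/funext => i; apply/funext => i'; apply: ua_graphE.
(* [Hk] speaks about all assignments; a vertex is needed to have one. *)
have km : (0 < k + m)%N by rewrite addn_gt0 m0 orbT.
have := Hk (fun=> Ordinal km); rewrite !graphE.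
by rewrite (H _ _ _ env') // (leq_trans _ (leq_addr _ _)).
Qed.
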